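(* Let $F=L+K$ be a continuously differentiable $\mathcal{LS}$-vector field and let $U$ be an isolating neighborhood for the flow $\varphi$ generated by $F$. Then $\varphi$ is related by continuation in $U$ to a gradient flow (generated by $\nabla f$) of a function $f:U\to\mathbb{R}$ of the form $$f(x)=\tfrac12\langle Lx,x\rangle-b(x),$$ where $b$ has finite-dimensional support.
   Context: $\mathbb{H}$ is a real separable Hilbert space. $L:\mathbb{H}\to\mathbb{H}$ is a fixed bounded selfadjoint invertible linear operator for which there is an increasing sequence of finite-dimensional subspaces $E_n\subset\mathbb{H}$ with $\overline{\bigcup_n E_n}=\mathbb{H}$ and $L(E_n)=E_n$; $P_n:\mathbb{H}\to\mathbb{H}$ is the orthogonal projection onto $E_n$. An $\mathcal{LS}$-vector field is a globally Lipschitz vector field $F=L+K$ where $K$ is completely continuous (maps bounded sets into precompact sets); an $\mathcal{LS}$-flow is a flow generated by an $\mathcal{LS}$-vector field. The global Lipschitz condition is a convenience ensuring global flows; since only the flow near isolated invariant sets matters, locally Lipschitz vector fields and local flows (such as the gradient flow of a function given only on $U$) are allowed in the same role. A function $b$ has finite-dimensional support if there exists $n$ such that $b(P_n x)=b(x)$ for all $x$. $\mathrm{Inv}(U,\varphi)$ is the set of $x\in U$ whose whole $\varphi$-orbit is contained in $U$; a closed and bounded set $U$ is an isolating neighborhood for $\varphi$ if $\mathrm{Inv}(U,\varphi)\subset\mathrm{int}\,U$. Two $\mathcal{LS}$-flows $\varphi_0,\varphi_1$ are related by continuation in $U$ if there is a continuous map $H:[0,1]\times\mathbb{H}\times\mathbb{R}\to\mathbb{H}$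 with $H(0,x,t)=\varphi_0(x,t)$ and $H(1,x,t)=\varphi_1(x,t)$ for all $(x,t)$, such that each $H(s,\cdot,\cdot)$ is an $\mathcal{LS}$-flow with isolating neighborhood $U$. *)

(* Defs.v *)
From mathcomp Require Export all_boot all_order all_algebra.
From mathcomp Require Export all_classical all_reals all_analysis.
Export Order.TTheory GRing.Theory Num.Theory numFieldNormedType.Exports.

Set Implicit Arguments.
Unset Strict Implicit.
Unset Printing Implicit Defensive.

Global Open Scope classical_set_scope.
Global Open Scope ring_scope.

(* A real Hilbert space is a complete normed module over R together with a
   positive definite symmetric form [ip] inducing its norm. *)
Definition hilbert_norm (R : realType) (H : completeNormedModType R)
    (ip : {dot H for idfun}) : Prop :=
  forall x : H, `|x| ^+ 2 = ip x x.

Definition separable (T : topologicalType) : Prop :=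
  exists2 D : set T, countable D & dense D.

Section Operators.
Variables (R : realType) (H : completeNormedModType R).
Variable ip : {dot H for idfun}.
Implicit Types (L M : {linear H -> H}) (E : set H) (P : H -> H).

Definition bounded_operator L : Prop :=
  exists C : R, forall x, `|L x| <= C * `|x|.

Definition selfadjoint L : Prop := forall x y, ip (L x) y = ip x (L y).

Definition invertible_operator L : Prop :=
  exists M, [/\ bounded_operator M, cancel L M & cancel M L].

Definition fin_dim_subspace E : Prop :=
  exists (k : nat) (v : 'I_k -> H),
    E = range (fun c : 'I_k -> R => \sum_(i < k) c i *: v i).

Definition orthogonal_projection E P : Prop :=
  forall x, E (P x) /\ (forall y, E y -> ip (x - P x) y = 0).

Definition fin_dim_support (P : nat -> H -> H) (b : H -> R) : Prop :=
  exists n, forall x, b (P n x) = b x.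

End Operators.

Section VectorFieldsAndFlows.
Variables (R : realType) (H : completeNormedModType R).
Implicit Types (L : {linear H -> H}) (F K : H -> H) (U : set H).
Implicit Types phi : H -> R -> H.

(* Continuity of the derivative is for the operator norm. *)
Definition continuously_differentiable F : Prop :=
  (forall x, differentiable F x) /\
  (forall x (e : R), 0 < e ->
     \forall y \near x, forall v, `|'d F y v - 'd F x v| <= e * `|v|).

(* Only the compactness half of complete continuity: below, K = F - L is
   continuous because F and L are Lipschitz. *)
Definition completely_continuous K : Prop :=
  forall B : set H, bounded_set B -> precompact (K @` B).

Definition LS_vector_field L F : Prop :=
  lipschitz F /\
  exists2 K, completely_continuous K & forall x, F x = L x + K x.

Definition flow phi : Prop :=
  [/\ continuous (fun p : H * R => phi p.1 p.2),
      forall x, phi x 0 = x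
    & forall x s t, phi x (s + t) = phi (phi x s) t].

Definition generated_by F phi : Prop :=
  flow phi /\ forall x (t : R), is_derive t 1 (phi x) (F (phi x t)).

Definition LS_flow L phi : Prop :=
  exists2 F, LS_vector_field L F & generated_by F phi.

Definition Inv U phi : set H := [set x | U x /\ forall t, U (phi x t)].

Definition isolating_neighborhood U phi : Prop :=
  [/\ closed U, bounded_set U & Inv U phi `<=` U°].

Definition related_by_continuation L U phi0 phi1 : Prop :=
  exists h : R * H * R -> H,
    [/\ {within (`[0, 1] `*` setT) `*` setT, continuous h},
        forall x t, h (0, x, t) = phi0 x t,
        forall x t, h (1, x, t) = phi1 x t
      & forall s : R, 0 <= s <= 1 ->
          LS_flow L (fun x t => h (s, x, t)) /\
          isolating_neighborhood U (fun x t => h (s, x, t))].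

Definition is_gradient (ip : {dot H for idfun}) (f : H -> R) (x g : H) : Prop :=
  differentiable f x /\ forall v, 'd f x v = ip g v.

(* The gradient flow of a function that matters only on U: [phi] is an
   LS-flow whose vector field is the gradient of [f] at every point of U and is
   unconstrained off U. *)
Definition LS_gradient_flow_on (ip : {dot H for idfun}) L U
    (f : H -> R) phi : Prop :=
  exists F, [/\ LS_vector_field L F, generated_by F phi
              & forall x, U x -> is_gradient ip f x (F x)].

End VectorFieldsAndFlows.

(* Main.v *)
Require Import Defs.
From mathcomp Require Import ring lra.

Set Implicit Arguments.
Unset Strict Implicit.
Unset Printing Implicit Defensive.

(** Let [0 <= w <= 1] be 1-Lipschitz and vanish exactly near [U].  The values
    [sup_(t >= 0) exp (- l t) w (phi x (+- t))] are 1-Lipschitz, and as long as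
    the orbit of [x] stays in [w = 0] they are multiplied by [exp (+- l t)] along
    it; so their difference [g] is a Lipschitz Lyapunov function near [U], which
    increases at least at the rate [l G], [G] being their sum.  Since [L] is
    hyperbolic, an orbit that stays near [U] for a long time is almost contained
    in some [E n]; by compactness it starts deep inside [U].  Hence [G] is
    bounded below on the part of [U] that is not deep inside [U].

    Averaging [g] over small boxes parallel to [E n] makes it C^1 with Lipschitz
    gradient on [E n].  With [x = y + z], [y = P n x], put
    [f x = th * g y + 1/2 <L z, z>], with [th] small first and then [n] large.
    As [g] is only Lipschitz, [<grad f, F>] exceeds
    [S x = th * l * G y + c^2/4 |z|^2] up to an error [C th^2] only.  But where
    [S < 2 C th^2] we also have [|f| = O(th^2)], while an orbit of
    [(1 - s) F + s grad f] inside [U] that passes through a point not interior to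
    [U] gains an amount of order [th] in [f] nearby; so it can never come back to
    small values of [|f|], and [f] would be unbounded on it in forward or
    backward time. *)

(** The function [g] is a difference of suprema, hence only Lipschitz, and averaging acts along
    finitely many directions only. Its growth is therefore recorded as a lower bound for finite
    increments along segments, with an error quadratic in the step. Such a bound passes through
    averages, and becomes a bound for a derivative only after smoothing. The Lipschitz constant of
    the smoothed gradient depends on the box and on [n] but need only be finite, so both can be
    chosen after [th].

    Isolation holds along the whole straight homotopy for the following reason. Where
    [<grad f, F> >= nu] and [|F| <= M], also [|grad f| >= nu / M]; hence along
    [X = (1 - s) F + s grad f] the derivative [(1 - s) <grad f, F> + s |grad f|^2] of [f] is at
    least [(nu / M) |X|], whatever [s] is. So the gain of [f] over a distance [d] does not depend on
    the speed of the orbit. It is linear in [th], against values [O(th^2)] in the region where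
    growth may fail; this gap is what makes a small [th] work. *)

(** * Inner product: bilinearity and the Cauchy-Schwarz inequality *)

Section InnerProduct.
Variables (R : realType) (H : completeNormedModType R).
Variables (ip : {dot H for idfun}) (ip_norm : hilbert_norm ip).
Implicit Types (x y z : H) (a : R).

Lemma ipC x y : ip x y = ip y x.
Proof. by have := @hermitian_subproof _ _ _ _ ip x y; rewrite expr0 mul1r. Qed.

Lemma ipDr x y z : ip x (y + z) = ip x y + ip x z.
Proof. by rewrite linearD. Qed.

Lemma ipDl x y z : ip (x + y) z = ip x z + ip y z.
Proof. by rewrite !(ipC _ z) ipDr. Qed.

Lemma ipZr a x y : ip x (a *: y) = a * ip x y.
Proof. by rewrite linearZ. Qed.

Lemma ipZl a x y : ip (a *: x) y = a * ip x y.
Proof. by rewrite !(ipC _ y) ipZr. Qed.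

Lemma ipNr x y : ip x (- y) = - ip x y.
Proof. by rewrite linearN. Qed.

Lemma ipNl x y : ip (- x) y = - ip x y.
Proof. by rewrite !(ipC _ y) ipNr. Qed.

Lemma ipBl x y z : ip (x - y) z = ip x z - ip y z.
Proof. by rewrite ipDl ipNl. Qed.

Lemma ipBr x y z : ip x (y - z) = ip x y - ip x z.
Proof. by rewrite ipDr ipNr. Qed.

Lemma ip0r x : ip x 0 = 0.
Proof. by rewrite linear0. Qed.

Lemma ip0l x : ip 0 x = 0.
Proof. by rewrite ipC ip0r. Qed.

Lemma ip_suml (I : Type) (s : seq I) (f : I -> H) y :
  ip (\sum_(i <- s) f i) y = \sum_(i <- s) ip (f i) y.
Proof. by elim/big_rec2: _ => [|i a b _ <-]; rewrite ?ip0l ?ipDl. Qed.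

Lemma normDsqr x y : `|x + y| ^+ 2 = `|x| ^+ 2 + 2 * ip x y + `|y| ^+ 2.
Proof. by rewrite !ip_norm !ipDl !ipDr (ipC y x); ring. Qed.

Lemma normBsqr x y : `|x - y| ^+ 2 = `|x| ^+ 2 - 2 * ip x y + `|y| ^+ 2.
Proof. by rewrite !ip_norm !ipBl !ipBr (ipC y x); ring. Qed.

Lemma ip_le x y : ip x y <= `|x| * `|y|.
Proof.
have [->|x0] := eqVneq x 0; first by rewrite ip0l normr0 mul0r.
have [->|y0] := eqVneq y 0; first by rewrite ip0r normr0 mulr0.
have xp : 0 < `|x| by rewrite normr_gt0.
have yp : 0 < `|y| by rewrite normr_gt0.
(* The square of [|y| x - |x| y] equals [2 |x| |y| (|x| |y| - <x, y>)]. *)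
have := sqr_ge0 `|(`|y| *: x) - (`|x| *: y)|.
rewrite normBsqr !normrZ !normr_id ipZl ipZr => h.
have : 0 <= 2 * (`|x| * `|y|) * (`|x| * `|y| - ip x y) by nra.
by rewrite pmulr_rge0 ?subr_ge0// !mulr_gt0.
Qed.

Lemma ip_abs x y : `|ip x y| <= `|x| * `|y|.
Proof.
by rewrite ler_norml ip_le andbT lerNl -ipNl -(normrN x) ip_le.
Qed.

Lemma ip_inj x y : (forall z, ip x z = ip y z) -> x = y.
Proof.
move=> h; apply/eqP; rewrite -subr_eq0 -normr_eq0 -sqrf_eq0 ip_norm.
by rewrite ipBl h subrr.
Qed.

Lemma normr_le_ip x (C : R) :
  0 <= C -> (forall z, ip x z <= C * `|z|) -> `|x| <= C.
Proof.
move=> C0 h; have [->|x0] := eqVneq x 0; first by rewrite normr0.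
have xp : 0 < `|x| by rewrite normr_gt0.
by have := h x; rewrite -ip_norm expr2 ler_pM2r.
Qed.

End InnerProduct.

(** * Derivatives of real functions and of curves in [H] *)

Section RealCalculus.
Variable R : realType.
Implicit Types (f df : R -> R) (a b C : R).

Lemma is_derive1_continuous (V : normedModType R) (f : R -> V) (x : R) v :
  is_derive x 1 f v -> {for x, continuous f}.
Proof. by move=> d; apply/differentiable_continuous/derivable1_diffP. Qed.

Lemma is_derive_nonincr f df a b : a <= b ->
  (forall t, a <= t <= b -> is_derive t 1 f (df t)) ->
  (forall t, a <= t <= b -> df t <= 0) -> f b <= f a.
Proof.
rewrite le_eqVlt => /predU1P[->//|ab] d df0.
have [x||c] := @MVT R f df a b ab.
- by rewrite in_itv/= => /andP[/ltW ax /ltW xb]; apply: d; rewrite ax xb.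
- apply: continuous_in_subspaceT => x.
  by rewrite inE/= in_itv/= => /d/is_derive1_continuous.
rewrite in_itv/= => /andP[/ltW ac /ltW cb] /eqP.
rewrite subr_eq => /eqP ->.
by rewrite gerDr mulr_le0_ge0 ?subr_ge0 ?(ltW ab)// df0// ac.
Qed.

(* At its last nonnegative time [f] would have to be increasing. *)
Lemma is_derive_trapped f df (T nu : R) : 0 <= T -> 0 < nu ->
  (forall t, 0 <= t <= T -> is_derive t 1 f (df t)) -> 0 <= f 0 ->
  (forall t, 0 <= t <= T -> 0 <= f t -> nu <= df t) -> nu * T <= f T.
Proof.
move=> T0 nu0 d f0 grow.
suff pos t : 0 <= t <= T -> 0 <= f t.
  have := @is_derive_nonincr (fun t => nu * t - f t) (fun t => nu - df t) 0 T T0.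
  rewrite mulr0 sub0r lerBlDr => h.
  apply: le_trans (h _ _) _; last by rewrite gerDr oppr_le0.
  - move=> t tT; have := d _ tT => dt.
    by apply: is_derive_eq; rewrite /GRing.scale/= mulr1.
  - by move=> t tT; rewrite subr_le0 grow// pos.
move=> /andP[t0 tT]; rewrite leNgt; apply/negP => ft.
pose A := [set s | 0 <= s <= t /\ 0 <= f s].
have A0 : A 0 by split; rewrite ?lexx.
have Asup : has_sup A.
  by split; [exists 0|exists t => s [/andP[]]].
set s := sup A.
have s0 : 0 <= s by exact: (ub_le_sup Asup.2).
have st : s <= t by apply: ge_sup; [exists 0|move=> u [/andP[]]].
have sT : 0 <= s <= T by rewrite s0 (le_trans st).
have ds := d _ sT; have cs := is_derive1_continuous ds.
have fs : 0 <= f s.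
  rewrite leNgt; apply/negP => fs.
  have : \forall u \near s, f u < 0 by exact: cvgr_lt cs _ fs.
  move=> /nbhs_ballP[e /= e0 he].
  have [u [/andP[u0 ut] fu] us] := sup_adherent e0 Asup.
  have : f u < 0.
    apply: he; rewrite /ball/= ger0_norm; last by rewrite subr_ge0 (ub_le_sup Asup.2)//; split; rewrite ?u0.
    by rewrite ltrBlDl -ltrBlDr.
  by rewrite ltNge fu.
have {}st : s < t by rewrite lt_neqAle st andbT; apply/eqP => E; rewrite E leNgt ft in fs.
have dfs := grow _ sT fs.
have : \forall h \near (0 : R)^', 0 < h^-1 *: ((f \o shift s) (h *: 1) - f s).
  have h : h^-1 *: ((f \o shift s) (h *: 1) - f s) @[h --> 0^'] --> df s.
    rewrite -(@derive_val _ _ _ _ _ _ _ ds).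
    exact: ex_derive.
  by apply: cvgr_gt h _ _; exact: lt_le_trans nu0 dfs.
move=> /nbhs_ballP[e /= e0 he].
(* Since the derivative at [s] is positive, [f] exceeds [f s >= 0] just to the right of [s]. The
   step does not pass [t], so [h + s] lies in [A] beyond its supremum. *)
pose h := Num.min (e / 2) (t - s).
have h0 : 0 < h by rewrite lt_min divr_gt0//= subr_gt0.
have := he h; rewrite /ball/= sub0r normrN gtr0_norm//.
rewrite gt_min ltr_pdivrMr// ltr_pMr// ltr1n/= => /(_ isT).
rewrite gt_eqF// => /(_ isT).
rewrite /GRing.scale/= mulr1 pmulr_rgt0 ?invr_gt0// => hfs.
have : h + s <= s.
  apply: (ub_le_sup Asup.2).
  split; last by apply: le_trans fs _; rewrite ltW// -subr_gt0.
  by rewrite addr_ge0 ?(ltW h0)//= -lerBrDr ge_min lexx orbT.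
by rewrite gerDr leNgt h0.
Qed.

End RealCalculus.

Lemma differentiable_from_bound (R : realType) (V W : normedModType R)
    (f : V -> W) (df : {linear V -> W}) (x : V) : continuous df ->
  (forall e : R, 0 < e ->
    \forall h \near (0 : V), `|f (h + x) - f x - df h| <= e * `|h|) ->
  differentiable f x /\ 'd f x = df :> (V -> W).
Proof.
move=> dfc fe.
have o : f \o shift x = cst (f x) + df +o_ (0 : V) id.
  apply/eqaddoP => e /fe; apply: filterS => h.
  by rewrite [(_ - _) h]/= opprD addrA.
have d := diff_unique dfc o.
split=> //; apply/diff_locallyP; split; first by rewrite d.
by rewrite d.
Qed.

(** Free of quotients, this form of the derivative passes directly through linear maps with a norm
    bound and through changes of sign or origin of time. *)
Lemma is_derive1P (R : realType) (V : normedModType R) (f : R -> V) (x : R) v :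
  is_derive x 1 f v <-> (forall e : R, 0 < e ->
    \forall h \near (0 : R), `|f (h + x) - f x - h *: v| <= e * `|h|).
Proof.
have E h (e : R) : h != 0 -> (`|v - h^-1 *: (f (h *: 1 + x) - f x)| <= e) =
    (`|f (h + x) - f x - h *: v| <= e * `|h|).
  move=> h0; have h1 : h *: (1 : R) = h by rewrite /GRing.scale/= mulr1.
  have {1}-> : v = h^-1 *: (h *: v) by rewrite scalerA mulVf// scale1r.
  rewrite h1 -scalerBr.
  rewrite normrZ normrV ?unitfE// ler_pdivrMl ?normr_gt0//.
  by rewrite mulrC distrC.
split=> [d e e0|h].
  have : h^-1 *: ((f \o shift x) (h *: 1) - f x) @[h --> 0^'] --> v.
    by rewrite -(@derive_val _ _ _ _ _ _ _ d); exact: ex_derive.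
  move=> /cvgrPdist_le /(_ e e0)/nbhs_ballP[r /= r0 hr].
  apply/nbhs_ballP; exists r => //= y yr.
  have [->|y0] := eqVneq y 0.
    by rewrite add0r subrr scale0r subr0 !normr0 mulr0.
  by rewrite -E//; apply: hr.
have c : h^-1 *: ((f \o shift x) (h *: 1) - f x) @[h --> 0^'] --> v.
  apply/cvgrPdist_le => e /h /nbhs_ballP[r /= r0 hr].
  apply/nbhs_ballP; exists r => //= y yr y0.
  by rewrite E//; apply: hr.
apply: DeriveDef; first by apply/cvg_ex; exists v.
exact: cvg_lim c.
Qed.

Section HilbertCalculus.
Variables (R : realType) (H : completeNormedModType R).
Variables (ip : {dot H for idfun}) (ip_norm : hilbert_norm ip).

(** Polarisation reduces continuity of the form to continuity of the norm. *)
Lemma cvg_ip (T : Type) (F : set_system T) (FF : Filter F) (f g : T -> H) a b :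
  f @ F --> a -> g @ F --> b -> (fun t => ip (f t) (g t)) @ F --> ip a b.
Proof.
have E x y : ip x y = 2^-1 * (`|x + y| ^+ 2 - `|x| ^+ 2 - `|y| ^+ 2).
  by rewrite (normDsqr ip_norm) (addrAC (_ + _)) addrK [_ + _ - _]addrAC subrr add0r mulKf.
move=> fa gb; rewrite E; under eq_fun do rewrite E.
by apply: cvgMr; apply: cvgB; [apply: cvgB|]; rewrite !expr2;
  apply: cvgM; apply: cvg_norm => //; apply: cvgD.
Qed.

Lemma is_derive_ip (f g : R -> H) (t : R) (df dg : H) :
  is_derive t 1 f df -> is_derive t 1 g dg ->
  is_derive t 1 (fun s => ip (f s) (g s)) (ip df (g t) + ip (f t) dg).
Proof.
move=> d1 d2.
have c1 : h^-1 *: ((f \o shift t) (h *: 1) - f t) @[h --> 0^'] --> df.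
  by rewrite -(@derive_val _ _ _ _ _ _ _ d1); exact: ex_derive.
have c2 : h^-1 *: ((g \o shift t) (h *: 1) - g t) @[h --> 0^'] --> dg.
  by rewrite -(@derive_val _ _ _ _ _ _ _ d2); exact: ex_derive.
have c0 : (fun h : R => h *: (1 : R) + t) @ (0 : R)^' --> t.
  apply: cvg_within_filter.
  have : (fun h : R => h *: (1 : R) + t) @ (0 : R) --> 0 *: (1 : R) + t.
    by apply: cvgD; [apply: cvgZr_tmp; apply: cvg_id|apply: cvg_cst].
  by rewrite scale0r add0r.
have c3 : (f \o shift t) (h *: 1) @[h --> 0^'] --> f t.
  by apply: (cvg_comp _ f c0); exact: (is_derive1_continuous d1).
have c : h^-1 *: (((fun s => ip (f s) (g s)) \o shift t) (h *: 1) -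
    ip (f t) (g t)) @[h --> 0^'] --> ip df (g t) + ip (f t) dg.
  apply: cvg_trans (cvgD (cvg_ip _ c1 (cvg_cst (g t))) (cvg_ip _ c3 c2)).
  apply: near_eq_cvg; near=> h; rewrite /=.
  rewrite addrfctE /= (ipZl ip) (ipZr ip) (ipBl ip) (ipBr ip).
  rewrite -[RHS]/(_ * (_ - _)).
  by ring.
apply: DeriveDef; first by apply/cvg_ex; eexists; exact: c.
exact: cvg_lim c.
Unshelve. all: by end_near. Qed.

End HilbertCalculus.

Section Reparametrisation.
Variables (R : realType) (V : normedModType R).

Lemma is_derive_comp_opp (f : R -> V) (t : R) v :
  is_derive (- t) 1 f v -> is_derive t 1 (fun s => f (- s)) (- v).
Proof.
move=> /is_derive1P d; apply/is_derive1P => e /d /nbhs_ballP[r /= r0 hr].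
apply/nbhs_ballP; exists r => //= h hr'.
have := hr (- h); rewrite /ball/= sub0r opprK => /(_ _).
rewrite /ball/= sub0r in hr'; rewrite normrN in hr'.
by rewrite opprD scalerN scaleNr normrN; exact.
Qed.

Lemma is_derive_comp_shift (f : R -> V) (t s : R) v :
  is_derive (t + s) 1 f v -> is_derive t 1 (fun u => f (u + s)) v.
Proof.
move=> /is_derive1P d; apply/is_derive1P => e /d; apply: filterS => h.
by rewrite addrA.
Qed.

(** Squaring makes the positive part continuously differentiable, which turns it into a cutoff
    usable in [escape]. *)
Lemma is_derive_maxsqr (t : R) :
  is_derive t 1 (fun s : R => Num.max 0 s ^+ 2) (2 * Num.max 0 t).
Proof.
apply/is_derive1P => e e0; apply/nbhs_ballP; exists e => //= h.
rewrite /ball/= sub0r normrN => he.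
apply: (@le_trans _ _ (`|h| * `|h|)); last by rewrite ler_wpM2r// ltW.
rewrite -expr2 real_normK ?num_real// /GRing.scale/= ler_norml.
have [th|th] := lerP 0 (h + t); have [t0|t0] := lerP 0 t; apply/andP; split; nra.
Qed.

End Reparametrisation.

Section HilbertCurves.
Variables (R : realType) (H : completeNormedModType R).
Variables (ip : {dot H for idfun}) (ip_norm : hilbert_norm ip).

Lemma is_derive_normsqr (f : R -> H) (t : R) df :
  is_derive t 1 f df ->
  is_derive t 1 (fun s => `|f s| ^+ 2) (2 * ip (f t) df).
Proof.
move=> d; have -> : (fun s => `|f s| ^+ 2) = (fun s => ip (f s) (f s)).
  by apply/funext => s; rewrite ip_norm.
apply: is_derive_eq (is_derive_ip ip_norm d d) _.
by rewrite (ipC ip df); ring.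
Qed.

(** Pairing [f] with the fixed vector [f b - f a] reduces the claim to monotonicity of one real
    function. *)
Lemma curve_mean_le (f df : R -> H) (g dg : R -> R) (a b : R) : a <= b ->
  (forall t, a <= t <= b -> is_derive t 1 f (df t)) ->
  (forall t, a <= t <= b -> is_derive t 1 g (dg t)) ->
  (forall t, a <= t <= b -> `|df t| <= dg t) ->
  `|f b - f a| <= g b - g a.
Proof.
move=> ab d1 d2 le.
have gab : 0 <= g b - g a.
  rewrite subr_ge0 -lerN2; apply: (@is_derive_nonincr R (fun t => - g t) (fun t => - dg t) a b ab).
    by move=> t /d2 dt; exact: is_deriveN.
  by move=> t /le; rewrite oppr_le0; exact: le_trans.
set v := f b - f a; have [->|v0] := eqVneq v 0; first by rewrite normr0.
have vp : 0 < `|v| by rewrite normr_gt0.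
rewrite -(ler_pM2r vp) -expr2 ip_norm {1}/v (ipBl ip).
have h := @is_derive_nonincr R (fun t => ip (f t) v - g t * `|v|)
  (fun t => ip (df t) v - dg t * `|v|) a b ab.
suff : ip (f b) v - g b * `|v| <= ip (f a) v - g a * `|v| by lra.
apply: h => t tab.
  have dt1 := d1 _ tab; have dt2 := d2 _ tab.
  apply: is_deriveB.
    apply: is_derive_eq (is_derive_ip ip_norm dt1 (is_derive_cst v t 1)) _.
    by rewrite (ip0r ip) addr0.
  apply: is_derive_eq; rewrite scaler0 add0r /GRing.scale/=.
  exact: mulrC.
rewrite subr_le0 (le_trans (ip_le ip_norm _ _))// ler_wpM2r//.
exact: le.
Qed.

(** The norm is not differentiable where [z] vanishes, so [sqrt (|z|^2 + s^2)] is estimated instead.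
    Multiplied by [exp (- l t)], it grows at most at the rate [e]. *)
Lemma gronwall (z dz : R -> H) (l e T : R) : 0 <= T -> 0 <= l -> 0 <= e ->
  (forall t, 0 <= t <= T -> is_derive t 1 z (dz t)) ->
  (forall t, 0 <= t <= T -> `|dz t| <= l * `|z t| + e) ->
  `|z T| <= (`|z 0| + e * T) * expR (l * T).
Proof.
move=> T0 l0 e0 d le; apply/ler_addgt0Pr => r r0.
(* With this regularisation the surplus at time [T] is exactly [r]. *)
pose s := r * expR (- (l * T)).
have s0 : 0 < s by rewrite mulr_gt0// expR_gt0.
have Ns t : 0 < `|z t| ^+ 2 + s ^+ 2 by rewrite ltr_wpDl// exprn_gt0.
pose N t := Num.sqrt (`|z t| ^+ 2 + s ^+ 2).
have N0 t : 0 < N t by rewrite sqrtr_gt0.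
have zN t : `|z t| <= N t.
  by rewrite -[leLHS](ger0_norm (normr_ge0 _)) -sqrtr_sqr ler_wsqrtr// lerDl sqr_ge0.
have dN t : 0 <= t <= T -> is_derive t 1 N (ip (z t) (dz t) / N t).
  move=> /d dt; have := is_derive_normsqr dt => dt2.
  have dt3 : is_derive t 1 (fun u => `|z u| ^+ 2 + s ^+ 2) (2 * ip (z t) (dz t)).
    by apply: is_derive_eq; rewrite addr0.
  have := @is_derive1_comp R Num.sqrt (fun u => `|z u| ^+ 2 + s ^+ 2) t _ _
    (is_derive1_sqrt (Ns t)) dt3.
  move=> /is_derive_eq; apply.
  by rewrite -/(N t) invfM; field; rewrite gt_eqF.
have := @is_derive_nonincr R (fun t => expR (- (l * t)) * N t - e * t)
  (fun t => expR (- (l * t)) * (ip (z t) (dz t) / N t - l * N t) - e) 0 T T0.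
rewrite !mulr0 oppr0 expR0 mul1r addr0 => h.
have {}h : expR (- (l * T)) * N T <= N 0 + e * T.
  rewrite -lerBlDr; apply: h => t tT.
    have dt := dN _ tT.
    have dl : is_derive t 1 (fun u => - (l * u)) (- l).
      by apply: is_derive_eq; rewrite /GRing.scale/= mulr1.
    have de := @is_derive1_comp R expR (fun u => - (l * u)) t _ _
      (is_derive_expR (- (l * t))) dl.
    rewrite /comp in de.
    apply: is_deriveB; last first.
      by apply: is_derive_eq; rewrite /GRing.scale/= mulr1.
    apply: is_derive_eq; rewrite /GRing.scale/=; ring.
  rewrite subr_le0; have [tt _] := andP tT.
  have E1 : expR (- (l * t)) <= 1 by rewrite expR_le1 oppr_le0 mulr_ge0.
  have E0 := expR_gt0 (- (l * t)).
  suff : ip (z t) (dz t) / N t - l * N t <= e by nra.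
  rewrite lerBlDr ler_pdivrMr//.
  apply: le_trans (ip_le ip_norm _ _) _.
  have := le _ tT; have := zN t; have := N0 t.
  have := normr_ge0 (z t); have := normr_ge0 (dz t).
  set p := `|z t|; set q := `|dz t|; set n := N t => q0 p0 n0 pn ql.
  apply: (@le_trans _ _ (n * q)); first by rewrite ler_wpM2r.
  rewrite mulrC ler_wpM2r ?(ltW n0)//; apply: le_trans ql _.
  by rewrite addrC lerD2l ler_wpM2l.
have {h} h : N T <= (N 0 + e * T) * expR (l * T).
  by rewrite mulrC -ler_pdivrMl ?expR_gt0// -expRN.
have N0s : N 0 <= `|z 0| + s.
  rewrite -[leRHS]ger0_norm; last by rewrite addr_ge0// ltW.
  rewrite -sqrtr_sqr ler_wsqrtr//.
  by rewrite sqrrD lerD2r lerDl mulrn_wge0// mulr_ge0// ltW.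
have sr : s * expR (l * T) = r by rewrite /s -mulrA -expRD addNr expR0 mulr1.
apply: le_trans (zN _) _; apply: le_trans h _.
rewrite -[in leRHS]sr -mulrDl ler_wpM2r ?expR_ge0//.
by rewrite addrAC lerD2r.
Qed.

(** The function [h = a - k (1 - max 0 u ^+ 2)] charges for the distance from [g 0]: nothing at the
    start, the full price [k] from distance [d] on. The price rises at most at the rate
    [4 k / d |dg|], because [max 0 u <= 1] and [|du| <= 2 / d |dg|]. Hence [h] grows wherever it is
    nonnegative: inside the ball by the first growth hypothesis, outside because [h >= 0] means
    [a >= k] there. *)
Lemma escape (g dg : R -> H) (a da : R -> R) (T d k nu : R) :
  0 <= T -> 0 < d -> 0 <= k -> 0 < nu ->
  (forall t, 0 <= t <= T -> is_derive t 1 g (dg t)) ->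
  (forall t, 0 <= t <= T -> is_derive t 1 a (da t)) -> 0 <= a 0 ->
  (forall t, 0 <= t <= T -> `|g t - g 0| < d ->
     nu + 4 * k / d * `|dg t| <= da t) ->
  (forall t, 0 <= t <= T -> d <= `|g t - g 0| -> k <= a t -> nu <= da t) ->
  nu * T <= a T.
Proof.
move=> T0 d0 k0 nu0 Dg Da a0 near far.
pose u t := 1 - d ^- 2 * `|g t - g 0| ^+ 2.
pose du t := - (d ^- 2 * (2 * ip (g t - g 0) (dg t))).
pose h t := a t - k * (1 - Num.max 0 (u t) ^+ 2).
pose dh t := da t + k * (2 * Num.max 0 (u t) * du t).
have d20 : 0 < d ^- 2 by rewrite invr_gt0 exprn_gt0.
have u1 t : u t <= 1 by rewrite gerBl mulr_ge0// ltW.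
have m1 t : 0 <= Num.max 0 (u t) <= 1 by rewrite le_max lexx ge_max ler01 u1.
have ha t : h t <= a t.
  rewrite gerBl mulr_ge0// subr_ge0 expr_le1//; by case/andP: (m1 t).
apply: le_trans (ha T); apply: (@is_derive_trapped _ h dh) => //.
- move=> t tT; have dt := Da _ tT; have dgt := Dg _ tT.
  have dg1 : is_derive t 1 (fun s => g s - g 0) (dg t).
    by apply: is_derive_eq; rewrite subr0.
  have dg2 := is_derive_normsqr dg1.
  have dut : is_derive t 1 u (du t).
    by apply: is_derive_eq; rewrite /GRing.scale/= /du; ring.
  have dm := @is_derive1_comp R (fun s => Num.max 0 s ^+ 2) u t _ _
    (is_derive_maxsqr (u t)) dut; rewrite /comp in dm.
  by apply: is_derive_eq; rewrite /GRing.scale/= /dh; ring.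
- by rewrite /h /u subrr normr0 expr0n/= mulr0 subr0 max_r// expr1n subrr mulr0 subr0.
- move=> t tT ht; have [gd|gd] := ltP `|g t - g 0| d.
    apply: le_trans (_ : nu <= da t - 4 * k / d * `|dg t|) _.
      by rewrite lerBrDr near.
    rewrite lerD2l lerNl -mulrN; have /andP[m0 m1t] := m1 t.
    have q0 := normr_ge0 (dg t).
    have : - du t <= 2 / d * `|dg t|.
      rewrite /du opprK; apply: (@le_trans _ _ (d ^- 2 * (2 * (d * `|dg t|)))).
        rewrite ler_pM2l// ler_pM2l//; apply: le_trans (ip_le ip_norm _ _) _.
        by rewrite ler_wpM2r// ltW.
      by rewrite le_eqVlt; apply/orP; left; apply/eqP; field; rewrite gt_eqF.
    set q := 2 / d * `|dg t| => dq.
    have -> : 4 * k / d * `|dg t| = k * (2 * q) by rewrite /q; ring.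
    rewrite ler_wpM2l// -mulrA -mulrN mulrC.
    have qp : 0 <= q by rewrite !mulr_ge0 ?invr_ge0// ltW.
    by move: m0 m1t dq qp; set m := Num.max _ _; nra.
  have mt : Num.max 0 (u t) = 0.
    apply/max_l; rewrite subr_le0 mulrC ler_pdivlMr ?exprn_gt0// mul1r.
    by rewrite ler_sqr ?nnegrE// ltW.
  move: ht; rewrite /h /dh mt mulr0 mul0r mulr0 addr0 expr0n/= subr0 mulr1 subr_ge0.
  exact: far.
Qed.

End HilbertCurves.

Section Gradient.
Variables (R : realType) (H : completeNormedModType R).
Variables (ip : {dot H for idfun}) (ip_norm : hilbert_norm ip).

Lemma is_gradient_from_bound (f : H -> R) (x g : H) :
  (forall e : R, 0 < e ->
    \forall h \near (0 : H), `|f (h + x) - f x - ip g h| <= e * `|h|) ->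
  is_gradient ip f x g.
Proof.
move=> fe; have c : continuous (ip g).
  by move=> y; apply: (cvg_ip ip_norm); [exact: cvg_cst|exact: cvg_id].
have [d1 d2] := @differentiable_from_bound R H R f (ip g) x c fe.
by split=> // v; rewrite d2.
Qed.

Lemma is_gradient_comp (f : H -> R) (c : R -> H) (t : R) (g v : H) :
  is_gradient ip f (c t) g -> is_derive t 1 c v ->
  is_derive t 1 (fun s => f (c s)) (ip g v).
Proof.
move=> [df fg] dc.
have dc1 : differentiable c t by exact/derivable1_diffP.
have dfc : differentiable (f \o c) t by exact: differentiable_comp.
apply: DeriveDef; first by apply/derivable1_diffP.
rewrite -[fun s => _]/(f \o c) deriveE// diff_comp//= -(deriveE _ dc1).
by rewrite (@derive_val _ _ _ _ _ _ _ dc) fg.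
Qed.

End Gradient.

(** * Completeness, antiderivatives and the Riesz representation *)

Lemma seq_complete (R : realType) (H : completeNormedModType R) (u : nat -> H) :
  (forall e : R, 0 < e -> exists N, forall m, (N <= m)%N -> `|u N - u m| < e) ->
  exists x : H, u @ \oo --> x.
Proof.
move=> h; apply/cvg_ex; apply/cauchy_cvgP; apply: cauchy_exP => e /h[N hN].
exists (u N); exists N => // m /= Nm.
by rewrite -ball_normE /ball_/=; exact: hN.
Qed.

Section ScalarAntiderivative.
Variable R : realType.
Implicit Types (f df : R -> R) (a b C : R).

(** Controlling the derivative on the whole ball about [a] through [b] covers increments of either
    sign at once. *)
Lemma is_derive_lip f df a b C :
  (forall s, `|s - a| <= `|b - a| -> is_derive s 1 f (df s)) ->
  (forall s, `|s - a| <= `|b - a| -> `|df s| <= C) ->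
  `|f b - f a| <= C * `|b - a|.
Proof.
have main (p q : R) : p <= q -> (forall s : R, p <= s <= q -> is_derive s 1 f (df s)) ->
    (forall s, p <= s <= q -> `|df s| <= C) -> `|f q - f p| <= C * (q - p).
  move=> pq d le.
  have h1 := @is_derive_nonincr R (fun t => - f t - C * t)
    (fun t => - df t - C) p q pq.
  have h2 := @is_derive_nonincr R (fun t => f t - C * t)
    (fun t => df t - C) p q pq.
  rewrite ler_norml; apply/andP; split.
    suff : - f q - C * q <= - f p - C * p by lra.
    apply: h1 => t /[dup] /d dt /le; rewrite ler_norml => /andP[? ?]; last by lra.
    by apply: is_derive_eq; rewrite /GRing.scale/= mulr1.
  suff : f q - C * q <= f p - C * p by lra.
  apply: h2 => t /[dup] /d dt /le; rewrite ler_norml => /andP[? ?]; last by lra.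
  by apply: is_derive_eq; rewrite /GRing.scale/= mulr1.
move=> d le; have [ab|ba] := leP a b.
  rewrite [`|b - a|]ger0_norm ?subr_ge0//; apply: main => // s /andP[as_ sb].
    by apply: d; rewrite !ger0_norm ?subr_ge0// lerD2r.
  by apply: le; rewrite !ger0_norm ?subr_ge0// lerD2r.
rewrite distrC (distrC b) [`|a - b|]gtr0_norm ?subr_gt0//.
apply: main => [|s /andP[bs sa]|s /andP[bs sa]]; first exact: ltW.
  by apply: d; rewrite distrC (distrC b) !ger0_norm ?subr_ge0 ?(ltW ba)// lerD2l lerN2.
by apply: le; rewrite distrC (distrC b) !ger0_norm ?subr_ge0 ?(ltW ba)// lerD2l lerN2.
Qed.

(* Integrating from a left end point [n] below the region of interest, and
   gluing the results. *)
Lemma scalar_antiderivative f : continuous f ->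
  exists F : R -> R, F 0 = 0 /\ forall t : R, is_derive t 1 F (f t).
Proof.
move=> cf.
have step (n : nat) : {F : R -> R | F 0 = 0 /\
    forall t : R, `|t| < n%:R -> is_derive t 1 F (f t)}.
  apply: cid.
  pose G (x : R) := \int[lebesgue_measure]_(t in `[- n%:R, x]) f t.
  exists (fun t => G t - G 0); split; first by rewrite subrr.
  move=> t; rewrite ltr_norml => /andP[nt tn].
  have := @continuous_FTC1 R f (BLeft (- n%:R)) t (t + 1).
  case.
  - by rewrite ltrDl.
  - apply: continuous_compact_integrable; first exact: segment_compact.
    exact: continuous_subspaceT.
  - exact: nt.
  - exact: cf.
  move=> dG EG.
  have dGt : is_derive t 1 G (f t).
    by apply: DeriveDef; [exact: dG|rewrite -derive1E; exact: EG].
  by apply: is_derive_eq; rewrite subr0.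
have [F F0] : exists F : nat -> R -> R, forall n, F n 0 = 0 /\
    forall t : R, `|t| < n%:R -> is_derive t 1 (F n) (f t).
  by exists (fun n => sval (step n)) => n; exact: (svalP (step n)).
have FE n m (t : R) : `|t| < n%:R -> `|t| < m%:R -> F n t = F m t.
  move=> tn tm; apply/eqP; rewrite -subr_eq0 -normr_le0.
  have := @is_derive_lip (fun s => F n s - F m s) (fun=> 0) 0 t 0.
  rewrite /= (F0 n).1 (F0 m).1 subrr mul0r => h.
  rewrite -[F n t - _]subr0; apply: h => s; rewrite !subr0 => st.
    have d1 := (F0 n).2 s (le_lt_trans st tn).
    have d2 := (F0 m).2 s (le_lt_trans st tm).
    by apply: is_derive_eq; rewrite subrr.
  by rewrite normr0.
(* [N t] is strictly above [|t|], so the branch [F (N t)] is still valid at all times near [t]. *)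
pose N (t : R) := (Num.truncn `|t|).+1.
have NP t : `|t| < (N t)%:R by exact: truncnS_gt.
exists (fun t => F (N t) t); split; first exact: (F0 _).1.
move=> t; apply: (near_eq_is_derive (f := F (N t))) => //.
  near=> s; apply: FE => //; near: s.
  apply/nbhs_ballP; exists ((N t)%:R - `|t|) => /=; first by rewrite subr_gt0.
  move=> s; rewrite /ball/= distrC ltrBrDr; apply: le_lt_trans.
  by rewrite -{1}(subrK t s) ler_normD.
exact: (F0 _).2.
Unshelve. all: by end_near. Qed.

End ScalarAntiderivative.

Section Riesz.
Variables (R : realType) (H : completeNormedModType R).
Variables (ip : {dot H for idfun}) (ip_norm : hilbert_norm ip).

Lemma harmonic_small (e : R) : 0 < e -> exists N, forall m, (N <= m)%N -> m.+1%:R^-1 < e.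
Proof.
move=> e0; have /cvgrPdist_lt/(_ _ e0)[N _ hN] := @cvg_harmonic R.
exists N => m /hN /=; rewrite /harmonic/= sub0r normrN ger0_norm//.
Qed.

(* The representing vector minimises [`|x|^2 - 2 l x]. *)
Lemma riesz_representation (l : H -> R) (C : R) :
  (forall a u v, l (a *: u + v) = a * l u + l v) ->
  (forall v, `|l v| <= C * `|v|) ->
  exists x, forall v, ip x v = l v.
Proof.
move=> lin bnd.
have l0 : l 0 = 0.
  by apply/eqP; rewrite -normr_le0 (le_trans (bnd 0))// normr0 mulr0.
have lD u v : l (u + v) = l u + l v by rewrite -{1}[u]scale1r lin mul1r.
have lZ a u : l (a *: u) = a * l u by rewrite -[a *: u]addr0 lin l0 addr0.
pose J x := `|x| ^+ 2 - 2 * l x.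
have Jlb : lbound (range J) (- C ^+ 2).
  move=> _ [x _ <-]; rewrite /J.
  have := bnd x; rewrite ler_norml => /andP[_].
  have := sqr_ge0 (`|x| - C); set n := `|x|; set y := l x; nra.
have Jinf : has_inf (range J) by split; [exists (J 0); exists 0|exists (- C ^+ 2)].
pose m := inf (range J).
have mJ x : m <= J x by apply: ge_inf; [exact: Jinf.2|exists x].
have /choice[u uP] : forall n, exists x, J x < m + n.+1%:R^-1.
  move=> n; have n0 : 0 < n.+1%:R^-1 :> R by rewrite invr_gt0.
  by have [_ [x _ <-] xm] := inf_adherent n0 Jinf; exists x.
have [x ux] : exists x : H, u @ \oo --> x.
  apply: seq_complete => e e0.
  (* By the parallelogram law and minimality at the midpoint, [|u N - u k|^2] is below twice the sum
     of the two excesses over [m], each of them less than [e^2 / 4]. *)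
  have [N hN] := harmonic_small (divr_gt0 (exprn_gt0 2 e0) (ltr0n R 4)).
  exists N => k Nk.
  have := uP N; have := uP k; have := mJ (2^-1 *: (u N + u k)).
  have := hN _ (leqnn N); have := hN _ Nk.
  rewrite /J lZ lD normrZ exprMn (normDsqr ip_norm) ger0_norm ?invr_ge0//.
  move=> h1 h2 h3 h4 h5.
  have : `|u N - u k| ^+ 2 < e ^+ 2.
    rewrite (normBsqr ip_norm); rewrite expr2 in h3.
    move: h1 h2; rewrite !(@ltr_pdivlMr _ 4)// => h1 h2.
    move: h1 h2 h3 h4 h5; move: (k.+1%:R^-1) (N.+1%:R^-1) => p q.
    by move: (`|u N| ^+ 2) (`|u k| ^+ 2) (ip (u N) (u k)) (l (u N)) (l (u k)) => *; lra.
  by rewrite ltr_sqr ?nnegrE// ltW.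
exists x => v.
(* Minimality tested at [u n + r *: v], in the limit: the first variation for every real [r]. *)
have key r : 0 <= 2 * r * (ip x v - l v) + r ^+ 2 * `|v| ^+ 2.
  have c : (fun n => 2 * r * (ip (u n) v - l v) + r ^+ 2 * `|v| ^+ 2 +
      n.+1%:R^-1) @ \oo --> 2 * r * (ip x v - l v) + r ^+ 2 * `|v| ^+ 2 + 0.
    apply: cvgD; last exact: cvg_harmonic.
    apply: cvgD; last exact: cvg_cst.
    apply: cvgMr; apply: cvgB; last exact: cvg_cst.
    by apply: (cvg_ip ip_norm) => //; exact: cvg_cst.
  rewrite -[leRHS]addr0 -(cvg_lim _ c)//.
  apply: limr_ge; first by apply/cvg_ex; eexists; exact: c.
  near=> n.
  have := uP n; have := mJ (u n + r *: v).
  rewrite /J lD lZ (normDsqr ip_norm) (ipZr ip) normrZ exprMn real_normK ?num_real//.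
  move: (n.+1%:R^-1) (`|u n| ^+ 2) (ip (u n) v) (l (u n)) => *; lra.
set d := ip x v - l v in key.
suff : d = 0 by move/eqP; rewrite subr_eq0 => /eqP.
have [v0|v0] := eqVneq v 0; first by rewrite /d v0 (ip0r ip) l0 subrr.
have vp : 0 < `|v| ^+ 2 by rewrite exprn_gt0// normr_gt0.
(* This [r] minimises the quadratic polynomial in [key]. *)
have := key (- (d / `|v| ^+ 2)).
have -> : 2 * - (d / `|v| ^+ 2) * d + (- (d / `|v| ^+ 2)) ^+ 2 * `|v| ^+ 2 =
   - (d ^+ 2 / `|v| ^+ 2) by field; rewrite normr_eq0.
rewrite oppr_ge0 pmulr_lle0 ?invr_gt0// => d2.
by apply/eqP; rewrite -sqrf_eq0 eq_le d2 sqr_ge0.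
Unshelve. all: by end_near. Qed.

(** The integral is built weakly: scalar antiderivatives of [ip (u t) v] are linear and bounded in
    [v], so Riesz provides a vector. Its derivative exists in norm because the remainder estimates
    are uniform over [v] of bounded norm. *)
Lemma vector_antiderivative (u : R -> H) : continuous u ->
  exists U : R -> H, U 0 = 0 /\ forall t : R, is_derive t 1 U (u t).
Proof.
move=> cu.
have cip v : continuous (fun t => ip (u t) v).
  by move=> t; apply: (cvg_ip ip_norm); [exact: cu|exact: cvg_cst].
have [F FP] := choice (fun v => scalar_antiderivative (cip v)).
have lip v (a b C : R) : (forall s, `|s - a| <= `|b - a| -> `|u s| <= C) ->
    `|F v b - F v a| <= C * `|v| * `|b - a|.
  move=> uC; apply: (@is_derive_lip R (F v) (fun s => ip (u s) v)).
    by move=> s _; exact: (FP v).2.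
  by move=> s /uC us; apply: le_trans (ip_abs ip_norm _ _) _; rewrite ler_wpM2r.
have /choice[U UP] : forall t, exists x, forall v, ip x v = F v t.
  move=> t.
  (* The maximum of [|u|] between [- |t|] and [|t|] bounds the functional to be represented. *)
  have [||c _ cmax] := @EVT_max R (fun s => `|u s|) (- `|t|) `|t|.
  - by rewrite ge0_cp.
  - apply: continuous_subspaceT => s.
    by apply: cvg_norm; exact: cu.
  apply: (@riesz_representation (fun v => F v t) (`|u c| * `|t|)) => [a v w|v].
    apply/eqP; rewrite -subr_eq0 -normr_le0.
    have := @is_derive_lip R (fun s => F (a *: v + w) s - (a * F v s + F w s))
      (fun=> 0) 0 t 0.
    rewrite /= !(FP _).1 mulr0 addr0 subrr mul0r => h.
    rewrite -[X in `|X|]subr0; apply: h => s _; last by rewrite normr0.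
    have d1 := (FP (a *: v + w)).2 s; have d2 := (FP v).2 s; have d3 := (FP w).2 s.
    by apply: is_derive_eq; rewrite (ipDr ip) (ipZr ip) /GRing.scale/= subrr.
  have := lip v 0 t `|u c|; rewrite (FP v).1 !subr0 mulrAC; apply=> s.
  by rewrite subr0 ler_norml => st; apply: cmax; rewrite in_itv.
exists U; split.
  by apply: (ip_inj ip_norm) => v; rewrite UP (FP v).1 (ip0l ip).
move=> t; apply/is_derive1P => e e0.
have /cvgrPdist_le/(_ e e0)/nbhs_ballP[r /= r0 hr] := cu t.
apply/nbhs_ballP; exists r => //= h; rewrite /ball/= sub0r normrN => hr'.
apply: (normr_le_ip ip_norm); first by rewrite mulr_ge0// ltW.
move=> v; rewrite !(ipBl ip) (ipZl ip) !UP.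
apply: le_trans (ler_norm _) _.
have := @is_derive_lip R (fun s => F v s - s * ip (u t) v)
  (fun s => ip (u s) v - ip (u t) v) t (h + t) (e * `|v|).
rewrite /= addrK => H1.
have -> : F v (h + t) - F v t - h * ip (u t) v =
   F v (h + t) - (h + t) * ip (u t) v - (F v t - t * ip (u t) v) by ring.
rewrite mulrAC; apply: H1 => s sh.
  have d1 := (FP v).2 s; apply: is_derive_eq.
  by rewrite scaler0 add0r /GRing.scale/= mulr1.
rewrite -(ipBl ip); apply: le_trans (ip_abs ip_norm _ _) _.
rewrite ler_wpM2r// distrC; apply: hr; rewrite /ball/= distrC.
exact: le_lt_trans hr'.
Qed.

End Riesz.

(** * Differential equations with Lipschitz right-hand side and their flows *)

Section DifferentialEquations.
Variables (R : realType) (H : completeNormedModType R).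
Variables (ip : {dot H for idfun}) (ip_norm : hilbert_norm ip).
Implicit Types (X : H -> H) (l : R).

Lemma curve_growth (f df : R -> H) (G dG : R -> R) (t : R) :
  (forall s : R, is_derive s 1 f (df s)) ->
  (forall s : R, 0 <= s -> is_derive s 1 G (dG s)) ->
  (forall s : R, `|s| <= `|t| -> `|df s| <= dG `|s|) ->
  `|f t - f 0| <= G `|t| - G 0.
Proof.
move=> d1 d2 le; have [t0|t0] := leP 0 t.
  rewrite (ger0_norm t0).
  apply: (curve_mean_le ip_norm t0 (df := df) (dg := dG)) => // s /andP[s0 st].
    exact: d2.
  by have := le s; rewrite !ger0_norm//; apply.
have nt : 0 <= - t by rewrite oppr_ge0 ltW.
have := @curve_mean_le R H ip ip_norm (fun s => f (- s)) (fun s => - df (- s)) G dG 0 (- t) nt.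
rewrite opprK oppr0 (ltr0_norm t0); apply => s /andP[s0 st].
- exact: is_derive_comp_opp.
- exact: d2.
rewrite normrN; have := le (- s).
by rewrite normrN (ltr0_norm t0) (ger0_norm s0); exact.
Qed.

Lemma gronwall_sym (z dz : R -> H) (l e t : R) : 0 <= l -> 0 <= e ->
  (forall s : R, is_derive s 1 z (dz s)) ->
  (forall s : R, `|s| <= `|t| -> `|dz s| <= l * `|z s| + e) ->
  `|z t| <= (`|z 0| + e * `|t|) * expR (l * `|t|).
Proof.
move=> l0 e0 d le; have [t0|t0] := leP 0 t.
  rewrite (ger0_norm t0).
  apply: (gronwall ip_norm t0 l0 e0 (dz := dz)) => // s /andP[s0 st].
  by apply: le; rewrite !ger0_norm.
have nt : 0 <= - t by rewrite oppr_ge0 ltW.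
have := @gronwall R H ip ip_norm (fun s => z (- s)) (fun s => - dz (- s)) l e (- t) nt l0 e0.
rewrite opprK oppr0 (ltr0_norm t0); apply => s /andP[s0 st].
- exact: is_derive_comp_opp.
rewrite normrN; apply: le.
by rewrite normrN (ltr0_norm t0) (ger0_norm s0).
Qed.

(** The two fields are compared along [y2] only. With a fixed reference orbit as [y2], a field
    difference that grows in space is then harmless. *)
Lemma ode_dist X1 X2 (y1 y2 : R -> H) l (e t : R) : 0 <= l -> 0 <= e ->
  (forall x y, `|X1 x - X1 y| <= l * `|x - y|) ->
  (forall s : R, is_derive s 1 y1 (X1 (y1 s))) ->
  (forall s : R, is_derive s 1 y2 (X2 (y2 s))) ->
  (forall s : R, `|s| <= `|t| -> `|X1 (y2 s) - X2 (y2 s)| <= e) ->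
  `|y1 t - y2 t| <= (`|y1 0 - y2 0| + e * `|t|) * expR (l * `|t|).
Proof.
move=> l0 e0 lip d1 d2 le.
apply: (@gronwall_sym (fun s => y1 s - y2 s) (fun s => X1 (y1 s) - X2 (y2 s))) => //.
move=> s st; rewrite -(subrK (X1 (y2 s)) (X1 (y1 s))) -addrA.
by rewrite (le_trans (ler_normD _ _))// lerD// le.
Qed.

Lemma ode_unique X (y1 y2 : R -> H) l : 0 <= l ->
  (forall x y, `|X x - X y| <= l * `|x - y|) ->
  (forall s : R, is_derive s 1 y1 (X (y1 s))) ->
  (forall s : R, is_derive s 1 y2 (X (y2 s))) ->
  y1 0 = y2 0 -> forall t, y1 t = y2 t.
Proof.
move=> l0 lip d1 d2 e t; apply/eqP; rewrite -subr_eq0 -normr_le0.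
have := @ode_dist X X y1 y2 l 0 t l0 (lexx 0) lip d1 d2.
rewrite e subrr normr0 mul0r add0r mul0r; apply => s _.
by rewrite subrr normr0.
Qed.

Lemma lipschitz_bound_continuous (V W : normedModType R) (f : V -> W) l :
  (forall x y, `|f x - f y| <= l * `|x - y|) -> continuous f.
Proof.
move=> lip x; apply/cvgrPdist_le => e e0.
have l1 : 0 < `|l| + 1 by rewrite ltr_wpDl.
apply/nbhs_ballP; exists (e / (`|l| + 1)) => /=; first exact: divr_gt0.
move=> y; rewrite -ball_normE /ball_/= ltr_pdivlMr// => /ltW.
apply: le_trans; apply: le_trans (lip _ _) _; rewrite mulrC ler_wpM2l//.
by rewrite (le_trans (ler_norm _))// lerDl.
Qed.

(* Picard iteration; measured with the weight [expR (2 (l + 1) |t|)] it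
   contracts by the factor 1/2 on the whole real line. *)
Lemma ode_solution X l (x0 : H) : 0 <= l ->
  (forall x y, `|X x - X y| <= l * `|x - y|) ->
  exists y : R -> H, y 0 = x0 /\ forall t : R, is_derive t 1 y (X (y t)).
Proof.
move=> l0 lip; have cX := lipschitz_bound_continuous lip.
(* The operator [A] must be total; discontinuous functions are sent to the zero curve. *)
have /choice[A AP] : forall u : R -> H, exists U : R -> H, continuous u ->
    U 0 = 0 /\ forall t : R, is_derive t 1 U (u t).
  move=> u; have [cu|ncu] := pselect (continuous u).
    by have [U UP] := vector_antiderivative ip_norm cu; exists U.
  by exists (fun=> 0).
pose G (y : R -> H) (t : R) := x0 + A (X \o y) t.
have cXy (y : R -> H) : continuous y -> continuous (X \o y).
  by move=> cy t; apply: (cvg_comp _ _ (cy t)); exact: cX.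
have G0 (y : R -> H) : continuous y -> G y 0 = x0.
  by move=> /cXy /AP[A0 _]; rewrite /G A0 addr0.
have dG (y : R -> H) : continuous y -> forall t : R, is_derive t 1 (G y) (X (y t)).
  move=> /cXy /AP[_ d] t; have dt := d t.
  by apply: is_derive_eq; rewrite add0r.
have cG (y : R -> H) : continuous y -> continuous (G y).
  by move=> cy t; exact: is_derive1_continuous (dG y cy t).
pose Y n := iter n G (fun=> x0).
have cY n : continuous (Y n).
  by elim: n => [|n IH] /=; [move=> t; exact: cvg_cst|exact: cG].
(* The weight has logarithmic derivative [2 (l + 1)], which is the source of the factor 1/2. The
   summand 1 lets the weight dominate [|t|] even when [l = 0], as the first iterate requires. *)
have Gd (y1 y2 : R -> H) (c t : R) : continuous y1 -> continuous y2 -> 0 <= c ->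
    (forall s, `|y1 s - y2 s| <= c * expR (2 * (l + 1) * `|s|)) ->
    `|G y1 t - G y2 t| <= 2^-1 * c * expR (2 * (l + 1) * `|t|).
  move=> c1 c2 c0 le.
  have := @curve_growth (fun s => G y1 s - G y2 s) (fun s => X (y1 s) - X (y2 s))
    (fun s => 2^-1 * c * expR (2 * (l + 1) * s))
    (fun s => (l + 1) * c * expR (2 * (l + 1) * s)) t.
  rewrite !G0// subrr subr0 => h.
  have {}h : `|G y1 t - G y2 t| <= 2^-1 * c * expR (2 * (l + 1) * `|t|) -
      2^-1 * c * expR (2 * (l + 1) * 0).
    apply: h => s.
    - have d1 := dG _ c1 s; have d2 := dG _ c2 s; exact: is_deriveB.
    - move=> _; have dl : is_derive s 1 (fun u => 2 * (l + 1) * u) (2 * (l + 1)).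
        by apply: is_derive_eq; rewrite /GRing.scale/= mulr1.
      have de := @is_derive1_comp R expR (fun u => 2 * (l + 1) * u) s _ _
        (is_derive_expR _) dl.
      rewrite /comp in de.
      by apply: is_derive_eq; rewrite /GRing.scale/=; field.
    - move=> _; apply: le_trans (lip _ _) _.
      rewrite -mulrA; apply: ler_pM => //; by rewrite lerDl.
  apply: le_trans h _; rewrite gerBl !mulr_ge0// ?invr_ge0// expR_ge0//.
pose C := `|X x0|.
have C0 : 0 <= C by exact: normr_ge0.
pose E (t : R) : R := expR (2 * (l + 1) * `|t|).
have YS n (t : R) : `|Y n.+1 t - Y n t| <= 2^-1 ^+ n * C * E t.
  elim: n t => [|n IH] t; last first.
    have c0 : 0 <= 2^-1 ^+ n * C by rewrite mulr_ge0// exprn_ge0.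
    have := Gd (Y n.+1) (Y n) (2^-1 ^+ n * C) t (cY _) (cY _) c0 IH.
    by rewrite exprS -[_ * _ * C]mulrA.
  rewrite expr0 mul1r.
  have := @curve_growth (G (fun=> x0)) (fun=> X x0) (fun s => C * s) (fun=> C) t.
  have c0 : continuous (fun _ : R => x0) by move=> ?; exact: cvg_cst.
  rewrite G0// mulr0 subr0 => h; apply: le_trans (h _ _ _) _.
  - by move=> s; exact: dG.
  - by move=> s _; apply: is_derive_eq; rewrite /GRing.scale/= mulr1.
  - by [].
  rewrite ler_wpM2l//; apply: le_trans (expR_ge1Dx _).
  have t0 := normr_ge0 t; nra.
have E0 t : 0 <= E t by exact: expR_ge0.
have YD n k t : `|Y (n + k)%N t - Y n t| <= 2 * 2^-1 ^+ n * C * E t.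
  have : `|Y (n + k)%N t - Y n t| <= 2 * (2^-1 ^+ n - 2^-1 ^+ (n + k)) * C * E t.
    elim: k => [|k IH]; first by rewrite addn0 !subrr normr0 mulr0 !mul0r.
    rewrite -(subrK (Y (n + k)%N t) (Y (n + k.+1)%N t)) -addrA.
    apply: le_trans (ler_normD _ _) _; apply: le_trans (lerD _ IH) _.
      by rewrite addnS; exact: YS.
    rewrite -mulrDl -mulrDl ler_wpM2r// ler_wpM2r//.
    by rewrite addnS exprS; lra.
  move/le_trans; apply; rewrite -!mulrA ler_wpM2l// ler_wpM2r ?mulr_ge0//.
  by rewrite gerBl exprn_ge0// invr_ge0.
have small (t e : R) : 0 < e -> exists n, 2 * 2^-1 ^+ n * C * E t < e.
  move=> e0.
  have c : (fun n => 2 * 2^-1 ^+ n * C * E t) @ \oo --> (2 * 0 * C * E t : R).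
    apply: cvgMl; apply: cvgMl; apply: cvgMr; apply: cvg_expr.
    by rewrite ger0_norm ?invr_ge0// invf_lt1 ?ltr1n.
  rewrite mulr0 !mul0r in c.
  have /cvgrPdist_lt/(_ _ e0)[n _ /(_ n (leqnn n))/=] := c.
  rewrite sub0r normrN => h; exists n; apply: le_lt_trans h.
  exact: ler_norm.
have /choice[y yP] : forall t, exists x : H, Y ^~ t @ \oo --> x.
  move=> t; apply: seq_complete => e /(small t)[n hn]; exists n => m nm.
  by rewrite distrC -(subnKC nm); apply: le_lt_trans hn.
have yY n t : `|y t - Y n t| <= 2 * 2^-1 ^+ n * C * E t.
  have c : (fun m => `|Y (m + n)%N t - Y n t|) @ \oo --> `|y t - Y n t|.
    apply: cvg_norm; apply: cvgB; last exact: cvg_cst.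
    by have := yP t; rewrite -(cvg_shiftn n).
  rewrite -(cvg_lim _ c)//; apply: limr_le; first by apply/cvg_ex; eexists; exact: c.
  by apply: nearW => m; rewrite addnC; exact: YD.
have cy : continuous y.
  move=> t; apply/cvgrPdist_le => e e0.
  have [n hn] := small (`|t| + 1) (e / 3) (divr_gt0 e0 (ltr0n R 3)).
  have e3 : 0 < e / 3 by rewrite divr_gt0.
  have near1 : forall s, `|s| <= `|t| + 1 -> `|y s - Y n s| <= e / 3.
    move=> s st; apply: le_trans (yY n s) _; apply: le_trans (ltW hn).
    rewrite ler_wpM2l ?mulr_ge0 ?exprn_ge0 ?invr_ge0//.
    by rewrite ler_expR ler_wpM2l ?mulr_ge0 ?addr_ge0// (ger0_norm (_ : 0 <= `|t| + 1)) ?addr_ge0.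
  have /cvgrPdist_le/(_ _ e3)/nbhs_ballP[r /= r0 hr] := cY n t.
  apply/nbhs_ballP; exists (Num.min r 1) => /=; first by rewrite lt_min r0 ltr01.
  move=> s; rewrite /ball/= lt_min => /andP[sr s1].
  have h1 := near1 t; have h2 := near1 s; have h3 := hr s sr.
  have -> : y t - y s = (y t - Y n t) + (Y n t - Y n s) + (Y n s - y s).
    by rewrite !subrKA.
  apply: le_trans (ler_normD _ _) _; apply: le_trans (lerD (ler_normD _ _) (lexx _)) _.
  rewrite [X in _ + X]distrC.
  have ht : `|t| <= `|t| + 1 by rewrite lerDl.
  have hs : `|s| <= `|t| + 1.
    rewrite -[s](subrK t) (le_trans (ler_normD _ _))// addrC lerD2l distrC ltW//.
  by have := h1 ht; have := h2 hs; lra.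
exists y.
have Gy t : G y t = y t.
  apply/eqP; rewrite -subr_eq0 -normr_le0; apply/ler_addgt0Pr => e e0; rewrite add0r.
  have e2 : 0 < e / 2 by rewrite divr_gt0.
  have [n hn] := small t _ e2.
  have cn0 : 0 <= 2 * 2^-1 ^+ n * C by rewrite !mulr_ge0 ?exprn_ge0 ?invr_ge0.
  have h1 : `|Y n.+1 t - y t| <= e / 2.
    rewrite distrC; apply: le_trans (yY n.+1 t) _; apply: le_trans (ltW hn).
    rewrite -!mulrA ler_wpM2l// ler_wpM2r ?mulr_ge0//.
    by rewrite exprS ler_piMl ?exprn_ge0 ?invr_ge0// invf_le1 ?ler1n.
  have h2 : `|G y t - Y n.+1 t| <= e / 2.
    have := Gd y (Y n) (2 * 2^-1 ^+ n * C) t cy (cY n) cn0 (yY n).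
    move=> h; apply: le_trans h _; apply: le_trans (ltW hn).
    rewrite -[_^-1 * _ * _]mulrA ler_piMl ?mulr_ge0// invf_le1 ?ler1n//.
  rewrite -(subrKA (Y n.+1 t)) (splitr e) (le_trans (ler_normD _ _))//.
  exact: lerD.
have EGy : G y = y by apply/funext.
split; first by rewrite -Gy G0.
by move=> t; have := dG y cy t; rewrite EGy.
Qed.

End DifferentialEquations.

Section Flows.
Variables (R : realType) (H : completeNormedModType R).
Variables (ip : {dot H for idfun}) (ip_norm : hilbert_norm ip).

(** Continuity at [(s0, x0, t0)] follows from Gronwall against the orbit of [x0], which is bounded
    for [|t| <= |t0| + 1]; the linear growth [1 + |x|] in the parameter estimate is thus evaluated
    on a bounded set. The function [g] in the proof is a continuous majorant of the distance that
    vanishes at the base point. *)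
Lemma lipschitz_family_flow (X : R -> H -> H) (l B : R) : 0 <= l -> 0 <= B ->
  (forall s x y, `|X s x - X s y| <= l * `|x - y|) ->
  (forall s s' x, `|X s x - X s' x| <= B * `|s - s'| * (1 + `|x|)) ->
  exists Phi : R -> H -> R -> H, (forall s, generated_by (X s) (Phi s)) /\
    continuous (fun p : R * H * R => Phi p.1.1 p.1.2 p.2).
Proof.
move=> l0 B0 lip par.
have /choice[y yP] : forall q : R * H, exists y : R -> H,
    y 0 = q.2 /\ forall t : R, is_derive t 1 y (X q.1 (y t)).
  by move=> q; exact: (ode_solution ip_norm q.2 l0 (lip q.1)).
pose Phi s x t := y (s, x) t.
have Phi0 s x : Phi s x 0 = x by rewrite /Phi (yP (s, x)).1.
have dPhi s x (t : R) : is_derive t 1 (Phi s x) (X s (Phi s x t)).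
  exact: (yP (s, x)).2.
have cPhi : continuous (fun p : R * H * R => Phi p.1.1 p.1.2 p.2).
  move=> [[s0 x0] t0] /=.
  pose y0 := Phi s0 x0; pose T := `|t0| + 1.
  have T0 : 0 <= T by rewrite addr_ge0.
  have cy0 : continuous y0 by move=> t; exact: is_derive1_continuous (dPhi s0 x0 t).
  have [||c _ cmax] := @EVT_max R (fun s => `|y0 s|) (- T) T.
  - by rewrite ge0_cp.
  - by apply: continuous_subspaceT => s; apply: cvg_norm; exact: cy0.
  pose E := expR (l * T); pose M := B * (1 + `|y0 c|).
  have M0 : 0 <= M by rewrite mulr_ge0// addr_ge0.
  pose g (p : R * H * R) := (`|p.1.2 - x0| + M * `|p.1.1 - s0| * T) * E +
     `|y0 p.2 - y0 t0|.
  have cg : g @ (s0, x0, t0) --> (`|x0 - x0| + M * `|s0 - s0| * T) * E + `|y0 t0 - y0 t0|.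
    have c1 : (fun p : R * H * R => p.1.1) @ (s0, x0, t0) --> s0.
      by apply: (cvg_comp _ _ cvg_fst); exact: cvg_fst.
    have c2 : (fun p : R * H * R => p.1.2) @ (s0, x0, t0) --> x0.
      by apply: (cvg_comp _ _ cvg_fst); exact: cvg_snd.
    have c3 : (fun p : R * H * R => y0 p.2) @ (s0, x0, t0) --> y0 t0.
      by apply: (cvg_comp _ _ cvg_snd); exact: cy0.
    apply: cvgD; last by apply: cvg_norm; apply: cvgB => //; exact: cvg_cst.
    apply: cvgMl; apply: cvgD.
      by apply: cvg_norm; apply: cvgB => //; exact: cvg_cst.
    apply: cvgMl; apply: cvgMr.
    by apply: cvg_norm; apply: cvgB => //; exact: cvg_cst.
  rewrite !subrr !normr0 !(mulr0, mul0r, addr0, add0r) in cg.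
  have le p : `|p.2| <= T -> `|Phi p.1.1 p.1.2 p.2 - y0 t0| <= g p.
    move=> pT; rewrite -(subrKA (y0 p.2)) (le_trans (ler_normD _ _))// lerD2r.
    have := @ode_dist R H ip ip_norm (X p.1.1) (X s0) (Phi p.1.1 p.1.2) y0 l
      (M * `|p.1.1 - s0|) p.2 l0 (mulr_ge0 M0 (normr_ge0 _)) (lip _)
      (dPhi _ _) (dPhi _ _).
    rewrite /y0 !Phi0 => h; apply: le_trans (h _) _.
      move=> s sp; apply: le_trans (par _ _ _) _.
      rewrite /M [B * (1 + _) * _]mulrAC ler_wpM2l ?mulr_ge0//.
      rewrite lerD2l; apply: cmax; rewrite in_itv/= -ler_norml.
      exact: le_trans pT.
    apply: ler_pM => //.
    + by rewrite addr_ge0// mulr_ge0// mulr_ge0.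
    + by rewrite lerD2l ler_wpM2l// mulr_ge0.
    + by rewrite ler_expR ler_wpM2l.
  apply/cvgrPdist_le => e e0.
  have near1 : \forall p \near (s0, x0, t0), `|p.2| <= T.
    have : (fun p : R * H * R => `|p.2|) @ (s0, x0, t0) --> `|t0|.
      by apply: cvg_norm; exact: cvg_snd.
    by move=> /cvgr_le; apply; rewrite ltrDl.
  have near2 : \forall p \near (s0, x0, t0), g p <= e.
    by move/cvgr_le : cg; apply.
  near=> p; rewrite distrC.
  apply: (@le_trans _ _ (g p)); last by near: p.
  by apply: le; near: p.
exists Phi; split=> // s; split; last exact: dPhi.
split => [p|x|x u t]; [|exact: Phi0|].
  apply: (@continuous_comp _ _ _ (fun p : H * R => (s, p.1, p.2))
    (fun q : R * H * R => Phi q.1.1 q.1.2 q.2)); last exact: cPhi.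
  apply: (@cvg_pair _ _ _ (nbhs p) (nbhs (s, p.1)) (nbhs p.2)); last exact: cvg_snd.
  by apply: (@cvg_pair _ _ _ (nbhs p) (nbhs s) (nbhs p.1)); [exact: cvg_cst|exact: cvg_fst].
have := @ode_unique R H ip ip_norm (X s) (fun t => Phi s x (t + u))
  (Phi s (Phi s x u)) l l0 (lip s).
rewrite add0r Phi0 addrC => h; apply: h => // r.
exact: is_derive_comp_shift.
Unshelve. all: by end_near. Qed.

Lemma generated_by_unique (F : H -> H) phi psi l : 0 <= l ->
  (forall x y, `|F x - F y| <= l * `|x - y|) ->
  generated_by F phi -> generated_by F psi -> forall x t, phi x t = psi x t.
Proof.
move=> l0 lip [[_ p0 _] dp] [[_ q0 _] dq] x.
by apply: (ode_unique ip_norm l0 lip (dp x) (dq x)); rewrite p0 q0.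
Qed.

End Flows.

(** * Orthogonal projections onto finite-dimensional subspaces *)

Section Projections.
Variables (R : realType) (H : completeNormedModType R).
Variables (ip : {dot H for idfun}) (ip_norm : hilbert_norm ip).
Implicit Types (e : seq H) (E : set H).

Definition orthonormal e : Prop :=
  uniq e /\ forall v w, v \in e -> w \in e -> ip v w = (v == w)%:R.

Definition proj e (x : H) : H := \sum_(v <- e) ip x v *: v.

Lemma projD e x y : proj e (x + y) = proj e x + proj e y.
Proof.
by rewrite -big_split; apply: eq_bigr => v _; rewrite (ipDl ip) scalerDl.
Qed.

Lemma projZ e a x : proj e (a *: x) = a *: proj e x.
Proof.
by rewrite scaler_sumr; apply: eq_bigr => v _; rewrite (ipZl ip) scalerA.
Qed.

Lemma ip_proj e x w : orthonormal e -> w \in e -> ip (proj e x) w = ip x w.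
Proof.
move=> [ue oe] we; rewrite (ip_suml ip) (bigD1_seq w)//= (ipZl ip) (oe _ _ we we).
rewrite eqxx mulr1 big_seq_cond big1 ?addr0// => v /andP[ve vw].
by rewrite (ipZl ip) oe// (negPf vw) mulr0.
Qed.

Lemma gram_schmidt E (s : seq H) : E 0 -> (forall a x y, E x -> E y -> E (a *: x + y)) ->
  (forall v, v \in s -> E v) ->
  exists e, [/\ orthonormal e, forall v, v \in e -> E v
    & forall v, v \in s -> proj e v = v].
Proof.
move=> E0 Elin; elim: s => [_|v s IH sE]; first by exists [::].
have [w ws|e [oe eE es]] := IH; first by apply: sE; rewrite inE ws orbT.
have pE e' x : (forall w, w \in e' -> E w) -> E (proj e' x).
  move=> e'E; rewrite /proj big_seq; elim/big_ind: _ => // [a b Ea Eb|w we].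
    by rewrite -[a]scale1r; exact: Elin.
  by rewrite -[_ *: _]addr0; apply: Elin => //; exact: e'E.
pose u := v - proj e v.
have Eu : E u.
  by rewrite /u addrC -scaleN1r; apply: Elin; [exact: pE|apply: sE; rewrite mem_head].
have ue w : w \in e -> ip u w = 0 by move=> we; rewrite (ipBl ip) ip_proj// subrr.
(* If the residual vanishes, [v] is already in the span and the list stays as it is. *)
have [u0|u0] := eqVneq u 0.
  exists e; split=> // w; rewrite inE => /predU1P[->|/es//].
  by apply/esym/eqP; rewrite -subr_eq0 -/u u0.
have up : `|u| != 0 by rewrite normr_eq0.
pose w := `|u|^-1 *: u.
have we z : z \in e -> ip w z = 0 by move=> ze; rewrite (ipZl ip) ue// mulr0.
have ww : ip w w = 1.
  by rewrite (ipZl ip) (ipZr ip) -ip_norm expr2; field.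
have wne : w \notin e.
  by apply/negP => /we; rewrite ww => /eqP; rewrite oner_eq0.
exists (w :: e); split.
- split; first by rewrite /= wne oe.1.
  move=> a b; rewrite !inE => /predU1P[->|ae] /predU1P[->|be].
  + by rewrite ww eqxx.
  + by rewrite we//; case: eqP => // wb; rewrite wb be in wne.
  + by rewrite (ipC ip) we//; case: eqP => // wb; rewrite -wb ae in wne.
  + exact: oe.2.
- move=> a; rewrite inE => /predU1P[->|/eE//].
  by rewrite -[w]addr0; exact: Elin.
- move=> a; rewrite inE /proj big_cons => /predU1P[->|/es ea].
    rewrite -/(proj e v) -[X in _ = X](subrK (proj e v)) -/u; congr (_ + _).
    have -> : ip v w = `|u|^-1 * `|u| ^+ 2.
      rewrite (ipZr ip) ip_norm; congr (_ * _).
      rewrite -[v in LHS](subrK (proj e v)) -/u (ipDl ip).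
      rewrite [X in _ + X](_ : _ = 0) ?addr0// (ip_suml ip) big_seq big1// => z ze.
      by rewrite (ipZl ip) (ipC ip z) ue// mulr0.
    by rewrite scalerA -[RHS]scale1r; congr (_ *: _); rewrite expr2; field.
  rewrite -/(proj e a) ea -[X in ip X w]ea (ip_suml ip) big_seq big1 ?scale0r ?add0r//.
  by move=> z ze; rewrite (ipZl ip) (ipC ip z) we// mulr0.
Qed.

Lemma fin_dim_orthonormal_basis E : fin_dim_subspace E ->
  exists e, [/\ orthonormal e, forall v, v \in e -> E v
    & forall x, E x -> proj e x = x].
Proof.
move=> [k [v ->]].
have [|||e [oe eE es]] := @gram_schmidt
    (range (fun c : 'I_k -> R => \sum_(i < k) c i *: v i)) (codom v).
- by exists (fun=> 0) => //; rewrite big1// => i _; rewrite scale0r.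
- move=> a _ _ [c _ <-] [d _ <-]; exists (fun i => a * c i + d i) => //.
  rewrite scaler_sumr -big_split; apply: eq_bigr => i _.
  by rewrite scalerDl scalerA.
- move=> _ /codomP[i ->]; exists (fun j => (j == i)%:R) => //.
  rewrite (bigD1 i)//= eqxx scale1r big1 ?addr0// => j /negPf ->.
  by rewrite scale0r.
exists e; split=> // _ [c _ <-].
elim/big_ind: _ => [|x y xE yE|i _].
- by rewrite /proj big1// => w _; rewrite (ip0l ip) scale0r.
- by rewrite projD xE yE.
- by rewrite projZ es// codom_f.
Qed.

Lemma orthogonal_projectionE E P e : orthogonal_projection ip E P ->
  orthonormal e -> (forall v, v \in e -> E v) -> (forall x, E x -> proj e x = x) ->
  forall x, P x = proj e x.
Proof.
move=> EP oe eE Ee x; have [EPx Px] := EP x.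
have h w : w \in e -> ip (P x) w = ip x w.
  move=> /eE /Px; rewrite (ipBl ip) => /eqP; rewrite subr_eq0 => /eqP ->//.
rewrite -(Ee _ EPx) /proj big_seq [RHS]big_seq.
by apply: eq_bigr => v /h ->.
Qed.

End Projections.

Section OrthogonalProjection.
Variables (R : realType) (H : completeNormedModType R).
Variables (ip : {dot H for idfun}) (ip_norm : hilbert_norm ip).
Variables (E : set H) (P : H -> H).
Hypotheses (E_fin : fin_dim_subspace E) (EP : orthogonal_projection ip E P).
Implicit Types x y : H.

(** Projections are specified by orthogonality alone; the explicit expansion supplies their
    linearity and reduces compactness to finitely many coordinates. *)
Lemma oproj_basis : exists e, [/\ orthonormal ip e, forall v, v \in e -> E v
  & forall x, P x = proj ip e x].
Proof.
have [e [oe eE Ee]] := fin_dim_orthonormal_basis ip_norm E_fin.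
by exists e; split=> //; exact: orthogonal_projectionE.
Qed.

Lemma oprojD x y : P (x + y) = P x + P y.
Proof. by have [e [_ _ Pe]] := oproj_basis; rewrite !Pe projD. Qed.

Lemma oprojZ a x : P (a *: x) = a *: P x.
Proof. by have [e [_ _ Pe]] := oproj_basis; rewrite !Pe projZ. Qed.

Lemma oprojB x y : P (x - y) = P x - P y.
Proof. by rewrite oprojD -scaleN1r oprojZ scaleN1r. Qed.

Lemma oproj_id y : E y -> P y = y.
Proof.
have [e [oe eE Pe]] := oproj_basis.
have [e' [oe' eE' Ee']] := fin_dim_orthonormal_basis ip_norm E_fin.
by move=> Ey; rewrite (orthogonal_projectionE EP oe' eE' Ee') Ee'.
Qed.

Lemma oproj_idem x : P (P x) = P x.
Proof. exact: oproj_id (EP x).1. Qed.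

Lemma oproj_orth x y : ip (x - P x) (P y) = 0.
Proof. exact: (EP x).2 (EP y).1. Qed.

Lemma oproj_ip x y : ip (P x) y = ip x (P y).
Proof.
have /eqP := oproj_orth x y; have /eqP := oproj_orth y x.
rewrite !(ipBl ip) !subr_eq0 => /eqP h1 /eqP h2.
by rewrite (ipC ip) h1 h2 (ipC ip).
Qed.

Lemma oproj_pythagoras x : `|x| ^+ 2 = `|P x| ^+ 2 + `|x - P x| ^+ 2.
Proof.
have := normDsqr ip_norm (x - P x) (P x).
by rewrite subrK oproj_orth mulr0 addr0 addrC.
Qed.

Lemma oproj_norm x : `|P x| <= `|x|.
Proof.
rewrite -ler_sqr ?nnegrE// [leRHS]oproj_pythagoras lerDl; exact: sqr_ge0.
Qed.

Lemma oproj_residual_norm x : `|x - P x| <= `|x|.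
Proof.
rewrite -ler_sqr ?nnegrE// [leRHS]oproj_pythagoras lerDr; exact: sqr_ge0.
Qed.

Lemma oproj_residualB x y : (x - y) - P (x - y) = (x - P x) - (y - P y).
Proof. by rewrite oprojB !opprB [P y - P x]addrC addrACA [- y + _]addrC. Qed.

Lemma oproj_residual_lip x y :
  `|(x - P x) - (y - P y)| <= `|x - y|.
Proof. by rewrite -oproj_residualB oproj_residual_norm. Qed.

Lemma oproj_best x y : E y -> `|x - P x| <= `|x - y|.
Proof.
move=> Ey; have := oproj_residual_lip x y.
by rewrite (oproj_id Ey) subrr subr0.
Qed.

(** The commutator [w] lies in [E]. It is also orthogonal to itself: [w] differs from the residual
    of [L x] by [L (x - P x)], and pairing the latter with [w] moves [L] onto [w], which keeps it in
    [E]. *)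
Lemma oproj_comm (L : {linear H -> H}) : selfadjoint ip L -> L @` E = E ->
  forall x, L (P x) = P (L x).
Proof.
move=> Lsa LE x; apply/eqP; rewrite -subr_eq0 -normr_eq0 -sqrf_eq0 ip_norm.
have ELP : E (L (P x)) by rewrite -LE; exists (P x) => //; exact: (EP x).1.
have Ew : E (L (P x) - P (L x)).
  have -> : L (P x) - P (L x) = P (L (P x) - L x).
    by rewrite oprojB (oproj_id ELP).
  exact: (EP _).1.
set w := L (P x) - P (L x) in Ew *; rewrite {1}/w.
have -> : L (P x) - P (L x) = (L x - P (L x)) - L (x - P x).
  by rewrite linearB/= opprB [RHS]addrC subrKA.
rewrite (ipBl ip) ((EP (L x)).2 w Ew) Lsa (EP x).2 ?subrr//.
by rewrite -LE; exists w.
Qed.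

End OrthogonalProjection.

(** * Compactness along ultrafilters and uniform approximation by [E n] *)

Section Ultrafilters.
Variables (R : realType).

Lemma ultrafilter_fmap (T U : Type) (F : set_system T) (f : T -> U) :
  UltraFilter F -> UltraFilter (f @ F).
Proof.
move=> UF; split; first exact: fmap_proper_filter.
move=> G PG FG; apply/seteqP; split=> [A GA|A]; last exact: FG.
have [//|FA] := in_ultra_setVsetC (f @^-1` A) UF.
have /FG GC : (f @ F) (~` A) by exact: FA.
by have [x []] := filter_ex (filterI GA GC).
Qed.

(** Heine-Borel in ultrafilter form: bounded coordinates converge simultaneously along one
    ultrafilter, which replaces the extraction of subsequences. *)
Lemma ultrafilter_bounded_cvg (T : Type) (F : set_system T) (f : T -> R) (C : R) :
  UltraFilter F -> F [set t | `|f t| <= C] -> exists c : R, f @ F --> c.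
Proof.
move=> UF FC; have := @segment_compact R (- C) C; rewrite compact_ultra.
move=> /(_ _ (ultrafilter_fmap f UF)) [].
  suff : F (f @^-1` [set` `[- C, C]]) by [].
  apply: (filterS _ FC) => t ft; have : `|f t| <= C by exact: ft.
  by rewrite ler_norml /= in_itv.
by move=> c [_ fc]; exists c.
Qed.

End Ultrafilters.

Section Compactness.
Variables (R : realType) (H : completeNormedModType R).
Variables (ip : {dot H for idfun}) (ip_norm : hilbert_norm ip).
Implicit Types (e : seq H) (x y : H).

Lemma cvg_sum_seq (T : Type) (F : set_system T) {FF : Filter F} (I : eqType) (s : seq I)
    (f : I -> T -> H) (l : I -> H) : (forall i, i \in s -> f i @ F --> l i) ->
  (fun t => \sum_(i <- s) f i t) @ F --> \sum_(i <- s) l i.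
Proof.
elim: s => [|i s IH] h.
  by rewrite big_nil; under eq_fun do rewrite big_nil; exact: cvg_cst.
rewrite big_cons; under eq_fun do rewrite big_cons.
apply: cvgD; first by apply: h; rewrite mem_head.
by apply: IH => j js; apply: h; rewrite inE js orbT.
Qed.

Lemma ultrafilter_proj_cvg (T : Type) (F : set_system T) (f : T -> H) (C : R) e :
  UltraFilter F -> F [set t | `|f t| <= C] ->
  exists z : H, (fun t => proj ip e (f t)) @ F --> z.
Proof.
move=> UF FC.
have /choice[c cP] : forall v, exists c : R, (fun t => ip (f t) v) @ F --> c.
  move=> v; apply: (@ultrafilter_bounded_cvg R _ F _ (C * `|v|)) => //.
  apply: filterS FC => t /= ft; apply: le_trans (ip_abs ip_norm _ _) _.
  by rewrite ler_wpM2r.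
exists (\sum_(v <- e) c v *: v).
by apply: cvg_sum_seq => v _; apply: cvgZr_tmp; exact: cP.
Qed.

(** The finitely many coordinates of a bounded family converge along every ultrafilter, and the set
    on the right is stable under such limits. *)
Lemma precompact_span e (A : set H) (C : R) :
  A `<=` [set x | proj ip e x = x /\ `|x| <= C] -> precompact A.
Proof.
move=> AZ; apply: (precompact_subset AZ).
apply: compact_precompact; first exact: norm_hausdorff.
rewrite compact_ultra => F UF FZ.
have [|z zP] := @ultrafilter_proj_cvg H F id C e UF.
  by apply: filterS FZ => x [].
have Fz : F --> z.
  have : id @ F --> z.
    apply: cvg_trans zP; apply: near_eq_cvg; apply: filterS FZ => x [/= xP _].
    by rewrite xP.
  by [].
exists z; split => //; split.
  have c : (proj ip e) @ F --> proj ip e z.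
    apply: cvg_sum_seq => v _; apply: cvgZr_tmp.
    by apply: (cvg_ip ip_norm); [exact: Fz|exact: cvg_cst].
  by apply: (cvg_unique _ c zP); exact: norm_hausdorff.
have cn : (fun x => `|x|) @ F --> `|z| by apply: cvg_norm.
rewrite -(cvg_lim _ cn)//; apply: limr_le; first by apply/cvg_ex; eexists; exact: cn.
by apply: filterS FZ => x [].
Qed.

(** The values lie in the continuous image of the product of two compact closures. This keeps the
    fields of the homotopy of the form [L] plus a compact map. *)
Lemma precompact_comb (a b : R) (T : Type) (B : set T) (f g : T -> H) :
  precompact (f @` B) -> precompact (g @` B) ->
  precompact ((fun t => a *: f t + b *: g t) @` B).
Proof.
rewrite !(@precompactE H) => cf cg.
pose m (p : H * H) := a *: p.1 + b *: p.2.
have cm : compact (m @` (closure (f @` B) `*` closure (g @` B))).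
  apply: continuous_compact; last exact: compact_setX.
  apply: continuous_subspaceT => p.
  by apply: cvgD; apply: cvgZl_tmp; [exact: cvg_fst|exact: cvg_snd].
have := compact_precompact (@norm_hausdorff _ H) cm; rewrite -precompactE.
apply: precompact_subset => _ [t Bt <-].
by exists (f t, g t) => //; split; apply: subset_closure; exists t.
Qed.

Variables (E : nat -> set H) (P : nat -> H -> H).
Hypotheses (E_fin : forall n, fin_dim_subspace (E n))
  (E_increasing : forall n, E n `<=` E n.+1)
  (E_dense : closure (\bigcup_n E n) = setT)
  (EP : forall n, orthogonal_projection ip (E n) (P n)).

Lemma oproj_residual_cvg x (r : R) : 0 < r ->
  exists N, forall n, (N <= n)%N -> `|x - P n x| < r.
Proof.
move=> r0; have : closure (\bigcup_n E n) x by rewrite E_dense.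
move=> /(_ _ (nbhsx_ballx x r r0))[y [[N _ EN] xy]].
exists N => n Nn.
have En : E n y.
  rewrite -(subnKC Nn); elim: (n - N)%N => [|k IH]; first by rewrite addn0.
  by rewrite addnS; exact: E_increasing.
apply: le_lt_trans (oproj_best ip_norm (E_fin n) (EP n) x En) _.
by move: xy; rewrite -ball_normE.
Qed.

(** Residuals converge to 0 pointwise and are 1-Lipschitz, so the convergence is uniform on a
    compact set: a cluster point [p] of points with large residuals would have a large residual
    itself. *)
Lemma oproj_residual_uniform (A : set H) (r : R) : precompact A -> 0 < r ->
  exists N, forall n, (N <= n)%N -> forall x, A x -> `|x - P n x| <= r.
Proof.
rewrite precompactE => cA r0; apply: contrapT => /forallNP h.
have /choice[z zP] : forall N, exists q : nat * H,
    [/\ (N <= q.1)%N, A q.2 & r < `|q.2 - P q.1 q.2|].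
  move=> N; have /existsNP[n /not_implyP[Nn /existsNP[x /not_implyP[Ax /negP]]]] := h N.
  by rewrite -ltNge => rx; exists (n, x).
have PF : ProperFilter ((fun N => (z N).2) @ \oo) by exact: fmap_proper_filter.
have [|p [_ pc]] := cA _ PF.
  by exists 0%N => // N _ /=; apply: subset_closure; have [] := zP N.
have r2 : 0 < r / 2 by rewrite divr_gt0.
have [N hN] := oproj_residual_cvg p r2.
have [||_ [[m /= Nm <-] pm]] := pc [set (z m).2 | m in [set m | (N <= m)%N]] (ball p (r / 2)).
- by exists N => // m /= Nm; exists m.
- exact: nbhsx_ballx.
have [mq _] := zP m; apply/negP; rewrite -leNgt.
have -> : (z m).2 - P (z m).1 (z m).2 = ((z m).2 - P (z m).1 (z m).2 - (p - P (z m).1 p))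
   + (p - P (z m).1 p) by rewrite subrK.
apply: le_trans (ler_normD _ _) _; rewrite (splitr r); apply: lerD.
  apply: le_trans (oproj_residual_lip ip_norm (E_fin _) (EP _) _ _) _.
  by rewrite distrC ltW//; move: pm; rewrite -ball_normE.
by rewrite ltW// hN// (leq_trans Nm).
Qed.

End Compactness.

(** * Orbits that stay near [U] for a long time *)

Section EscapeSym.
Variables (R : realType) (H : completeNormedModType R).
Variables (ip : {dot H for idfun}) (ip_norm : hilbert_norm ip).

Lemma is_derive_comp_sign (V : normedModType R) (f : R -> V) (s t : R) v :
  `|s| = 1 -> is_derive (s * t) 1 f v -> is_derive t 1 (fun u => f (s * u)) (s *: v).
Proof.
move=> s1 /is_derive1P d; apply/is_derive1P => e /d /nbhs_ballP[r /= r0 hr].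
apply/nbhs_ballP; exists r => //= h; rewrite /ball/= sub0r normrN => hr'.
have := hr (s * h); rewrite /ball/= sub0r normrN normrM s1 mul1r => /(_ hr').
by rewrite mulrDr scalerA [h * s]mulrC.
Qed.

(** Reversing time and the sign of [a] together leaves [da] and [|dg|] unchanged. So a negative
    [a 0] is treated like a nonnegative one, with the large value of [|a|] reached in the past. *)
Lemma escape_sym (g dg : R -> H) (a da : R -> R) (T d k nu : R) :
  0 <= T -> 0 < d -> 0 <= k -> 0 < nu ->
  (forall t : R, is_derive t 1 g (dg t)) ->
  (forall t : R, is_derive t 1 a (da t)) ->
  (forall t, `|t| <= T -> `|g t - g 0| < d -> nu + 4 * k / d * `|dg t| <= da t) ->
  (forall t, `|t| <= T -> d <= `|g t - g 0| -> k <= `|a t| -> nu <= da t) ->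
  exists2 t, `|t| <= T & nu * T <= `|a t|.
Proof.
move=> T0 d0 k0 nu0 Dg Da near far.
have [s s1 sa] : exists2 s : R, `|s| = 1 & 0 <= s * a 0.
  have [a0|a0] := leP 0 (a 0); first by exists 1; rewrite ?normr1 ?mul1r.
  by exists (-1); rewrite ?normrN1// mulN1r oppr_ge0 ltW.
have ss : s * s = 1 by rewrite -expr2 -[s ^+ 2]real_normK ?num_real// s1 expr1n.
exists (s * T); first by rewrite normrM s1 mul1r ger0_norm.
have h := @escape R H ip ip_norm (fun t => g (s * t)) (fun t => s *: dg (s * t))
  (fun t => s * a (s * t)) (fun t => da (s * t)) T d k nu T0 d0 k0 nu0.
have {}h : nu * T <= s * a (s * T).
  have sT t : 0 <= t <= T -> `|s * t| <= T.
    by case/andP => t0 tT; rewrite normrM s1 mul1r ger0_norm.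
  apply: h => [t _|t _||t tT|t tT].
  - exact: is_derive_comp_sign.
  - have dt := is_derive_comp_sign s1 (Da (s * t)).
    by apply: is_derive_eq; rewrite /GRing.scale/= mulrA ss mul1r.
  - by rewrite mulr0.
  - rewrite mulr0 normrZ s1 mul1r; exact: near (sT _ tT).
  - rewrite mulr0 => gd ka; apply: far (sT _ tT) gd _.
    by apply: le_trans ka _; rewrite (le_trans (ler_norm _))// normrM s1 mul1r.
by apply: le_trans h _; rewrite (le_trans (ler_norm _))// normrM s1 mul1r.
Qed.

End EscapeSym.

Section AsymptoticCompactness.
Variables (R : realType) (H : completeNormedModType R).
Variables (ip : {dot H for idfun}) (ip_norm : hilbert_norm ip).
Variables (L : {linear H -> H}) (CL c : R).
Hypotheses (CL0 : 0 < CL) (c0 : 0 < c).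
Hypotheses (L_le : forall x, `|L x| <= CL * `|x|) (L_ge : forall x, c * `|x| <= `|L x|).
Hypothesis L_sa : selfadjoint ip L.
Variables (E : nat -> set H) (P : nat -> H -> H).
Hypotheses (E_fin : forall n, fin_dim_subspace (E n))
  (E_increasing : forall n, E n `<=` E n.+1)
  (E_dense : closure (\bigcup_n E n) = setT)
  (L_E : forall n, L @` E n = E n)
  (EP : forall n, orthogonal_projection ip (E n) (P n)).
Variables (F K : H -> H) (l : R).
Hypotheses (l0 : 0 < l) (F_lip : forall x y, `|F x - F y| <= l * `|x - y|).
Hypotheses (FE : forall x, F x = L x + K x) (K_cc : completely_continuous K).
Variable phi : H -> R -> H.
Hypothesis phi_F : generated_by F phi.

Lemma is_derive_L (f : R -> H) (t : R) v :
  is_derive t 1 f v -> is_derive t 1 (fun s => L (f s)) (L v).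
Proof.
move=> /is_derive1P d; apply/is_derive1P => e e0.
have /d : 0 < e / CL by exact: divr_gt0.
apply: filterS => h; rewrite -linearZ -!linearB => le.
by apply: le_trans (L_le _) _; rewrite -ler_pdivlMl// mulrA [_^-1 * e]mulrC.
Qed.

Lemma is_derive_residual n (f : R -> H) (t : R) v :
  is_derive t 1 f v -> is_derive t 1 (fun s => f s - P n (f s)) (v - P n v).
Proof.
move=> /is_derive1P d; apply/is_derive1P => e /d.
apply: filterS => h; apply: le_trans.
have En := E_fin n; have EPn := EP n.
rewrite -[h *: (v - _)](_ : h *: v - P n (h *: v) = _); last first.
  by rewrite (oprojZ ip_norm En EPn) scalerBr.
rewrite -!(oproj_residualB ip_norm En EPn).
exact: oproj_residual_norm.
Qed.

(** The residual [y] moves with velocity [L y] plus the residual of [K]. Pairing with [L y] rather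
    than with [y] makes the linear part contribute [|L y|^2] whatever the signature of [L]; the
    perturbation costs at most half of it. *)
Lemma residual_coercive n x (e : R) : `|K x - P n (K x)| <= e ->
  2^-1 * `|L (x - P n x)| ^+ 2 - 2^-1 * e ^+ 2 <=
    ip (L (x - P n x)) (F x - P n (F x)).
Proof.
move=> Ke; have En := E_fin n; have EPn := EP n.
have -> : F x - P n (F x) = L (x - P n x) + (K x - P n (K x)).
  rewrite FE (oprojD ip_norm En EPn) linearB/= (oproj_comm ip_norm En EPn L_sa (L_E n)).
  by rewrite opprD addrACA.
rewrite (ipDr ip) -ip_norm.
have := ip_abs ip_norm (L (x - P n x)) (K x - P n (K x)).
rewrite ler_norml => /andP[h _].
have : `|L (x - P n x)| * `|K x - P n (K x)| <= `|L (x - P n x)| * e.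
  by rewrite ler_wpM2l.
have := sqr_ge0 (`|L (x - P n x)| - e).
by move: `|L _| h => u; set v := ip _ _; set w := `|_ - _| => *; nra.
Qed.

(* The quadratic form [<L y, y> / 2] of the residual [y] of an orbit is a
   Lyapunov function as long as [y] is not small. *)
Lemma residual_small (Rad b : R) : 0 < b -> exists N, exists2 T : R, 0 < T &
  forall n x, (N <= n)%N -> (forall t, `|t| <= T -> `|phi x t| <= Rad) ->
    `|x - P n x| < b.
Proof.
move=> b0; pose A := [set x : H | `|x| <= Rad].
have pA : precompact (K @` A).
  apply: K_cc; exists Rad; split; first exact: num_real.
  by move=> C RC x /= xR; apply: le_trans xR (ltW RC).
pose r := `|Rad|; have r0 : 0 <= r by exact: normr_ge0.
pose M := CL * r + 1; have M0 : 0 < M by rewrite ltr_wpDl// mulr_ge0// ltW.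
(* With [|dy| <= M] and radius [b / 2], this [k] keeps the price [4 k / (b / 2) |dy|] in the escape
   argument below [c^2 b^2 / 32]. *)
pose k := c ^+ 2 * b ^+ 3 / (256 * M).
have k0 : 0 < k.
  apply: divr_gt0; first by rewrite mulr_gt0 ?exprn_gt0.
  by apply: mulr_gt0; first exact: ltr0n.
(* The two bounds serve the two regimes: [|y| >= b / 2] near the start, and later [|a| >= k], which
   forces [|y|^2 >= 2 k / CL]. *)
pose mu := Num.min (c ^+ 2 * b ^+ 2 / 16) (c ^+ 2 * k / CL).
have mu0 : 0 < mu.
  by rewrite lt_min; apply/andP; split; rewrite divr_gt0// mulr_gt0// exprn_gt0.
pose e := Num.min 1 mu.
have e0 : 0 < e by rewrite lt_min ltr01 mu0.
have emu : e ^+ 2 <= mu.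
  apply: (@le_trans _ _ e); last by rewrite ge_min lexx orbT.
  by rewrite expr2 ler_piMl ?(ltW e0)// ge_min lexx.
have e1 : e <= 1 by rewrite ge_min lexx.
pose nu := mu / 2; have nu0 : 0 < nu by rewrite divr_gt0.
have [N hN] := oproj_residual_uniform ip_norm E_fin E_increasing E_dense EP pA e0.
(* Then [nu * T] exceeds every value that [|a|] can take on the ball of radius [r]. *)
pose T := CL * r ^+ 2 / nu + 1.
have T0 : 0 < T by rewrite ltr_wpDl// divr_ge0// ?(ltW nu0)// mulr_ge0// ?exprn_ge0// ltW.
exists N, T => // n x Nn xT; rewrite ltNge; apply/negP => bx.
have En := E_fin n; have EPn := EP n.
have [[_ phi0 _] dphi] := phi_F.
pose y t := phi x t - P n (phi x t).
pose dy t := F (phi x t) - P n (F (phi x t)).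
have Dy (t : R) : is_derive t 1 y (dy t) by exact: is_derive_residual.
pose a t := 2^-1 * ip (L (y t)) (y t).
pose da t := ip (L (y t)) (dy t).
have Da (t : R) : is_derive t 1 a (da t).
  have d := is_derive_ip ip_norm (is_derive_L (Dy t)) (Dy t).
  by apply: is_derive_eq; rewrite /GRing.scale/= L_sa (ipC ip (dy t)) /da; field.
have yr (t : R) : `|t| <= T -> `|y t| <= r.
  move=> /xT h; apply: le_trans (oproj_residual_norm ip_norm EPn _) _.
  exact: le_trans h (ler_norm _).
have ge (t : R) : `|t| <= T -> 2^-1 * c ^+ 2 * `|y t| ^+ 2 - 2^-1 * mu <= da t.
  move=> tT.
  have Ke : `|K (phi x t) - P n (K (phi x t))| <= e.
    by apply: hN => //; exists (phi x t) => //; exact: xT.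
  apply: le_trans (residual_coercive Ke); rewrite -/(y t).
  have : (c * `|y t|) ^+ 2 <= `|L (y t)| ^+ 2.
    by rewrite ler_sqr ?nnegrE ?L_ge// mulr_ge0// ltW.
  by rewrite exprMn; lra.
have dyM (t : R) : `|t| <= T -> `|dy t| <= M.
  move=> tT.
  have Ke : `|K (phi x t) - P n (K (phi x t))| <= e.
    by apply: hN => //; exists (phi x t) => //; exact: xT.
  have -> : dy t = L (y t) + (K (phi x t) - P n (K (phi x t))).
    rewrite /dy FE (oprojD ip_norm En EPn) linearB/= (oproj_comm ip_norm En EPn L_sa (L_E n)).
    by rewrite opprD addrACA.
  apply: le_trans (ler_normD _ _) _; apply: lerD; last exact: le_trans Ke e1.
  by apply: le_trans (L_le _) _; rewrite ler_wpM2l ?(ltW CL0)// yr.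
have aCL (t : R) : `|a t| <= 2^-1 * CL * `|y t| ^+ 2.
  rewrite normrM ger0_norm ?invr_ge0// -mulrA ler_wpM2l ?invr_ge0//.
  apply: le_trans (ip_abs ip_norm _ _) _.
  by rewrite expr2 mulrA ler_wpM2r.
have y0 : y 0 = x - P n x by rewrite /y phi0.
have b2 : 0 < b / 2 by rewrite divr_gt0.
have [||t tT] := escape_sym ip_norm (ltW T0) b2 (ltW k0) nu0 Dy Da.
- move=> t tT yd; apply: le_trans (ge t tT).
  have yb : b / 2 <= `|y t|.
    have := ler_distD (y t) (y 0) 0; rewrite !subr0 distrC y0 => h.
    by move: yd; rewrite y0; lra.
  have : (b / 2) ^+ 2 <= `|y t| ^+ 2 by rewrite ler_sqr ?nnegrE// ltW.
  have -> : 4 * k / (b / 2) * `|dy t| = c ^+ 2 * b ^+ 2 / 32 * (`|dy t| / M).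
    by rewrite /k; field; rewrite !gt_eqF.
  have dM : `|dy t| / M <= 1 by rewrite ler_pdivrMr// mul1r dyM.
  have mu1 : mu <= c ^+ 2 * b ^+ 2 / 16 by rewrite ge_min lexx.
  have cb : 0 <= c ^+ 2 * b ^+ 2 / 32 by rewrite !mulr_ge0 ?exprn_ge0 ?invr_ge0 ?ltW.
  have h1 := ler_wpM2l cb dM.
  move=> yb2; have h2 := ler_wpM2l (sqr_ge0 c) yb2.
  rewrite /nu; move: h1 h2 mu1; rewrite mulr1 exprMn exprVn.
  set Y := `|y t| ^+ 2; set z := _ * (_ / M); set cc := c ^+ 2; set bb := b ^+ 2.
  by move=> *; lra.
- move=> t tT _ ka; apply: le_trans (ge t tT).
  have h1 := le_trans ka (aCL t).
  have mu2 : mu <= c ^+ 2 * k / CL by rewrite ge_min lexx orbT.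
  have c2 : 0 <= c ^+ 2 / CL by rewrite divr_ge0 ?exprn_ge0 ?ltW.
  have := ler_wpM2l c2 h1.
  have -> : c ^+ 2 / CL * (2^-1 * CL * `|y t| ^+ 2) = 2^-1 * c ^+ 2 * `|y t| ^+ 2.
    by field; rewrite gt_eqF.
  rewrite mulrAC => h2; rewrite /nu; lra.
apply/negP; rewrite -ltNge; apply: le_lt_trans (aCL t) _.
have -> : nu * T = CL * r ^+ 2 + nu by rewrite /T; field; rewrite gt_eqF.
have : `|y t| ^+ 2 <= r ^+ 2 by rewrite ler_sqr ?nnegrE// yr.
move=> /(ler_wpM2l (ltW CL0)) h.
have := mulr_ge0 (ltW CL0) (sqr_ge0 r).
by move: (CL * r ^+ 2) h => u h hu; rewrite -mulrA; lra.
Qed.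

Variable U : set H.
Hypothesis U_iso : isolating_neighborhood U phi.

Lemma phi_lip x y (t : R) : `|phi x t - phi y t| <= `|x - y| * expR (l * `|t|).
Proof.
have [[_ phi0 _] d] := phi_F.
have := @ode_dist R H ip ip_norm F F (phi x) (phi y) l 0 t (ltW l0) (lexx 0) F_lip
  (d x) (d y).
by rewrite mul0r addr0 !phi0; apply => s _; rewrite subrr normr0.
Qed.

(* Otherwise the starting points of the bad orbits have a limit along an
   ultrafilter, because their residuals become small, and the orbit of the limit
   never leaves [U]. *)
Lemma isolation_time : exists r T d : R, [/\ 0 < r, r <= 1, 0 < T, 0 < d &
  forall x, (forall t, `|t| <= T -> exists2 y, U y & `|phi x t - y| < r) ->
    ball x d `<=` U].
Proof.
have [Ucl Ubd Uinv] := U_iso.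
have [[_ phi0 _] _] := phi_F.
apply: contrapT => h.
have /choice[x xP] : forall k : nat, exists x : H,
    (forall t, `|t| <= k.+1%:R -> exists2 y, U y & `|phi x t - y| < k.+1%:R^-1) /\
    ~ (ball x k.+1%:R^-1 `<=` U).
  move=> k; apply: contrapT => hk; apply: h.
  exists k.+1%:R^-1, k.+1%:R, k.+1%:R^-1; split; rewrite ?invr_gt0 ?invf_le1 ?ler1n//.
  by move=> x hx; apply: contrapT => hx'; apply: hk; exists x.
(* An ultrafilter containing all tails: along it the radius tends to 0 and the time span to
   infinity. *)
have [W [UW tailW]] := ultraFilterLemma (T := nat) (F := \oo) _.
have late (r : R) : 0 < r -> W [set k | k.+1%:R^-1 < r].
  move=> r0; apply: tailW; have [N hN] := harmonic_small r0.
  by exists N.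
have long (T : R) : W [set k | T <= k.+1%:R].
  apply: tailW; exists (Num.truncn `|T|) => // k /= Tk.
  apply: le_trans (ler_norm _) _; apply: le_trans (ltW (truncnS_gt _)) _.
  by rewrite ler_nat.
have [Rad0 [_ Rad0P]] := Ubd.
have URad y : U y -> `|y| <= Rad0 + 1 by apply: Rad0P; rewrite ltrDl.
pose Rad := Rad0 + 2.
have xRad k t : `|t| <= k.+1%:R -> `|phi (x k) t| <= Rad.
  move=> /(xP k).1[y Uy yk]; rewrite -[phi _ _](subrK y).
  apply: le_trans (ler_normD _ _) _.
  have k1 : k.+1%:R^-1 <= 1 :> R by rewrite invf_le1// ler1n.
  have := URad _ Uy; rewrite /Rad; move: (k.+1%:R^-1) yk k1 => u; lra.
(* Up to [e / 2] the points [x k] lie in one fixed [E N], and their projections there converge along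
   [W]. So [x] is Cauchy along [W]. *)
have [p xp] : exists p : H, x @ W --> p.
  apply/cvg_ex; apply/cauchy_cvgP; apply: cauchy_exP => e e0.
  have e2 : 0 < e / 2 by rewrite divr_gt0.
  have [N [T T0 hNT]] := residual_small Rad e2.
  have [b [_ _ Pb]] := oproj_basis ip_norm (E_fin N) (EP N).
  have xR : W [set k | `|x k| <= Rad].
    by apply: filterS (long 0) => k /= k0; rewrite -[x k]phi0 xRad ?normr0.
  have [z zP] := @ultrafilter_proj_cvg R H ip ip_norm nat W x Rad b UW xR.
  exists z; move/cvgrPdist_lt/(_ _ e2) : zP => zP.
  suff : W (x @^-1` ball z e) by [].
  apply: (filterS _ (filterI (long T) zP)) => k [/= Tk zk].
  rewrite -ball_normE /ball_/=.
  have := hNT N (x k) (leqnn _); rewrite Pb => /(_ _) hx.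
  have {}hx : `|x k - proj ip b (x k)| < e / 2.
    by apply: hx => t tT; apply: xRad; exact: le_trans Tk.
  rewrite -(subrKA (proj ip b (x k))) (splitr e).
  by apply: le_lt_trans (ler_normD _ _) _; rewrite ltrD// distrC.
have pU t : U (phi p t).
  suff : closure U (phi p t) by exact: Ucl.
  move=> B /nbhs_ballP[e /= e0 eB].
  have e2 : 0 < e / 2 by rewrite divr_gt0.
  have E0 := expR_gt0 (l * `|t|).
  move/cvgrPdist_lt/(_ _ (divr_gt0 e2 E0)) : xp => xp.
  have [k [[/= k1 k2] k3]] :=
    filter_ex (filterI (filterI (late _ e2) (long `|t|)) xp).
  have [y Uy yk] := (xP k).1 t k2.
  exists y; split => //; apply: eB; rewrite -ball_normE /ball_/=.
  rewrite -(subrKA (phi (x k) t)) (splitr e).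
  apply: le_lt_trans (ler_normD _ _) _; rewrite ltrD//; last exact: lt_trans k1.
  by apply: le_lt_trans (phi_lip _ _ _) _; rewrite -ltr_pdivlMr.
(* As [p] is interior, small balls around nearby points [x k] lie in [U], against their choice. *)
have /nbhs_ballP[e /= e0 eU] : U° p by apply: Uinv; split => //; rewrite -[p]phi0.
have e2 : 0 < e / 2 by rewrite divr_gt0.
move/cvgrPdist_lt/(_ _ e2) : xp => xp.
have [k [/= k1 k2]] := filter_ex (filterI (late _ e2) xp).
apply: (xP k).2 => y; rewrite -ball_normE /ball_/= => xy.
apply: eU; rewrite -ball_normE /ball_/= -(subrKA (x k)) (splitr e).
by apply: le_lt_trans (ler_normD _ _) _; rewrite ltrD//; exact: lt_trans k1.
Qed.

End AsymptoticCompactness.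

(** * The Lipschitz Lyapunov function near [U] *)

Section CappedDistance.
Variables (R : realType) (H : completeNormedModType R) (U : set H).
Implicit Types x y : H.

(* Capping at 1 keeps the infimum meaningful when [U] is empty. *)
Definition capped_dist x : R := inf ([set 1] `|` [set `|x - y| | y in U]).

Let S x : set R := [set 1] `|` [set `|x - y| | y in U].

Let S_inf x : has_inf (S x).
Proof.
split; first by exists 1; left.
by exists 0 => _ [->|[y _ <-]].
Qed.

Lemma capped_dist_le1 x : capped_dist x <= 1.
Proof. by apply: ge_inf; [exact: (S_inf x).2|left]. Qed.

Lemma capped_dist_le x y : U y -> capped_dist x <= `|x - y|.
Proof. by move=> Uy; apply: ge_inf; [exact: (S_inf x).2|right; exists y]. Qed.

Lemma capped_dist_lt x (r : R) : r <= 1 -> capped_dist x < r ->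
  exists2 y, U y & `|x - y| < r.
Proof.
move=> r1 xr; have r0 : 0 < r - capped_dist x by rewrite subr_gt0.
have [e] := inf_adherent r0 (S_inf x).
rewrite -/(capped_dist x) addrC subrK => -[->|[y Uy <-]] er; last by exists y.
by move: er; rewrite ltNge r1.
Qed.

Lemma capped_dist_lip x y : capped_dist x - capped_dist y <= `|x - y|.
Proof.
rewrite lerBlDr -lerBlDl; apply: lb_le_inf; first exact: (S_inf y).1.
move=> _ [->|[z Uz <-]].
  by rewrite lerBlDl (le_trans (capped_dist_le1 _))// lerDr.
by rewrite lerBlDl (le_trans (capped_dist_le _ Uz))// ler_distD.
Qed.

End CappedDistance.

Section Lyapunov.
Variables (R : realType) (H : completeNormedModType R).
Variables (ip : {dot H for idfun}) (ip_norm : hilbert_norm ip).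
Variables (F : H -> H) (l : R).
Hypotheses (l0 : 0 < l) (F_lip : forall x y, `|F x - F y| <= l * `|x - y|).
Variable phi : H -> R -> H.
Hypothesis phi_F : generated_by F phi.
Variable w : H -> R.
Hypotheses (w0 : forall x, 0 <= w x) (w1 : forall x, w x <= 1).
Hypothesis w_lip : forall x y, w x - w y <= `|x - y|.

(** The sign [s] is the direction of time: 1 follows the forward orbit, -1 the backward one. *)
Definition exit_value (s : R) (x : H) : R :=
  sup [set expR (- (l * t)) * w (phi x (s * t)) | t in [set t | 0 <= t]].

Let S s x : set R := [set expR (- (l * t)) * w (phi x (s * t)) | t in [set t | 0 <= t]].

Let S_sup s x : has_sup (S s x).
Proof.
split; first by exists (expR (- (l * 0)) * w (phi x (s * 0))); exists 0 => /=.
exists 1 => _ [t /= t0 <-]; rewrite mulr_ile1 ?expR_ge0// expR_le1 oppr_le0.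
by rewrite mulr_ge0// ltW.
Qed.

Lemma exit_value_ge s x t : 0 <= t ->
  expR (- (l * t)) * w (phi x (s * t)) <= exit_value s x.
Proof. by move=> t0; apply: (ub_le_sup (S_sup s x).2); exists t. Qed.

Lemma exit_value_le s x C :
  (forall t, 0 <= t -> expR (- (l * t)) * w (phi x (s * t)) <= C) ->
  exit_value s x <= C.
Proof. by move=> h; apply: ge_sup; [exact: (S_sup s x).1|move=> _ [t /= t0 <-]; exact: h]. Qed.

Lemma exit_value_ge0 s x : 0 <= exit_value s x.
Proof.
by apply: le_trans (exit_value_ge s x (lexx 0)); rewrite mulr_ge0// expR_ge0.
Qed.

Lemma exit_value_le1 s x : exit_value s x <= 1.
Proof.
apply: exit_value_le => t t0; rewrite mulr_ile1 ?expR_ge0// expR_le1 oppr_le0.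
by rewrite mulr_ge0// ltW.
Qed.

(** Two orbits separate at most by the factor [exp (l t)], which the discount [exp (- l t)] cancels
    exactly; this fixes the discount rate. *)
Lemma exit_value_lip s x y : `|s| = 1 ->
  `|exit_value s x - exit_value s y| <= `|x - y|.
Proof.
move=> s1.
suff h a b : exit_value s a <= exit_value s b + `|a - b|.
  have h1 := h x y; have h2 := h y x; rewrite distrC in h2.
  by rewrite ler_norml; apply/andP; split; lra.
apply: exit_value_le => t t0.
have h1 := exit_value_ge s b t0.
have h2 := w_lip (phi a (s * t)) (phi b (s * t)).
have h3 := phi_lip ip_norm l0 F_lip phi_F a b (s * t).
rewrite normrM s1 mul1r (ger0_norm t0) in h3.
have E0 := expR_gt0 (- (l * t)).
have EE : expR (- (l * t)) * expR (l * t) = 1 by rewrite -expRD addNr expR0.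
apply: le_trans (_ : expR (- (l * t)) * (w (phi b (s * t)) + `|a - b| * expR (l * t)) <= _).
  by rewrite ler_wpM2l ?(ltW E0)//; lra.
by rewrite mulrDr mulrCA EE mulr1 lerD2r.
Qed.

(** The stretch of orbit with [w = 0] contributes nothing to the supremum, and the remaining times
    are discounted by [s] less when seen from [phi x s]. *)
Lemma exit_value_forward x s : 0 <= s -> (forall t, 0 <= t <= s -> w (phi x t) = 0) ->
  expR (l * s) * exit_value 1 x <= exit_value 1 (phi x s).
Proof.
move=> s0 ws; have [[_ phi0 phiD] _] := phi_F.
rewrite mulrC -ler_pdivlMr ?expR_gt0//; apply: exit_value_le => t t0.
have [ts|st] := leP t s.
  by rewrite mul1r ws ?t0// mulr0 divr_ge0 ?expR_ge0 ?exit_value_ge0.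
have ts0 : 0 <= t - s by rewrite subr_ge0 ltW.
have := exit_value_ge 1 (phi x s) ts0; rewrite !mul1r -phiD [s + _]addrC subrK => h.
rewrite ler_pdivlMr ?expR_gt0// mulrAC -expRD.
by rewrite (_ : - (l * t) + l * s = - (l * (t - s)))//; ring.
Qed.

Lemma exit_value_backward x s : 0 <= s -> (forall t, 0 <= t <= s -> w (phi x t) = 0) ->
  exit_value (-1) (phi x s) <= expR (- (l * s)) * exit_value (-1) x.
Proof.
move=> s0 ws; have [[_ phi0 phiD] _] := phi_F.
apply: exit_value_le => t t0; rewrite -phiD mulN1r.
have [ts|st] := leP t s.
  rewrite ws ?mulr0 ?mulr_ge0 ?expR_ge0 ?exit_value_ge0//.
  by rewrite subr_ge0 ts lerBlDr lerDl.
have ts0 : 0 <= t - s by rewrite subr_ge0 ltW.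
have := exit_value_ge (-1) x ts0; rewrite mulN1r opprB => h.
rewrite (_ : - (l * t) = - (l * s) + - (l * (t - s))); last by ring.
by rewrite expRD -mulrA ler_wpM2l ?expR_ge0.
Qed.

Definition lyapunov x := exit_value 1 x - exit_value (-1) x.
Definition lyapunov_rate x := exit_value 1 x + exit_value (-1) x.

Lemma lyapunov_lip x y : `|lyapunov x - lyapunov y| <= 2 * `|x - y|.
Proof.
have h1 := exit_value_lip x y (normr1 R).
have h2 := exit_value_lip x y (normrN1 R).
rewrite /lyapunov opprD addrACA -opprD.
by apply: le_trans (ler_normB _ _) _; lra.
Qed.

Lemma lyapunov_rate_lip x y : `|lyapunov_rate x - lyapunov_rate y| <= 2 * `|x - y|.
Proof.
have h1 := exit_value_lip x y (normr1 R).
have h2 := exit_value_lip x y (normrN1 R).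
rewrite /lyapunov_rate opprD addrACA.
by apply: le_trans (ler_normD _ _) _; lra.
Qed.

Lemma lyapunov_rate_le2 x : lyapunov_rate x <= 2.
Proof. by have := exit_value_le1 1 x; have := exit_value_le1 (-1) x; rewrite /lyapunov_rate; lra. Qed.

Lemma lyapunov_abs x : `|lyapunov x| <= lyapunov_rate x.
Proof.
have := exit_value_ge0 1 x; have := exit_value_ge0 (-1) x.
by rewrite ler_norml /lyapunov /lyapunov_rate => *; apply/andP; split; lra.
Qed.

Lemma lyapunov_rate_ge x t : expR (- (l * `|t|)) * w (phi x t) <= lyapunov_rate x.
Proof.
have e0 s := exit_value_ge0 s x.
have [t0|t0] := leP 0 t.
  have := exit_value_ge 1 x t0; rewrite mul1r (ger0_norm t0) => /le_trans; apply.
  by rewrite lerDl.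
have nt0 : 0 <= - t by rewrite oppr_ge0 ltW.
have := exit_value_ge (-1) x nt0; rewrite mulN1r opprK (ltr0_norm t0) => /le_trans; apply.
by rewrite lerDr.
Qed.

(** With [u = l s], this combines [exp u >= 1 + u] and [exp (- u) <= 1 - u + u^2]. Keeping [s]
    finite yields a quadratic error with explicit constant where no derivative is available. *)
Lemma lyapunov_increase x s : 0 <= s -> (forall t, 0 <= t <= s -> w (phi x t) = 0) ->
  (l * s - (l * s) ^+ 2) * lyapunov_rate x <= lyapunov (phi x s) - lyapunov x.
Proof.
move=> s0 ws.
have h1 := exit_value_forward s0 ws; have h2 := exit_value_backward s0 ws.
have u0 : 0 <= l * s by rewrite mulr_ge0// ltW.
move: h1 h2; have p := exit_value_ge0 1 x; have q := exit_value_ge0 (-1) x.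
rewrite /lyapunov /lyapunov_rate; set a := exit_value 1 x in p *.
set b := exit_value (-1) x in q *; move: (l * s) u0 => u u0 h1 h2.
have e1 : 1 + u <= expR u by exact: expR_ge1Dx.
have e2 : expR (- u) <= 1 - u + u ^+ 2.
  rewrite expRN invf_ple ?posrE ?expR_gt0//; last by nra.
  apply: le_trans e1; rewrite -[_^-1]mul1r ler_pdivrMr; last by nra.
  have : 0 <= u ^+ 3 by rewrite exprn_ge0.
  by nra.
have := ler_wpM2r p e1; have := ler_wpM2r q e2.
move: (expR u * a) (expR (- u) * b) h1 h2 => A B h1 h2 h3 h4.
have : 0 <= u ^+ 2 * a by rewrite mulr_ge0// exprn_ge0.
by move=> ?; lra.
Qed.

End Lyapunov.

Lemma bounded_setP (R : realType) (H : completeNormedModType R) (U : set H) :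
  bounded_set U -> exists2 C : R, 0 < C & forall x, U x -> `|x| <= C.
Proof.
move=> [C [_ hC]]; exists (`|C| + 1); first by rewrite ltr_wpDl.
by apply: hC; rewrite (le_lt_trans (ler_norm C))// ltrDl.
Qed.

Section LyapunovPair.
Variables (R : realType) (H : completeNormedModType R).
Variables (ip : {dot H for idfun}) (ip_norm : hilbert_norm ip).
Variables (F : H -> H) (l : R).
Hypotheses (l0 : 0 < l) (F_lip : forall x y, `|F x - F y| <= l * `|x - y|).
Variable phi : H -> R -> H.
Hypothesis phi_F : generated_by F phi.

Lemma flow_displacement x (M t : R) : `|F x| <= M -> 0 <= t <= 1 ->
  `|phi x t - x| <= M * expR l * t.
Proof.
move=> FM /andP[t0 t1]; have [[_ phi0 _] d] := phi_F.
have M0 : 0 <= M by exact: le_trans FM.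
have := @gronwall R H ip ip_norm (fun s => phi x s - x) (fun s => F (phi x s)) l M t
  t0 (ltW l0) M0.
rewrite phi0 subrr normr0 add0r => h.
have {}h : `|phi x t - x| <= M * t * expR (l * t).
  apply: h => s _.
    by have ds := d x s; apply: is_derive_eq; rewrite subr0.
  rewrite -[F (phi x s)](subrK (F x)); apply: le_trans (ler_normD _ _) _.
  by apply: lerD.
apply: le_trans h _; rewrite mulrAC ler_wpM2r// ler_wpM2l//.
by rewrite ler_expR ler_piMr// ltW.
Qed.

Lemma flow_taylor x (M t : R) : `|F x| <= M -> 0 <= t <= 1 ->
  `|phi x t - (x + t *: F x)| <= l * M * expR l * t ^+ 2.
Proof.
move=> FM /andP[t0 t1]; have [[_ phi0 _] d] := phi_F.
have M0 : 0 <= M by exact: le_trans FM.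
have := @curve_mean_le R H ip ip_norm (fun s => phi x s - s *: F x)
  (fun s => F (phi x s) - F x) (fun s => l * (M * expR l * t) * s)
  (fun=> l * (M * expR l * t)) 0 t t0.
rewrite phi0 scale0r subr0 mulr0 subr0 => h.
have {}h : `|phi x t - t *: F x - x| <= l * (M * expR l * t) * t.
  apply: h => s /andP[s0 st].
  - have ds := d x s; apply: is_deriveB.
    apply/is_derive1P => e e0; apply/nbhs_ballP; exists 1 => //= u _.
    by rewrite scalerDl addrK subrr normr0 mulr_ge0// ltW.
  - by apply: is_derive_eq; rewrite /GRing.scale/= mulr1.
  - apply: le_trans (F_lip _ _) _; rewrite ler_wpM2l ?(ltW l0)//.
    apply: le_trans (flow_displacement FM _) _.
      by rewrite s0 (le_trans st t1).
    by rewrite ler_wpM2l// mulr_ge0// expR_ge0.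
rewrite opprD addrA addrAC; apply: le_trans h _.
by rewrite le_eqVlt; apply/orP; left; apply/eqP; ring.
Qed.

(** Growth of [g] has to be averaged later and tested in a direction [v] other than [F z]. It is
    therefore stated for straight segments: replacing the orbit by a segment costs a quadratic term,
    and a wrong velocity costs twice its error since [g] is 2-Lipschitz. *)
Lemma lyapunov_pair (U : set H) (r T d : R) : 0 < r -> r <= 1 -> bounded_set U ->
  (forall x, (forall t, `|t| <= T -> exists2 y, U y & `|phi x t - y| < r) ->
    ball x d `<=` U) ->
  exists g G : H -> R, [/\ forall x y, `|g x - g y| <= 2 * `|x - y|,
    forall x y, `|G x - G y| <= 2 * `|x - y|,
    forall x, `|g x| <= G x <= 2,
    exists2 mu : R, 0 < mu & forall x, ~ (ball x d `<=` U) -> mu <= G x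
  & exists C s0 : R, [/\ 0 <= C, 0 < s0 & forall z v s,
      (exists2 y, U y & `|z - y| < r / 4) -> 0 <= s <= s0 ->
      s * (l * G z - 2 * `|v - F z|) - C * s ^+ 2 <= g (z + s *: v) - g z]].
Proof.
move=> r0 r1 /bounded_setP[Rad Rad0 URad] deep.
(* The offset makes [w] vanish up to distance [r / 2] from [U], while [w >= r / 2] from distance [r]
   on. *)
pose w x := Num.max 0 (capped_dist U x - r / 2).
have w0 x : 0 <= w x by rewrite le_max lexx.
have w1 x : w x <= 1.
  by rewrite ge_max ler01 lerBlDr (le_trans (capped_dist_le1 U x))// lerDl divr_ge0// ltW.
have w_lip x y : w x - w y <= `|x - y|.
  have := capped_dist_lip U x y; have := normr_ge0 (x - y); rewrite /w.
  by have [] := leP 0 (capped_dist U x - r / 2);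
    have [] := leP 0 (capped_dist U y - r / 2); lra.
exists (lyapunov l phi w), (lyapunov_rate l phi w).
pose M := `|F 0| + l * (Rad + 1) + 1.
have M0 : 0 < M by rewrite ltr_wpDl// addr_ge0// mulr_ge0 ?addr_ge0// ltW.
have FM z : (exists2 y, U y & `|z - y| < r / 4) -> `|F z| <= M.
  move=> [y Uy zy]; have := F_lip z 0; rewrite subr0 => Fz.
  have : `|F z| <= `|F 0| + l * `|z|.
    by rewrite -[F z](subrK (F 0)) (le_trans (ler_normD _ _))// addrC lerD2l.
  have zR : `|z| <= Rad + 1.
    rewrite -[z](subrK y) (le_trans (ler_normD _ _))//.
    by have := URad y Uy; lra.
  by have := ler_wpM2l (ltW l0) zR; rewrite /M; lra.
have E1 : 1 <= expR l by apply: le_trans (expR_ge1Dx _); rewrite lerDl ltW.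
have ME0 : 0 < M * expR l by rewrite mulr_gt0// expR_gt0.
split.
- exact: lyapunov_lip.
- exact: lyapunov_rate_lip.
- by move=> x; rewrite lyapunov_abs// lyapunov_rate_le2.
(* An orbit that does not start deep in [U] reaches distance [r] within time [T]; there
   [w >= r / 2], discounted at worst by [exp (- l T)]. *)
- exists (expR (- (l * `|T|)) * (r / 2)); first by rewrite mulr_gt0 ?expR_gt0// divr_gt0.
  move=> x nU.
  have [t tT ht] : exists2 t, `|t| <= T & ~ exists2 y, U y & `|phi x t - y| < r.
    apply: contrapT => h; apply/nU/deep => t tT; apply: contrapT => h'.
    by apply: h; exists t.
  apply: le_trans (lyapunov_rate_ge l0 phi w0 w1 x t).
  have wr : r / 2 <= w (phi x t).
    rewrite le_max; apply/orP; right; rewrite lerBrDr.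
    have : r <= capped_dist U (phi x t).
      by rewrite leNgt; apply/negP => /(capped_dist_lt r1).
    by lra.
  apply: ler_pM => //; rewrite ?expR_ge0 ?divr_ge0 ?(ltW r0)//.
  rewrite ler_expR lerN2 ler_wpM2l ?(ltW l0)//.
  exact: le_trans tT (ler_norm _).
(* Within this time the orbit moves by at most [r / 8], hence stays within [r / 4 + r / 8 < r / 2]
   of [U], where [w] vanishes. *)
pose s0 := Num.min 1 (r / 8 / (M * expR l)).
exists (2 * l ^+ 2 + 2 * (l * M * expR l)), s0; split.
- by rewrite addr_ge0 ?mulr_ge0 ?sqr_ge0 ?expR_ge0// ltW.
- by rewrite lt_min ltr01 divr_gt0// divr_gt0.
move=> z v s Uz /andP[s_ge0 ss0].
have s1 : s <= 1 by rewrite (le_trans ss0)// ge_min lexx.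
have sr : s <= r / 8 / (M * expR l) by rewrite (le_trans ss0)// ge_min lexx orbT.
have wz t : 0 <= t <= s -> w (phi z t) = 0.
  move=> /andP[t0 ts]; apply/max_l; rewrite subr_le0.
  have disp := flow_displacement (FM z Uz) (_ : 0 <= t <= 1).
  have {}disp : `|phi z t - z| <= r / 8.
    apply: le_trans (disp _) _; first by rewrite t0 (le_trans ts).
    by rewrite -ler_pdivlMl// mulrC (le_trans ts).
  have [y Uy zy] := Uz.
  apply: le_trans (capped_dist_le _ Uy) _.
  rewrite -(subrKA z) (le_trans (ler_normD _ _))//; lra.
have inc := lyapunov_increase l0 phi_F w0 w1 s_ge0 wz.
have tay : `|phi z s - (z + s *: F z)| <= l * M * expR l * s ^+ 2.
  by apply: flow_taylor; [exact: FM|rewrite s_ge0].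
have lip := lyapunov_lip ip_norm l0 F_lip phi_F w0 w1 w_lip (phi z s) (z + s *: v).
rewrite ler_norml in lip; case/andP: lip => _ lip.
have tri : `|phi z s - (z + s *: v)| <= l * M * expR l * s ^+ 2 + s * `|v - F z|.
  have -> : phi z s - (z + s *: v) = (phi z s - (z + s *: F z)) + s *: (F z - v).
    by rewrite scalerBr !opprD !addrA subrK.
  apply: le_trans (ler_normD _ _) _; apply: lerD => //.
  by rewrite normrZ (ger0_norm s_ge0) distrC.
have G2 := lyapunov_rate_le2 l0 phi w0 w1 z.
have := ler_wpM2l (sqr_ge0 (l * s)) G2.
move: inc lip tri; rewrite mulrBl exprMn.
move: (lyapunov _ _ _ _) (lyapunov _ _ _ _) (lyapunov _ _ _ _) (lyapunov_rate _ _ _ _).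
move=> a b g G *; lra.
Qed.

End LyapunovPair.

(** * Averages over segments and smoothing in finitely many directions *)

Section Mean.
Variable R : realType.
Implicit Types (u : R -> R) (tau : R).

Lemma antiderivative_exists : exists A : (R -> R) -> R -> R, forall u, continuous u ->
  forall t : R, is_derive t 1 (A u) (u t).
Proof.
have /choice[A AP] : forall u : R -> R, exists U : R -> R, continuous u ->
    forall t : R, is_derive t 1 U (u t).
  move=> u; have [cu|ncu] := pselect (continuous u).
    by have [U [_ UP]] := scalar_antiderivative cu; exists U.
  by exists (fun=> 0).
by exists A.
Qed.

Definition antiderivative : (R -> R) -> R -> R := sval (cid antiderivative_exists).

Lemma antiderivativeP u : continuous u -> forall t : R, is_derive t 1 (antiderivative u) (u t).
Proof. by move=> cu; apply: (svalP (cid antiderivative_exists)). Qed.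

(** The antiderivative is fixed by choice; its arbitrary additive constant cancels here. *)
Definition mean tau u := tau^-1 * (antiderivative u tau - antiderivative u 0).

Lemma mean_shift tau u (U : R -> R) (h : R) : continuous u ->
  (forall t : R, is_derive t 1 U (u t)) ->
  mean tau (fun t => u (t + h)) = tau^-1 * (U (tau + h) - U h).
Proof.
move=> cu dU; congr (_ * _); apply/eqP; rewrite -subr_eq0 -normr_le0.
have cuh : continuous (fun t => u (t + h)).
  move=> t; apply: (@continuous_comp _ _ _ (fun t => t + h) u); last exact: cu.
  by apply: cvgD; [exact: cvg_id|exact: cvg_cst].
have := @is_derive_lip R (fun t => antiderivative (fun t => u (t + h)) t - U (t + h)) (fun=> 0)
  0 tau 0.
rewrite mul0r add0r => H.
rewrite [X in `|X|](_ : _ =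
   antiderivative (fun t => u (t + h)) tau - U (tau + h) -
  (antiderivative (fun t => u (t + h)) 0 - U h)); last by ring.
apply: H => t _; last by rewrite normr0.
have d1 := antiderivativeP cuh t; have d2 := is_derive_comp_shift (dU (t + h)).
by apply: is_derive_eq; rewrite subrr.
Qed.

Lemma meanE tau u (U : R -> R) : continuous u ->
  (forall t : R, is_derive t 1 U (u t)) -> mean tau u = tau^-1 * (U tau - U 0).
Proof.
move=> cu dU; have := mean_shift tau 0 cu dU; rewrite addr0 => <-.
by congr mean; apply/funext => t; rewrite addr0.
Qed.

(** Three terms are what a first-order remainder [f (z + h *: v) - f z - h * D z] consists of;
    shorter combinations take zero coefficients. *)
Lemma mean_lin tau u1 u2 u3 (a b c : R) : continuous u1 -> continuous u2 -> continuous u3 ->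
  mean tau (fun t => a * u1 t + b * u2 t + c * u3 t) = a * mean tau u1 + b * mean tau u2 + c * mean tau u3.
Proof.
move=> c1 c2 c3.
have cu : continuous (fun t => a * u1 t + b * u2 t + c * u3 t).
  move=> t; apply: cvgD; last by apply: cvgMr; exact: c3.
  by apply: cvgD; apply: cvgMr; [exact: c1|exact: c2].
have dU (t : R) : is_derive t 1 (fun t => a * antiderivative u1 t +
    b * antiderivative u2 t + c * antiderivative u3 t) (a * u1 t + b * u2 t + c * u3 t).
  have d1 := antiderivativeP c1 t; have d2 := antiderivativeP c2 t.
  by have d3 := antiderivativeP c3 t; apply: is_derive_eq; rewrite /GRing.scale/=.
by rewrite (meanE tau cu dU) /mean; ring.
Qed.

Lemma mean_bound tau u (m : R) : 0 < tau -> continuous u ->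
  (forall t, 0 <= t <= tau -> m <= u t) -> m <= mean tau u.
Proof.
move=> tau0 cu mu; rewrite ler_pdivlMl//.
have := @is_derive_nonincr R (fun t => m * t - antiderivative u t) (fun t => m - u t) 0 tau (ltW tau0).
rewrite mulr0 sub0r => h.
suff : m * tau - antiderivative u tau <= - antiderivative u 0 by lra.
apply: h => t tt; last by rewrite subr_le0 mu.
by have d := antiderivativeP cu t; apply: is_derive_eq; rewrite /GRing.scale/= mulr1.
Qed.

Lemma mean_abs tau u (d : R) : 0 < tau -> continuous u ->
  (forall t, 0 <= t <= tau -> `|u t| <= d) -> `|mean tau u| <= d.
Proof.
move=> tau0 cu ud.
have E := mean_lin tau (-1) 0 0 cu cu cu; rewrite !mul0r !addr0 mulN1r in E.
rewrite ler_norml; apply/andP; split.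
  by apply: mean_bound => // t /ud; rewrite ler_norml => /andP[].
rewrite -lerN2 -E; apply: mean_bound => // [t|t /ud].
  apply: cvgD; last by apply: cvgMr; exact: cu.
  by apply: cvgD; apply: cvgMr; exact: cu.
by rewrite ler_norml => /andP[]; lra.
Qed.

End Mean.

Section Smoothing.
Variables (R : realType) (H : completeNormedModType R).
Implicit Types (f g : H -> R) (v z : H).

Definition average (tau : R) v f z := mean tau (fun t => f (z + t *: v)).

Lemma line_continuous f (C : R) v z : (forall x y, `|f x - f y| <= C * `|x - y|) ->
  continuous (fun t : R => f (z + t *: v)).
Proof.
move=> lip; apply: (@lipschitz_bound_continuous R R R _ (C * `|v|)) => x y.
apply: le_trans (lip _ _) _; rewrite opprD addrACA subrr add0r -scalerBl normrZ.
by rewrite -mulrA [`|v| * _]mulrC.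
Qed.

(** This is how the Lyapunov inequality is inherited: a lower bound for increments at all translates
    bounds the increment of the average. *)
Lemma average_increment f (C tau : R) v z u (m : R) : 0 < tau ->
  (forall x y, `|f x - f y| <= C * `|x - y|) ->
  (forall t, 0 <= t <= tau -> m <= f (z + t *: v + u) - f (z + t *: v)) ->
  m <= average tau v f (z + u) - average tau v f z.
Proof.
move=> tau0 lip h.
have c1 := @line_continuous f C v (z + u) lip; have c2 := @line_continuous f C v z lip.
have := mean_lin tau 1 (-1) 0 c1 c2 c2.
rewrite mul1r mul0r addr0 mulN1r => <-; apply: mean_bound => //.
  by move=> t; apply: cvgD; [apply: cvgD|]; apply: cvgMr; [exact: c1|exact: c2|exact: c2].
by move=> t /h; rewrite mul1r mulN1r mul0r addr0 addrAC.
Qed.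

Lemma average_near f (C tau : R) v z (a d : R) : 0 < tau ->
  (forall x y, `|f x - f y| <= C * `|x - y|) ->
  (forall t, 0 <= t <= tau -> `|f (z + t *: v) - a| <= d) ->
  `|average tau v f z - a| <= d.
Proof.
move=> tau0 lip h; have c := @line_continuous f C v z lip.
have c1 : continuous (fun _ : R => 1 : R) by move=> t; exact: cvg_cst.
have m1 : mean tau (fun _ : R => 1 : R) = 1.
  have d1 (t : R) : is_derive t 1 (fun t : R => t) 1 by exact: is_derive_id.
  by rewrite (meanE tau c1 d1) subr0 mulVf ?gt_eqF.
have cc (u : R -> R) (b e : R) : continuous u -> continuous (fun t => b * u t + e + 0).
  move=> cu t; apply: cvgD; last exact: cvg_cst.
  by apply: cvgD; last exact: cvg_cst; apply: cvgMr; exact: cu.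
have := mean_lin tau 1 (- a) 0 c c1 c1; have := mean_lin tau (-1) a 0 c c1 c1.
rewrite m1 !mulr1 !addr0 mul1r mulN1r => E1 E2.
rewrite ler_norml; apply/andP; split.
  rewrite /average -E2; apply: mean_bound => // [|t /h]; first exact: (cc _ 1 (- a) c).
  by rewrite ler_norml => /andP[]; lra.
rewrite -lerN2 opprB addrC /average -E1; apply: mean_bound => // [|t /h]; first exact: (cc _ (-1) a c).
by rewrite ler_norml => /andP[]; lra.
Qed.

Lemma average_lip f (C tau : R) v : 0 < tau ->
  (forall x y, `|f x - f y| <= C * `|x - y|) ->
  forall x y, `|average tau v f x - average tau v f y| <= C * `|x - y|.
Proof.
move=> tau0 lip x y.
have h a b : - (C * `|a - b|) <= average tau v f a - average tau v f b.
  have := @average_increment f C tau v b (a - b) (- (C * `|a - b|)) tau0 lip.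
  rewrite subrKC => -> // t _; have := lip (b + t *: v + (a - b)) (b + t *: v).
  by rewrite [_ + (a - b)]addrC addrK ler_norml => /andP[].
have h1 := h x y; have h2 := h y x; rewrite distrC in h2.
by rewrite ler_norml; apply/andP; split; lra.
Qed.

(** A quantitative form of being C^1 in the direction [v]. Asking [D] to be Lipschitz in all
    directions is what allows several directions to be combined. *)
Definition dir_smooth f v (D : H -> R) (l : R) : Prop :=
  (forall x y, `|D x - D y| <= l * `|x - y|) /\
  (forall z h, `|f (z + h *: v) - f z - h * D z| <= l * h ^+ 2).

Lemma average_dir_smooth f (C tau : R) v w D l : 0 < tau ->
  (forall x y, `|f x - f y| <= C * `|x - y|) -> dir_smooth f v D l ->
  dir_smooth (average tau w f) v (average tau w D) l.
Proof.
move=> tau0 lip [Dlip fD]; split; first exact: average_lip.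
move=> z h.
have c1 := @line_continuous f C w (z + h *: v) lip.
have c2 := @line_continuous f C w z lip; have c3 := @line_continuous D l w z Dlip.
have := mean_lin tau 1 (-1) (- h) c1 c2 c3.
rewrite mul1r mulN1r mulNr => <-; apply: mean_abs => // t.
  apply: cvgD; last by apply: cvgMr; exact: c3.
  by apply: cvgD; apply: cvgMr; [exact: c1|exact: c2].
by move=> _; have := fD (z + t *: w) h; rewrite mul1r mulN1r mulNr [z + h *: v + _]addrAC.
Qed.

(** The derivative of a moving average is a difference quotient, which is Lipschitz with a constant
    of order [1 / tau] as soon as the function is. *)
Lemma average_self_dir_smooth f (C tau : R) v : 0 < tau -> 0 <= C ->
  (forall x y, `|f x - f y| <= C * `|x - y|) ->
  dir_smooth (average tau v f) v (fun z => tau^-1 * (f (z + tau *: v) - f z))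
    (tau^-1 * (2 * C + 2 * C * `|v|)).
Proof.
move=> tau0 C0 lip; split=> [x y|z h].
  rewrite -mulrBr normrM ger0_norm ?invr_ge0 ?(ltW tau0)// -[leRHS]mulrA.
  rewrite ler_wpM2l ?invr_ge0 ?(ltW tau0)//.
  have h1 := lip (x + tau *: v) (y + tau *: v); have h2 := lip x y.
  have E : x + tau *: v - (y + tau *: v) = x - y.
    by rewrite opprD addrACA subrr addr0.
  rewrite E in h1.
  have : 0 <= 2 * C * `|v| * `|x - y| by rewrite !mulr_ge0.
  have := ler_normB (f (x + tau *: v) - f (y + tau *: v)) (f x - f y).
  have -> : f (x + tau *: v) - f x - (f (y + tau *: v) - f y) = f (x + tau *: v) - f (y + tau *: v) - (f x - f y) by ring.
  by lra.
pose u (t : R) := f (z + t *: v).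
have cu : continuous u by exact: (@line_continuous f C v z lip).
have dU := antiderivativeP cu; set U := antiderivative u in dU.
have -> : average tau v f (z + h *: v) = tau^-1 * (U (tau + h) - U h).
  rewrite -(mean_shift tau h cu dU); congr mean; apply/funext => t.
  by rewrite /u scalerDl [t *: v + _]addrC addrA.
have -> : average tau v f z = tau^-1 * (U tau - U 0) by exact: meanE.
have step a : `|U (h + a) - U a - h * u a| <= C * `|v| * h ^+ 2.
  have := @is_derive_lip R (fun s => U s - s * u a) (fun s => u s - u a) a (h + a)
    (C * `|v| * `|h|).
  rewrite addrK => H1.
  have -> : U (h + a) - U a - h * u a = U (h + a) - (h + a) * u a - (U a - a * u a) by ring.
  rewrite -[h ^+ 2]real_normK ?num_real// expr2 mulrA; apply: H1 => s sh.
    by have ds := dU s; apply: is_derive_eq; rewrite scaler0 add0r /GRing.scale/= mulr1.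
  apply: le_trans (lip _ _) _; rewrite opprD addrACA subrr add0r -scalerBl normrZ.
  by rewrite -mulrA ler_wpM2l// mulrC ler_wpM2l.
have h1 := step tau; have h2 := step 0; rewrite addr0 in h2.
have -> : tau^-1 * (U (tau + h) - U h) - tau^-1 * (U tau - U 0) -
  h * (tau^-1 * (f (z + tau *: v) - f z)) =
  tau^-1 * ((U (h + tau) - U tau - h * u tau) - (U h - U 0 - h * u 0)).
  by rewrite /u scale0r addr0 [tau + h]addrC; ring.
rewrite normrM ger0_norm ?invr_ge0 ?(ltW tau0)// -[leRHS]mulrA.
rewrite ler_wpM2l ?invr_ge0 ?(ltW tau0)//.
apply: le_trans (ler_normB _ _) _.
have : 0 <= 2 * C * h ^+ 2 by rewrite mulr_ge0 ?sqr_ge0// mulr_ge0.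
by lra.
Qed.

(* Averaging over a small box spanned by [e]. *)
Lemma smoothing g (C rho : R) (e : seq H) : 0 <= C -> 0 < rho ->
  (forall x y, `|g x - g y| <= C * `|x - y|) ->
  exists f : H -> R, [/\
    forall x y, `|f x - f y| <= C * `|x - y|,
    forall z u m, (forall y, `|y| <= rho -> m <= g (z + y + u) - g (z + y)) ->
      m <= f (z + u) - f z,
    forall z, `|f z - g z| <= C * rho
  & forall v, v \in e -> exists D l, 0 <= l /\ dir_smooth f v D l].
Proof.
move=> C0; elim: e rho => [|v e IH] rho rho0 lip.
  exists g; split=> // [z u m /(_ 0)|z].
    by rewrite normr0 !addr0; apply; exact: ltW.
  by rewrite subrr normr0 mulr_ge0// ltW.
have rho2 : 0 < rho / 2 by rewrite divr_gt0.
have [f [flip finc fg fD]] := IH _ rho2 lip.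
(* Segments of length at most [rho / 2], the other half of [rho] being left to the remaining
   directions; adding 1 admits [v = 0]. *)
pose tau := rho / 2 / (`|v| + 1).
have v1 : 0 < `|v| + 1 by rewrite ltr_wpDl.
have tau0 : 0 < tau by rewrite divr_gt0.
have tv t : 0 <= t <= tau -> `|t *: v| <= rho / 2.
  move=> /andP[t0 tt]; rewrite normrZ ger0_norm//.
  apply: (@le_trans _ _ (tau * (`|v| + 1))); last by rewrite divfK ?gt_eqF.
  by apply: ler_pM => //; rewrite lerDl.
exists (average tau v f); split.
- exact: average_lip.
- move=> z u m h; apply: (average_increment tau0 flip) => t /tv tt.
  apply: finc => y yr; have := h (t *: v + y); rewrite !addrA; apply.
  by rewrite (splitr rho) (le_trans (ler_normD _ _))// lerD.
- move=> z; apply: (average_near tau0 flip) => t /tv tt.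
  rewrite -(subrKA (g (z + t *: v))) (le_trans (ler_normD _ _))//.
  rewrite (splitr rho) mulrDr; apply: lerD; first exact: fg.
  by apply: le_trans (lip _ _) _; rewrite addrAC subrr add0r ler_wpM2l.
- move=> w; rewrite inE => /predU1P[->|/fD[D [l [l0 fDl]]]].
    exists (fun z => tau^-1 * (f (z + tau *: v) - f z)), (tau^-1 * (2 * C + 2 * C * `|v|)).
    split; last exact: average_self_dir_smooth.
    by rewrite mulr_ge0 ?invr_ge0 ?(ltW tau0)// addr_ge0 ?mulr_ge0.
  exists (average tau v D), l; split=> //.
  exact: (average_dir_smooth v tau0 flip fDl).
Qed.

End Smoothing.

(** * From directional derivatives to a gradient *)

Section GradientAssembly.
Variables (R : realType) (H : completeNormedModType R).
Variables (ip : {dot H for idfun}) (ip_norm : hilbert_norm ip).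
Implicit Types (f : H -> R) (e s : seq H).

Lemma dir_smooth_uniform f s :
  (forall v, v \in s -> exists D l, 0 <= l /\ dir_smooth f v D l) ->
  exists (D : H -> H -> R) (l : R), 0 <= l /\ forall v, v \in s -> dir_smooth f v (D v) l.
Proof.
elim: s => [|v s IH] h; first by exists (fun _ _ => 0), 0.
have [w ws|D [l [l0 Dl]]] := IH; first by apply: h; rewrite inE ws orbT.
have [D0 [k [k0 Dk]]] := h v (mem_head _ _).
exists (fun w => if w == v then D0 else D w), (l + k); split; first exact: addr_ge0.
have mono w D' a b : a <= b -> dir_smooth f w D' a -> dir_smooth f w D' b.
  move=> ab [h1 h2]; split=> [x y|z u].
    by apply: le_trans (h1 x y) _; rewrite ler_wpM2r.
  by apply: le_trans (h2 z u) _; rewrite ler_wpM2r// sqr_ge0.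
move=> w; rewrite inE; case: eqP => [-> _|_ /= ws].
  by apply: (mono _ _ k) => //; rewrite lerDr.
by apply: (mono _ _ l); [rewrite lerDl|exact: Dl].
Qed.

(** The displacement is made one vector at a time. Moving along [v] first shifts the base point of
    the other derivatives; since these are Lipschitz, the shift enters at second order. *)
Lemma dir_smooth_comb f s (D : H -> H -> R) (l : R) : 0 <= l ->
  (forall v, v \in s -> `|v| <= 1) -> (forall v, v \in s -> dir_smooth f v (D v) l) ->
  exists2 C : R, 0 <= C & forall z (c : H -> R),
    `|f (z + \sum_(v <- s) c v *: v) - f z - \sum_(v <- s) c v * D v z| <=
      C * (\sum_(v <- s) `|c v|) ^+ 2.
Proof.
move=> l0; elim: s => [_ _|v s IH s1 fD].
  by exists 0 => // z c; rewrite !big_nil addr0 subrr subr0 normr0 mul0r.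
have [w ws|w ws|C C0 h] := IH; [by apply: s1; rewrite inE ws orbT|by apply: fD; rewrite inE ws orbT|].
exists (C + l + l) => [|z c]; first by rewrite !addr_ge0.
rewrite !big_cons; set S := \sum_(w <- s) `|c w|.
have S0 : 0 <= S by exact: sumr_ge0.
have h1 := h (z + c v *: v) c; rewrite -/S in h1.
have [Dv fv] := fD v (mem_head _ _).
have h2 := fv z (c v); rewrite -[c v ^+ 2]real_normK ?num_real// in h2.
have h3 : `|\sum_(w <- s) c w * D w (z + c v *: v) - \sum_(w <- s) c w * D w z| <= l * `|c v| * S.
  rewrite -sumrB; apply: le_trans (ler_norm_sum _ _ _) _.
  rewrite /S mulr_sumr big_seq [leRHS]big_seq; apply: ler_sum => w ws.
  rewrite -mulrBr normrM mulrC ler_wpM2r//.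
  have ws' : w \in v :: s by rewrite inE ws orbT.
  have [Dw _] := fD w ws'.
  apply: le_trans (Dw _ _) _; rewrite addrAC subrr add0r normrZ ler_wpM2l//.
  by rewrite ler_piMr// s1// mem_head.
have -> : f (z + (c v *: v + \sum_(j <- s) c j *: j)) - f z - (c v * D v z + \sum_(j <- s) c j * D j z) =
  (f (z + c v *: v + \sum_(v <- s) c v *: v) - f (z + c v *: v) - \sum_(w <- s) c w * D w (z + c v *: v))
  + (\sum_(w <- s) c w * D w (z + c v *: v) - \sum_(w <- s) c w * D w z)
  + (f (z + c v *: v) - f z - c v * D v z) by rewrite addrA; ring.
apply: le_trans (ler_normD _ _) _; apply: le_trans (lerD (ler_normD _ _) (lexx _)) _.
apply: le_trans (lerD (lerD h1 h3) h2) _.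
have a0 := normr_ge0 (c v); set a := `|c v| in a0 *.
have : 0 <= C * (2 * a * S + a ^+ 2) by rewrite mulr_ge0// addr_ge0 ?sqr_ge0 ?mulr_ge0.
have : 0 <= l * (3 * a * S + a ^+ 2 + 2 * S ^+ 2).
  by rewrite mulr_ge0// !addr_ge0 ?sqr_ge0 ?mulr_ge0 ?sqr_ge0.
by rewrite sqrrD; lra.
Qed.

Lemma ip_comb e (d : H -> R) w : orthonormal ip e -> w \in e ->
  ip (\sum_(v <- e) d v *: v) w = d w.
Proof.
move=> [ue oe] we; rewrite (ip_suml ip) (bigD1_seq w)//= (ipZl ip) (oe _ _ we we).
rewrite eqxx mulr1 big_seq_cond big1 ?addr0// => v /andP[ve vw].
by rewrite (ipZl ip) oe// (negPf vw) mulr0.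
Qed.

Lemma smooth_gradient f e : orthonormal ip e ->
  (forall v, v \in e -> exists D l, 0 <= l /\ dir_smooth f v D l) ->
  exists (Gr : H -> H) (l C : R), [/\ 0 <= l, 0 <= C,
    forall x y, `|Gr x - Gr y| <= l * `|proj ip e x - proj ip e y|,
    forall x, proj ip e (Gr x) = Gr x
  & forall x h, `|f (proj ip e (x + h)) - f (proj ip e x) - ip (Gr x) h| <= C * `|h| ^+ 2].
Proof.
move=> oe /dir_smooth_uniform[D [l [l0 fD]]].
have e1 v : v \in e -> `|v| <= 1.
  move=> ve; rewrite -(@expr_le1 _ 2)// ip_norm.
  by rewrite (oe.2 _ _ ve ve) eqxx.
have [C C0 fC] := dir_smooth_comb l0 e1 fD.
(* The number of basis vectors bounds the sum of the coordinates by their maximum. *)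
pose n : R := (size e)%:R.
have sum_le (c : H -> R) a : (forall v, v \in e -> `|c v| <= a) -> \sum_(v <- e) `|c v| <= n * a.
  move=> ca; rewrite big_seq; apply: (@le_trans _ _ (\sum_(v <- e | v \in e) a)).
    exact: ler_sum.
  by rewrite -big_seq big_const_seq count_predT iter_addr_0 -mulr_natl.
exists (fun x => \sum_(v <- e) D v (proj ip e x) *: v), (n * l), (C * n ^+ 2).
split=> [|||x|x h].
- by rewrite mulr_ge0// ler0n.
- by rewrite mulr_ge0// sqr_ge0.
- move=> x y; rewrite -sumrB; under eq_bigr do rewrite -scalerBl.
  apply: le_trans (ler_norm_sum _ _ _) _.
  apply: (@le_trans _ _ (\sum_(v <- e) `|D v (proj ip e x) - D v (proj ip e y)|)).
    rewrite big_seq [leRHS]big_seq; apply: ler_sum => v ve.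
    by rewrite normrZ ler_piMr// e1.
  by rewrite -mulrA; apply: sum_le => v /fD[+ _]; exact.
- rewrite {1}/proj big_seq [RHS]big_seq; apply: eq_bigr => v ve.
  by rewrite ip_comb.
- rewrite projD; have := fC (proj ip e x) (fun v => ip h v).
  rewrite -/(proj ip e h) (ip_suml ip).
  under [in X in _ -> X]eq_bigr do rewrite (ipZl ip) (ipC ip _ h).
  under eq_bigr do rewrite mulrC.
  move=> hle; apply: le_trans hle _.
  rewrite -mulrA ler_wpM2l// -exprMn ler_sqr ?nnegrE; last 2 first.
    exact: sumr_ge0.
    by rewrite mulr_ge0// ler0n.
  apply: sum_le => v ve; apply: le_trans (ip_abs ip_norm _ _) _.
  by rewrite ler_piMr// e1.
Qed.

Lemma limit_le (A B C s0 : R) : 0 < s0 -> (forall t, 0 < t <= s0 -> A <= B + C * t) -> A <= B.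
Proof.
move=> s00 h; apply/ler_addgt0Pr => e e0.
pose t := Num.min s0 (e / (`|C| + 1)).
have C1 : 0 < `|C| + 1 by rewrite ltr_wpDl.
have t0 : 0 < t by rewrite lt_min s00 divr_gt0.
apply: le_trans (h t _) _; first by rewrite t0 ge_min lexx.
rewrite lerD2l; apply: (@le_trans _ _ ((`|C| + 1) * t)).
  by rewrite ler_wpM2r ?(ltW t0)// (le_trans (ler_norm _))// lerDl.
by rewrite mulrC -ler_pdivlMr// ge_min lexx orbT.
Qed.

End GradientAssembly.

(** * A function of [P x] plus a quadratic form in [x - P x] *)

Section SplitFunction.
Variables (R : realType) (H : completeNormedModType R).
Variables (ip : {dot H for idfun}) (ip_norm : hilbert_norm ip).
Variables (L : {linear H -> H}) (CL : R).
Hypotheses (CL0 : 0 < CL) (L_le : forall x, `|L x| <= CL * `|x|).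
Hypothesis L_sa : selfadjoint ip L.
Variables (E : set H) (P : H -> H).
Hypotheses (E_fin : fin_dim_subspace E) (EP : orthogonal_projection ip E P)
  (L_E : L @` E = E).
Variables (th : R) (f : H -> R) (Gr : H -> H) (lG CG : R).
Hypotheses (th0 : 0 <= th) (lG0 : 0 <= lG) (CG0 : 0 <= CG)
  (Gr_lip : forall x y, `|Gr x - Gr y| <= lG * `|x - y|)
  (P_Gr : forall x, P (Gr x) = Gr x)
  (f_Gr : forall x h, `|f (P (x + h)) - f (P x) - ip (Gr x) h| <= CG * `|h| ^+ 2).

(** This becomes the [b] of the theorem: subtracting it removes the quadratic form on [E] and puts
    [th * f] in its place. *)
Definition support_part x := 2^-1 * ip (L (P x)) (P x) - th * f (P x).
Definition split_function x := 2^-1 * ip (L x) x - support_part x.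
Definition split_gradient x := L (x - P x) + th *: Gr x.

Let PL x : L (P x) = P (L x) := oproj_comm ip_norm E_fin EP L_sa L_E x.

Let quadratic_formD (y z : H) :
  ip (L (y + z)) (y + z) = ip (L y) y + 2 * ip (L y) z + ip (L z) z.
Proof. by rewrite [L (_ + _)]linearD (ipDl ip) !(ipDr ip) (L_sa z) (ipC ip z); ring. Qed.

Lemma support_part_proj x : support_part (P x) = support_part x.
Proof. by rewrite /support_part (oproj_idem ip_norm E_fin EP). Qed.

Lemma split_functionE x :
  split_function x = th * f (P x) + 2^-1 * ip (L (x - P x)) (x - P x).
Proof.
have h : ip (L (P x)) (x - P x) = 0 by rewrite PL (ipC ip) (oproj_orth EP).
have h' : ip (L (x - P x)) (P x) = 0 by rewrite L_sa (ipC ip) h.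
rewrite /split_function /support_part.
have -> : ip (L x) x = ip (L (P x)) (P x) + ip (L (x - P x)) (x - P x).
  have := quadratic_formD (x - P x) (P x).
  by rewrite subrK h' mulr0 addr0 addrC.
by ring.
Qed.

Lemma split_function_gradient x : is_gradient ip split_function x (split_gradient x).
Proof.
apply: (is_gradient_from_bound ip_norm) => r r0.
pose C := CL + th * CG; have C0 : 0 < C by rewrite ltr_wpDr// mulr_ge0.
have key h : `|split_function (h + x) - split_function x - ip (split_gradient x) h| <= C * `|h| ^+ 2.
  have Lh z : `|ip (L z) z| <= CL * `|z| ^+ 2.
    apply: le_trans (ip_abs ip_norm _ _) _; rewrite expr2 mulrA ler_wpM2r//.
  have := f_Gr x h; set e := f _ - f _ - _ => he.
  have -> : split_function (h + x) - split_function x - ip (split_gradient x) h =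
    2^-1 * ip (L h) h - 2^-1 * ip (L (P h)) (P h) + th * e.
    rewrite /split_function /support_part /split_gradient /e [h + x]addrC.
    rewrite (oprojD ip_norm E_fin EP) !quadratic_formD (ipDl ip) (ipZl ip) [L (x - P x)]linearB (ipBl ip).
    have -> : ip (L (P x)) (P h) = ip (L (P x)) h.
      by rewrite -(oproj_ip EP) -PL (oproj_idem ip_norm E_fin EP).
    by field.
  have h1 := Lh h; have h2 := Lh (P h).
  have h3 : CL * `|P h| ^+ 2 <= CL * `|h| ^+ 2.
    rewrite ler_wpM2l ?(ltW CL0)// ler_sqr ?nnegrE//; exact: oproj_norm.
  have h4 : `|th * e| <= th * (CG * `|h| ^+ 2).
    by rewrite normrM (ger0_norm th0) ler_wpM2l.
  apply: le_trans (ler_normD _ _) _; apply: le_trans (lerD (ler_normB _ _) h4) _.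
  rewrite !normrM ger0_norm ?invr_ge0//; rewrite /C; lra.
apply/nbhs_ballP; exists (r / C) => /=; first exact: divr_gt0.
move=> h; rewrite -ball_normE /ball_/= sub0r normrN ltr_pdivlMr// => hr.
apply: le_trans (key h) _; rewrite expr2 mulrA ler_wpM2r// mulrC.
exact: ltW.
Qed.

Lemma split_gradient_lip x y :
  `|split_gradient x - split_gradient y| <= (CL + th * lG) * `|x - y|.
Proof.
rewrite /split_gradient opprD addrACA -linearB -scalerBr.
apply: le_trans (ler_normD _ _) _; rewrite mulrDl; apply: lerD.
  apply: le_trans (L_le _) _; rewrite ler_wpM2l ?(ltW CL0)//.
  exact: (oproj_residual_lip ip_norm E_fin EP).
by rewrite normrZ (ger0_norm th0) -mulrA ler_wpM2l.
Qed.

(** What remains after subtracting [L] is [th *: Gr x - L (P x)], which lies in the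
    finite-dimensional [E] and is bounded on bounded sets. *)
Lemma split_gradient_compact : completely_continuous (fun x => split_gradient x - L x).
Proof.
move=> B /bounded_setP[C C0 BC].
have [e [oe eE Pe]] := oproj_basis ip_norm E_fin EP.
apply: (@precompact_span R H ip ip_norm e _ (CL * C + th * (`|Gr 0| + lG * C))).
move=> _ [x Bx <-].
have -> : split_gradient x - L x = th *: Gr x - L (P x).
  by rewrite /split_gradient linearB/= addrAC [L x - _]addrC addrK addrC.
split.
  by rewrite -Pe (oprojB ip_norm E_fin EP) (oprojZ ip_norm E_fin EP) P_Gr PL
    (oproj_idem ip_norm E_fin EP).
have xC := BC _ Bx.
apply: le_trans (ler_normB _ _) _; rewrite addrC; apply: lerD.
  apply: le_trans (L_le _) _; rewrite ler_wpM2l ?(ltW CL0)//.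
  apply: le_trans xC; exact: oproj_norm.
rewrite normrZ (ger0_norm th0) ler_wpM2l//.
rewrite -[Gr x](subrK (Gr 0)) (le_trans (ler_normD _ _))// addrC lerD2l.
by apply: le_trans (Gr_lip _ _) _; rewrite subr0 ler_wpM2l.
Qed.

Lemma split_gradient_ip x y : ip (split_gradient x) y =
  ip (L (x - P x)) (y - P y) + th * ip (Gr x) (P y).
Proof.
rewrite /split_gradient (ipDl ip) (ipZl ip) -{1}P_Gr (oproj_ip EP).
congr (_ + _); rewrite (ipBr ip).
have -> : ip (L (x - P x)) (P y) = 0 by rewrite [L _]linearB PL (oproj_orth EP).
by rewrite subr0.
Qed.

End SplitFunction.

(** * Growth of the split function along [F] *)

Section GradientLike.
Variables (R : realType) (H : completeNormedModType R).
Variables (ip : {dot H for idfun}) (ip_norm : hilbert_norm ip).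
Variables (L : {linear H -> H}) (CL c : R).
Hypotheses (CL0 : 0 < CL) (c0 : 0 < c).
Hypotheses (L_le : forall x, `|L x| <= CL * `|x|) (L_ge : forall x, c * `|x| <= `|L x|).
Hypothesis L_sa : selfadjoint ip L.
Variables (E : nat -> set H) (P : nat -> H -> H).
Hypotheses (E_fin : forall n, fin_dim_subspace (E n))
  (E_increasing : forall n, E n `<=` E n.+1)
  (E_dense : closure (\bigcup_n E n) = setT)
  (L_E : forall n, L @` E n = E n)
  (EP : forall n, orthogonal_projection ip (E n) (P n)).
Variables (F K : H -> H) (l : R).
Hypotheses (l0 : 0 < l) (F_lip : forall x y, `|F x - F y| <= l * `|x - y|).
Hypotheses (FE : forall x, F x = L x + K x) (K_cc : completely_continuous K).
Variable phi : H -> R -> H.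
Hypothesis phi_F : generated_by F phi.
Variable U : set H.
Hypothesis U_iso : isolating_neighborhood U phi.

Let K_lip x y : `|K x - K y| <= (l + CL) * `|x - y|.
Proof.
have -> : K x - K y = (F x - F y) - L (x - y).
  have KE z : K z = F z - L z by rewrite FE addrC addKr.
  by rewrite !KE [L (x - y)]linearB !opprD !opprK addrACA.
by apply: le_trans (ler_normB _ _) _; rewrite mulrDl lerD.
Qed.

(* As [g] is only Lipschitz, comparing [P n (F x)] with [F (P n x)] costs a term
   [2 th (l + CL) |x - P n x|]; the quadratic term absorbs it up to a multiple of
   [th ^+ 2]. *)
Lemma gradient_estimate (g G : H -> R) (r C1 s0 th rho : R) n (f : H -> R) (Gr : H -> H) (CG M : R) :
  0 < r -> 0 < s0 -> 0 <= C1 -> 0 < th -> 0 < rho -> rho <= r / 16 -> 0 <= CG -> 0 < M ->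
  (forall x y, `|G x - G y| <= 2 * `|x - y|) -> (forall x, 0 <= G x <= 2) ->
  (forall z v s, (exists2 y, U y & `|z - y| < r / 4) -> 0 <= s <= s0 ->
    s * (l * G z - 2 * `|v - F z|) - C1 * s ^+ 2 <= g (z + s *: v) - g z) ->
  (forall x y, `|f x - f y| <= 2 * `|x - y|) ->
  (forall z u m, (forall y, `|y| <= rho -> m <= g (z + y + u) - g (z + y)) ->
      m <= f (z + u) - f z) ->
  (forall x, P n (Gr x) = Gr x) ->
  (forall x h, `|f (P n (x + h)) - f (P n x) - ip (Gr x) h| <= CG * `|h| ^+ 2) ->
  forall x e, U x -> `|F x| <= M -> `|K x - P n (K x)| <= e ->
  th * (4 * l * rho + 2 * e) + 2^-1 * e ^+ 2 <= th ^+ 2 ->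
  th * (2 * M + 2 * l) <= c ^+ 2 * r ^+ 2 / 256 ->
  th * (l * G (P n x)) + 4^-1 * c ^+ 2 * `|x - P n x| ^+ 2
    - (4 * (l + CL) ^+ 2 / c ^+ 2 + 1) * th ^+ 2 <=
  ip (split_gradient L (P n) th Gr x) (F x).
Proof.
move=> r0 s00 C10 th0 rho0 rhor CG0 M0 G_lip G02 g_inc f_lip f_inc P_Gr f_Gr x e Ux FM Ke err1 err2.
have En := E_fin n; have EPn := EP n.
rewrite (split_gradient_ip ip_norm L_sa En EPn (L_E n) th P_Gr).
set z := P n x; set q := `|x - z|; set v := P n (F x).
have Pv : P n v = v by rewrite /v (oproj_idem ip_norm En EPn).
have e0 : 0 <= e by exact: le_trans Ke.
have c20 : 0 < c ^+ 2 by rewrite exprn_gt0.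
have q0 : 0 <= q by exact: normr_ge0.
have res : 2^-1 * c ^+ 2 * q ^+ 2 - 2^-1 * e ^+ 2 <= ip (L (x - z)) (F x - v).
  apply: le_trans (residual_coercive ip_norm L_sa E_fin L_E EP FE Ke).
  have : (c * q) ^+ 2 <= `|L (x - z)| ^+ 2.
    rewrite ler_sqr ?nnegrE ?mulr_ge0 ?(ltW c0)//; exact: (L_ge (x - z)).
  by rewrite exprMn -/z; lra.
(* Passage from finite increments of [f] to its gradient, dividing by [t] and letting [t] tend to
   0. *)
have lim A C : (forall t, 0 < t <= s0 -> t * A - C * t ^+ 2 <= f (z + t *: v) - f z) ->
    A <= ip (Gr x) v.
  move=> hA; apply: (@limit_le R _ _ (C + CG * `|v| ^+ 2) s0) => // t /andP[t0 ts].
  have := f_Gr x (t *: v); have := hA t; rewrite t0 ts => /(_ isT).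
  rewrite (oprojD ip_norm En EPn) (oprojZ ip_norm En EPn) Pv -/z (ipZr ip) normrZ (gtr0_norm t0).
  move=> h1; rewrite ler_norml => /andP[_ h2].
  have : t * A <= t * (ip (Gr x) v + (C + CG * `|v| ^+ 2) * t).
    by move: h1 h2; rewrite exprMn; lra.
  by rewrite ler_pM2l.
have vM : `|v| <= M by apply: le_trans FM; exact: oproj_norm.
have weak : - (2 * M) <= ip (Gr x) v.
  apply: (lim _ 0) => t /andP[t0 _]; have := f_lip (z + t *: v) z.
  rewrite addrAC subrr add0r normrZ (gtr0_norm t0) ler_norml => /andP[h _].
  have : t * `|v| <= t * M by rewrite ler_wpM2l// ltW.
  by lra.
(* Far from [E n] the quadratic term alone dominates, [th] being small. Otherwise [z + y] is within
   [r / 8 + r / 16 < r / 4] of [x] and the growth of [g] applies. *)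
have [qr|qr] := ltP q (r / 8); last first.
  have q2 : (r / 8) ^+ 2 <= q ^+ 2 by rewrite ler_sqr ?nnegrE// divr_ge0// ltW.
  have h1 := ler_wpM2l (ltW c20) q2.
  have h2 := ler_wpM2l (ltW th0) weak.
  have h3 : th * (l * G z) <= th * (2 * l).
    rewrite ler_wpM2l ?(ltW th0)// mulrC ler_wpM2r ?(ltW l0)//.
    by case/andP: (G02 z).
  have h4 : 0 <= th * (4 * l * rho + 2 * e).
    have lr := mulr_gt0 l0 rho0.
    by rewrite mulr_ge0 ?(ltW th0)//; lra.
  have h5 : 0 <= (4 * (l + CL) ^+ 2 / c ^+ 2) * th ^+ 2.
    by rewrite mulr_ge0 ?sqr_ge0// divr_ge0 ?sqr_ge0// mulr_ge0 ?sqr_ge0.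
  move: h1 h2 h3 h4 h5 err1 err2 res; rewrite -/z -/v exprMn exprVn.
  by move=> *; lra.
have strong : l * G z - 4 * l * rho - 2 * e - 2 * (l + CL) * q <= ip (Gr x) v.
  apply: (lim _ C1) => t /andP[t0 ts]; apply: f_inc => y yr.
  have Uzy : exists2 u, U u & `|z + y - u| < r / 4.
    exists x => //; rewrite addrAC (le_lt_trans (ler_normD _ _))// distrC -/q.
    by lra.
  have := g_inc (z + y) v t Uzy; rewrite (ltW t0) ts => /(_ isT).
  apply: le_trans; rewrite lerD2r ler_wpM2l ?(ltW t0)//.
  have h1 := G_lip (z + y) z; rewrite addrAC subrr add0r ler_norml in h1.
  case/andP: h1 => h1 _.
  (* The linear parts of [v] and [F z] agree because [L] commutes with [P n]. What is left is the
     residual of [K] at [x], the change of [K] from [x] to [z], and the change of [F] over the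
     box. *)
  have h2 : `|v - F (z + y)| <= e + (l + CL) * q + l * rho.
    have -> : v - F (z + y) = - (K x - P n (K x)) + (K x - K z) + (F z - F (z + y)).
      have -> : v - F (z + y) = (v - F z) + (F z - F (z + y)) by rewrite subrKA.
      rewrite opprB [X in _ = X + _]subrKA; congr (_ + _).
      rewrite /v {1}FE (oprojD ip_norm En EPn) -(oproj_comm ip_norm En EPn L_sa (L_E n)).
      by rewrite FE opprD addrACA subrr add0r.
    apply: le_trans (ler_normD _ _) _; apply: le_trans (lerD (ler_normD _ _) (lexx _)) _.
    rewrite normrN; apply: lerD; first apply: lerD => //.
      by apply: le_trans (F_lip _ _) _; rewrite opprD addNKr normrN ler_wpM2l// ltW.
  have h3 : l * (2 * `|y|) <= l * (2 * rho) by rewrite ler_wpM2l ?(ltW l0)// ler_wpM2l.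
  have h4 := ler_wpM2l (ltW l0) h1.
  by move: h3 h4; lra.
have h1 := ler_wpM2l (ltW th0) strong.
(* Completing the square against half of the available quadratic growth. *)
have h2 : 2 * th * (l + CL) * q <= 4^-1 * c ^+ 2 * q ^+ 2 + 4 * (l + CL) ^+ 2 / c ^+ 2 * th ^+ 2.
  have := sqr_ge0 (2^-1 * c * q - 2 * (l + CL) / c * th).
  have -> : (2^-1 * c * q - 2 * (l + CL) / c * th) ^+ 2 =
   4^-1 * c ^+ 2 * q ^+ 2 + 4 * (l + CL) ^+ 2 / c ^+ 2 * th ^+ 2 - 2 * th * (l + CL) * q.
    by field; rewrite gt_eqF.
  by rewrite subr_ge0.
by move: h1 h2 err1 res; rewrite -/z -/v; move=> *; lra.
Qed.

End GradientLike.

Section GradientLikeFunction.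
Variables (R : realType) (H : completeNormedModType R).
Variables (ip : {dot H for idfun}) (ip_norm : hilbert_norm ip).
Variables (L : {linear H -> H}) (CL c : R).
Hypotheses (CL0 : 0 < CL) (c0 : 0 < c).
Hypotheses (L_le : forall x, `|L x| <= CL * `|x|) (L_ge : forall x, c * `|x| <= `|L x|).
Hypothesis L_sa : selfadjoint ip L.
Variables (E : nat -> set H) (P : nat -> H -> H).
Hypotheses (E_fin : forall n, fin_dim_subspace (E n))
  (E_increasing : forall n, E n `<=` E n.+1)
  (E_dense : closure (\bigcup_n E n) = setT)
  (L_E : forall n, L @` E n = E n)
  (EP : forall n, orthogonal_projection ip (E n) (P n)).
Variables (F K : H -> H) (l : R).
Hypotheses (l0 : 0 < l) (F_lip : forall x y, `|F x - F y| <= l * `|x - y|).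
Hypotheses (FE : forall x, F x = L x + K x) (K_cc : completely_continuous K).
Variable phi : H -> R -> H.
Hypothesis phi_F : generated_by F phi.
Variable U : set H.
Hypothesis U_iso : isolating_neighborhood U phi.

(** The output is shaped for [no_boundary_orbit], with [nu] of order [th] and [nu0] of order
    [th ^+ 2]. The numbers [r], [T], [d], [mu] come from isolation, then [th] is fixed, then [rho]
    and [e], then [n], and the smoothing comes last. *)
Lemma gradient_like_function : exists (n : nat) (b : H -> R) (Gd : H -> H),
  let f x := 2^-1 * ip (L x) x - b x in
  [/\ forall x, b (P n x) = b x,
    forall x, is_gradient ip f x (Gd x),
    exists2 lG : R, 0 <= lG & forall x y, `|Gd x - Gd y| <= lG * `|x - y|,
    completely_continuous (fun x => Gd x - L x)
  & exists d nu nu0 M B : R, [/\ [/\ 0 < d, 0 < nu, 0 < nu0 & 0 < M],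
      forall x, U x -> `|F x| <= M /\ `|f x| <= B,
      forall x, U x -> d * nu / (8 * M) <= `|f x| -> nu0 <= ip (Gd x) (F x)
    & forall x, U x -> ~ (ball x d `<=` U) -> nu <= ip (Gd x) (F x)]].
Proof.
have [r [T [d [r0 r1 T0 d0 deep]]]] := isolation_time ip_norm CL0 c0 L_le L_ge L_sa
  E_fin E_increasing E_dense L_E EP l0 F_lip FE K_cc phi_F U_iso.
have [Ucl Ubd _] := U_iso.
have [g [G [g_lip G_lip gG [mu mu0 Gmu] [C1 [s0 [C10 s00 g_inc]]]]]] :=
  lyapunov_pair ip_norm l0 F_lip phi_F r0 r1 Ubd deep.
have [Rad Rad0 URad] := bounded_setP Ubd.
pose M := `|F 0| + l * Rad + 1.
have M0 : 0 < M by rewrite ltr_wpDl// addr_ge0// mulr_ge0 ?ltW.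
have FM x : U x -> `|F x| <= M.
  move=> /URad xR; have := F_lip x 0; rewrite subr0 => Fx.
  have : `|F x| <= `|F 0| + l * `|x|.
    by rewrite -[F x](subrK (F 0)) (le_trans (ler_normD _ _))// addrC lerD2l.
  by have := ler_wpM2l (ltW l0) xR; rewrite /M; lra.
have G02 x : 0 <= G x <= 2.
  by have /andP[h ->] := gG x; rewrite andbT (le_trans _ h).
have c20 : 0 < c ^+ 2 by rewrite exprn_gt0.
pose C := 4 * (l + CL) ^+ 2 / c ^+ 2 + 1.
have C0 : 0 < C by rewrite ltr_wpDl// divr_ge0 ?(ltW c20)// mulr_ge0 ?sqr_ge0.
(* Where [S < 2 C th^2], the value [|f|] is below [C' th^2]. The three summands come from [th * G],
   from the averaging error, and from the quadratic form. *)
pose C' := 2 * C / l + 1 + 4 * CL * C / c ^+ 2.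
have C'0 : 0 < C'.
  have h1 : 0 < 2 * C / l by rewrite divr_gt0// mulr_gt0.
  have h2 : 0 < 4 * CL * C / c ^+ 2 by rewrite divr_gt0// !mulr_gt0.
  by rewrite /C'; lra.
pose mu1 := l * mu / 4; have mu10 : 0 < mu1 by rewrite divr_gt0// mulr_gt0.
(* The bounds serve, in this order, the case far from [E n] in [gradient_estimate], points not deep
   in [U] with a large residual, the absorption of the error [C th^2], and the gap between [C' th^2]
   and the threshold [d nu / (8 M)], which is linear in [th]. *)
have [th [th0 th1 th2 th3 th4]] : exists th : R, [/\ 0 < th,
    th * (2 * M + 2 * l) <= c ^+ 2 * r ^+ 2 / 256, th * l <= c ^+ 2 * mu / 32,
    C * th <= mu1 & C' * th < d * mu1 / (8 * M)].
  pose a1 := c ^+ 2 * r ^+ 2 / 256 / (2 * M + 2 * l).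
  pose a2 := c ^+ 2 * mu / 32 / l.
  pose a3 := mu1 / C.
  pose a4 := d * mu1 / (8 * M) / C' / 2.
  have p1 : 0 < 2 * M + 2 * l by rewrite addr_gt0// mulr_gt0.
  have a10 : 0 < a1.
    apply: divr_gt0 p1; apply: divr_gt0; last exact: ltr0n.
    by rewrite mulr_gt0 ?exprn_gt0.
  have a20 : 0 < a2 by rewrite divr_gt0// divr_gt0// mulr_gt0.
  have a30 : 0 < a3 by rewrite divr_gt0.
  have a40 : 0 < a4 by rewrite !divr_gt0// mulr_gt0.
  pose th := Num.min (Num.min a1 a2) (Num.min a3 a4).
  have t1 : th <= a1 by rewrite /th !ge_min lexx.
  have t2 : th <= a2 by rewrite /th !ge_min lexx !orbT.
  have t3 : th <= a3 by rewrite /th !ge_min lexx !orbT.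
  have t4 : th <= a4 by rewrite /th !ge_min lexx !orbT.
  exists th; split.
  - by rewrite !lt_min a10 a20 a30 a40.
  - by rewrite -ler_pdivlMr.
  - by rewrite -ler_pdivlMr.
  - by rewrite mulrC -ler_pdivlMr.
  - rewrite mulrC -ltr_pdivlMr//; apply: le_lt_trans t4 _.
    by rewrite ltr_pdivrMr// ltr_pMr ?ltr1n// !divr_gt0// mulr_gt0.
(* The second bound gives [|f - g| <= th]; the third, together with [e = th / 8], keeps the
   approximation errors below [th^2]. *)
pose rho := Num.min (r / 16) (Num.min (th / 2) (th / (16 * l))).
have rho0 : 0 < rho by rewrite !lt_min !divr_gt0// mulr_gt0.
have rho1 : rho <= r / 16 by rewrite ge_min lexx.
have rho2 : rho <= th / 2 by rewrite !ge_min lexx !orbT.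
have rho3 : rho <= th / (16 * l) by rewrite !ge_min lexx !orbT.
pose e := th / 8; have e0 : 0 < e by rewrite divr_gt0.
have err : th * (4 * l * rho + 2 * e) + 2^-1 * e ^+ 2 <= th ^+ 2.
  have : l * rho <= th / 16.
    apply: le_trans (ler_wpM2l (ltW l0) rho3) _.
    by rewrite le_eqVlt; apply/orP; left; apply/eqP; field; rewrite gt_eqF.
  move=> /(ler_wpM2l (ltW th0)); rewrite /e => h.
  by have := sqr_ge0 th; lra.
have pK : precompact (K @` U) by exact: K_cc.
have [n hn] := oproj_residual_uniform ip_norm E_fin E_increasing E_dense EP pK e0.
have Ke x : U x -> `|K x - P n (K x)| <= e by move=> Ux; apply: hn => //; exists x.
have En := E_fin n; have EPn := EP n.
have [es [oe _ Pe]] := oproj_basis ip_norm En EPn.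
have [f [f_lip f_inc f_g f_D]] := smoothing es (ler0n R 2) rho0 g_lip.
have [Gr [lG [CG [lG0 CG0 Gr_lip' Gr_P' f_Gr']]]] := smooth_gradient ip_norm oe f_D.
have Gr_lip x y : `|Gr x - Gr y| <= lG * `|x - y|.
  apply: le_trans (Gr_lip' x y) _; rewrite ler_wpM2l// -!Pe -(oprojB ip_norm En EPn).
  exact: oproj_norm.
have P_Gr x : P n (Gr x) = Gr x by rewrite Pe.
have f_Gr x h : `|f (P n (x + h)) - f (P n x) - ip (Gr x) h| <= CG * `|h| ^+ 2.
  by rewrite !Pe.
have fE x : 2^-1 * ip (L x) x - support_part ip L (P n) th f x =
    th * f (P n x) + 2^-1 * ip (L (x - P n x)) (x - P n x).
  exact: (split_functionE ip_norm L_sa En EPn (L_E n)).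
have f_abs x : `|2^-1 * ip (L x) x - support_part ip L (P n) th f x| <=
    th * G (P n x) + th ^+ 2 + 2^-1 * CL * `|x - P n x| ^+ 2.
  rewrite fE; apply: le_trans (ler_normD _ _) _; apply: lerD.
    rewrite normrM gtr0_norm// expr2 -mulrDr ler_wpM2l ?(ltW th0)//.
    rewrite -[f _](subrK (g (P n x))); apply: le_trans (ler_normD _ _) _.
    rewrite addrC; apply: lerD; first by case/andP: (gG (P n x)).
    by apply: le_trans (f_g _) _; lra.
  rewrite normrM ger0_norm ?invr_ge0// -[leRHS]mulrA ler_wpM2l ?invr_ge0//.
  by apply: le_trans (ip_abs ip_norm _ _) _; rewrite expr2 mulrA ler_wpM2r.
pose S x := th * (l * G (P n x)) + 4^-1 * c ^+ 2 * `|x - P n x| ^+ 2.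
have estimate x : U x -> S x - C * th ^+ 2 <= ip (split_gradient L (P n) th Gr x) (F x).
  move=> Ux; rewrite /S /C; apply: (@gradient_estimate R H ip ip_norm L CL c c0 L_le L_ge L_sa E P E_fin L_E EP
    F K l l0 F_lip FE U g G r C1 s0 th rho n f Gr CG M r0 s00 C10 th0 rho0 rho1 CG0 M0
    G_lip G02 g_inc f_lip f_inc P_Gr f_Gr x e Ux (FM _ Ux) (Ke _ Ux) err th1).
exists n, (support_part ip L (P n) th f), (split_gradient L (P n) th Gr); split.
- by move=> x; rewrite (support_part_proj ip_norm L En EPn).
- move=> x; exact: (split_function_gradient ip_norm CL0 L_le L_sa En EPn (L_E n) (ltW th0) CG0 f_Gr).
- exists (CL + th * lG); first by rewrite addr_ge0 ?(ltW CL0)// mulr_ge0// ltW.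
  move=> x y; exact: (split_gradient_lip ip_norm CL0 L_le En EPn (ltW th0) Gr_lip).
- exact: (split_gradient_compact ip_norm CL0 L_le L_sa En EPn (L_E n) (ltW th0) lG0 Gr_lip P_Gr).
exists d, (th * mu1), (C * th ^+ 2), M, (th * 2 + th ^+ 2 + 2^-1 * CL * Rad ^+ 2).
split.
- by split=> //; rewrite ?mulr_gt0// exprn_gt0.
- move=> x Ux; split; first exact: FM.
  apply: le_trans (f_abs x) _; apply: lerD.
    by rewrite lerD2r ler_wpM2l ?(ltW th0)//; case/andP: (G02 (P n x)).
  rewrite ler_wpM2l ?mulr_ge0 ?invr_ge0 ?(ltW CL0)// ler_sqr ?nnegrE ?(ltW Rad0)//.
  by apply: le_trans (URad _ Ux); exact: oproj_residual_norm.
- move=> x Ux fx.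
  suff : 2 * C * th ^+ 2 <= S x by have := estimate x Ux; lra.
  rewrite leNgt; apply/negP => Sx.
  have := le_trans fx (f_abs x); apply/negP; rewrite -ltNge.
  have q0 := sqr_ge0 `|x - P n x|.
  have [Gx0 _] := andP (G02 (P n x)).
  have hG : th * G (P n x) <= 2 * C / l * th ^+ 2.
    rewrite -(ler_pM2l l0).
    have -> : l * (2 * C / l * th ^+ 2) = 2 * C * th ^+ 2 by field; rewrite gt_eqF.
    have : 0 <= 4^-1 * c ^+ 2 * `|x - P n x| ^+ 2.
      by rewrite mulr_ge0// mulr_ge0 ?invr_ge0// ltW.
    by move: Sx; rewrite /S; lra.
  have hq : 2^-1 * CL * `|x - P n x| ^+ 2 <= 4 * CL * C / c ^+ 2 * th ^+ 2.
    have k0 : 0 < c ^+ 2 / (2 * CL) by rewrite divr_gt0// mulr_gt0.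
    rewrite -(ler_pM2l k0).
    have -> : c ^+ 2 / (2 * CL) * (2^-1 * CL * `|x - P n x| ^+ 2) = 4^-1 * c ^+ 2 * `|x - P n x| ^+ 2.
      by field; rewrite gt_eqF.
    have -> : c ^+ 2 / (2 * CL) * (4 * CL * C / c ^+ 2 * th ^+ 2) = 2 * C * th ^+ 2.
      by field; rewrite !gt_eqF.
    have : 0 <= th * (l * G (P n x)) by rewrite !mulr_ge0 ?(ltW th0) ?(ltW l0).
    by move: Sx; rewrite /S; lra.
  have h3 : th * (C' * th) < th * (d * mu1 / (8 * M)) by rewrite ltr_pM2l.
  have -> : d * (th * mu1) / (8 * M) = th * (d * mu1 / (8 * M)) by ring.
  by move: h3; rewrite /C'; lra.
- move=> x Ux nball.
  suff : 2 * th * mu1 <= S x.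
    have := ler_wpM2l (ltW th0) th3; have := estimate x Ux; lra.
  have Gx := Gmu _ nball.
  set q := `|x - P n x|; have q0 : 0 <= q by exact: normr_ge0.
  have [Gx0 _] := andP (G02 (P n x)).
  (* Either [P n x] is so close to [x] that [G] is still at least [mu / 2] there, or the residual
     alone makes [S] large. *)
  have [qm|qm] := leP q (mu / 4).
    have := G_lip x (P n x); rewrite -/q ler_norml => /andP[_ h].
    have hG : mu / 2 <= G (P n x) by lra.
    have : th * (l * (mu / 2)) <= th * (l * G (P n x)).
      by rewrite ler_wpM2l ?(ltW th0)// ler_wpM2l ?(ltW l0).
    have : 0 <= 4^-1 * c ^+ 2 * q ^+ 2.
      by rewrite mulr_ge0 ?sqr_ge0// mulr_ge0 ?invr_ge0// ltW.
    by rewrite /S /mu1 -/q; lra.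
  have q2 : (mu / 4) ^+ 2 <= q ^+ 2 by rewrite ler_sqr ?nnegrE ?(ltW qm)// divr_ge0// ltW.
  have h1 := ler_wpM2l (ltW c20) q2.
  have h2 := ler_wpM2r (ltW mu0) th2.
  have : 0 <= th * (l * G (P n x)) by rewrite !mulr_ge0 ?(ltW th0) ?(ltW l0).
  by move: h1 h2; rewrite /S /mu1 -/q exprMn exprVn; lra.
Qed.

End GradientLikeFunction.

(** * Isolation along the homotopy and the theorem *)

Section GradientContinuation.
Variables (R : realType) (H : completeNormedModType R).
Variables (ip : {dot H for idfun}) (ip_norm : hilbert_norm ip).

Lemma lipschitzP (f : H -> H) : lipschitz f ->
  exists2 l : R, 0 < l & forall x y, `|f x - f y| <= l * `|x - y|.
Proof.
move=> /pinfty_ex_gt0[l l0 h]; exists l => // x y.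
by have := h (x, y); apply.
Qed.

Lemma lipschitz_from_bound (f : H -> H) (l : R) :
  (forall x y, `|f x - f y| <= l * `|x - y|) -> lipschitz f.
Proof.
move=> h; apply: (@klipschitzW _ _ _ l); last by move=> [x y] _; exact: h.
exact: (@globally_properfilter _ _ (0, 0)).
Qed.

(* Along an orbit of [(1 - s) F + s grad f] the increase of [f] dominates the
   arc length where the orbit stays near a point outside the interior of [U];
   having left that neighbourhood, [f] is too large for it ever to stop growing. *)
Lemma no_boundary_orbit (U : set H) (F Gd : H -> H) (f : H -> R)
    (d nu nu0 M B s : R) (c : R -> H) :
  0 < d -> 0 < nu -> 0 < nu0 -> 0 < M -> 0 <= s <= 1 ->
  (forall x, is_gradient ip f x (Gd x)) ->
  (forall x, U x -> `|F x| <= M /\ `|f x| <= B) ->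
  (forall x, U x -> d * nu / (8 * M) <= `|f x| -> nu0 <= ip (Gd x) (F x)) ->
  (forall x, U x -> ~ (ball x d `<=` U) -> nu <= ip (Gd x) (F x)) ->
  (forall t : R, is_derive t 1 c ((1 - s) *: F (c t) + s *: Gd (c t))) ->
  (forall t, U (c t)) -> U° (c 0).
Proof.
move=> d0 nup nu0p M0 /andP[s0 s1] grad bnd far_f far_U dc Uc.
apply: contrapT => nU.
pose X t := (1 - s) *: F (c t) + s *: Gd (c t).
pose da t := ip (Gd (c t)) (X t).
have Da (t : R) : is_derive t 1 (fun t => f (c t)) (da t).
  exact: is_gradient_comp (grad _) (dc t).
have daE t : da t = (1 - s) * ip (Gd (c t)) (F (c t)) + s * `|Gd (c t)| ^+ 2.
  by rewrite /da /X (ipDr ip) !(ipZr ip) ip_norm.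
have s1' : 0 <= 1 - s by rewrite subr_ge0.
(* The derivative of [f] is a convex combination of [<Gd, F>] and [|Gd|^2]; bounding both from below
   gives a bound uniform in [s]. *)
have grow t v : 0 < v -> v <= ip (Gd (c t)) (F (c t)) ->
    v / M <= `|Gd (c t)| /\ Num.min v ((v / M) ^+ 2) <= da t.
  move=> v0 vG; have [FM _] := bnd _ (Uc t).
  have vMG : v / M <= `|Gd (c t)|.
    rewrite ler_pdivrMr//; apply: le_trans vG _.
    apply: le_trans (ip_le ip_norm _ _) _; exact: ler_wpM2l.
  split=> //; rewrite daE.
  have vM2 : (v / M) ^+ 2 <= `|Gd (c t)| ^+ 2.
    by rewrite ler_sqr ?nnegrE// divr_ge0// ltW.
  set m := Num.min _ _.
  have m1 : m <= ip (Gd (c t)) (F (c t)) by apply: le_trans vG; rewrite ge_min lexx.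
  have m2 : m <= `|Gd (c t)| ^+ 2 by apply: le_trans vM2; rewrite ge_min lexx orbT.
  have := ler_wpM2l s1' m1; have := ler_wpM2l s0 m2; lra.
pose m1 := Num.min nu ((nu / M) ^+ 2); pose m0 := Num.min nu0 ((nu0 / M) ^+ 2).
have m10 : 0 < m1 by rewrite lt_min nup exprn_gt0// divr_gt0.
have m00 : 0 < m0 by rewrite lt_min nu0p exprn_gt0// divr_gt0.
(* Near the start, half of the growth pays for arc length and half remains. Together with the 4 in
   [escape_sym] this explains the 8 in the threshold. *)
pose w := Num.min (m1 / 2) m0; have w0 : 0 < w by rewrite lt_min m00 divr_gt0.
have B0 : 0 <= B by apply: le_trans (bnd _ (Uc 0)).2.
(* Over this time span [f] would reach [B + 1], above its bound on [U]. *)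
pose T := (B + 1) / w.
have T0 : 0 <= T by rewrite divr_ge0 ?addr_ge0// ltW.
have k0 : 0 <= d * nu / (8 * M) by rewrite divr_ge0 ?mulr_ge0// ltW.
have [t _ td|t _ _ tk|t _] := escape_sym ip_norm T0 d0 k0 w0 dc Da.
(* A ball of radius [d] about [c t] contains [c 0]; inside [U] it would make [c 0] an interior
   point. *)
- have nball : ~ (ball (c t) d `<=` U).
    move=> bU; apply: nU; apply: (filterS bU).
    by apply: open_nbhs_nbhs; split; [exact: ball_open|rewrite -ball_normE].
  have vG := far_U _ (Uc t) nball.
  have [vMG mda] := grow t nu nup vG.
  have [FM _] := bnd _ (Uc t).
  have hX : `|X t| <= (1 - s) * M + s * `|Gd (c t)|.
    apply: le_trans (ler_normD _ _) _; rewrite !normrZ !ger0_norm// lerD2r.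
    exact: ler_wpM2l.
  have hda : nu / M * `|X t| <= da t.
    apply: (@le_trans _ _ (nu / M * ((1 - s) * M + s * `|Gd (c t)|))).
      by rewrite ler_wpM2l// divr_ge0// ltW.
    rewrite daE mulrDr mulrCA divfK ?gt_eqF//; apply: lerD.
      exact: ler_wpM2l.
    by rewrite mulrCA ler_wpM2l// expr2 ler_wpM2r.
  have -> : 4 * (d * nu / (8 * M)) / d = 2^-1 * (nu / M) by field; rewrite !gt_eqF.
  have : w <= m1 / 2 by rewrite ge_min lexx.
  by rewrite -/(X t) -mulrA; move: mda; rewrite -/m1; lra.
- have [_] := grow t nu0 nu0p (far_f _ (Uc t) tk).
  by apply: le_trans; rewrite ge_min lexx orbT.
rewrite /T mulrCA divff ?gt_eqF// mulr1 => hB.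
by have := (bnd _ (Uc t)).2; lra.
Qed.

(* Clipping the homotopy parameter to [0, 1] gives a family of flows depending
   continuously on a parameter in all of [R]. *)
Definition clip (s : R) : R := Num.max 0 (Num.min s 1).

Lemma clip_itv s : 0 <= clip s <= 1.
Proof. by rewrite /clip le_max lexx/= ge_max ler01 ge_min lexx orbT. Qed.

Lemma clip_id s : 0 <= s <= 1 -> clip s = s.
Proof. by move=> /andP[s0 s1]; rewrite /clip (min_l s1) (max_r s0). Qed.

Lemma clip_lip s s' : `|clip s - clip s'| <= `|s - s'|.
Proof.
rewrite /clip; case: (leP s 1) => h1; case: (leP s' 1) => h2;
  [case: (leP 0 s) => h3; case: (leP 0 s') => h4|
   case: (leP 0 s) => h3; rewrite (max_r ler01)|
   case: (leP 0 s') => h4; rewrite (max_r ler01)|];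
  have := ler_norm (s - s'); have := ler_norm (s' - s); rewrite (distrC s');
  rewrite ?subrr ?normr0// => p q; rewrite ler_norml; apply/andP; split; lra.
Qed.

End GradientContinuation.

Theorem theorem4p2 (R : realType) (H : completeNormedModType R)
    (ip : {dot H for idfun}) (ip_norm : hilbert_norm ip)
    (H_separable : separable H)
    (L : {linear H -> H}) (L_bounded : bounded_operator L)
    (L_selfadjoint : selfadjoint ip L) (L_invertible : invertible_operator L)
    (E : nat -> set H) (E_fin_dim : forall n, fin_dim_subspace (E n))
    (E_increasing : forall n, E n `<=` E n.+1)
    (E_dense : closure (\bigcup_n E n) = setT)
    (L_E : forall n, L @` E n = E n)
    (P : nat -> H -> H)
    (P_proj : forall n, orthogonal_projection ip (E n) (P n))
    (F : H -> H) (F_LS : LS_vector_field L F)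
    (F_C1 : continuously_differentiable F)
    (phi : H -> R -> H) (phi_flow : generated_by F phi)
    (U : set H) (U_isolating : isolating_neighborhood U phi) :
  exists (b : H -> R) (psi : H -> R -> H),
    [/\ fin_dim_support P b,
        LS_gradient_flow_on ip L U (fun x => 2^-1 * ip (L x) x - b x) psi
      & related_by_continuation L U phi psi].
Proof.
have [CL CL0 L_le] : exists2 CL : R, 0 < CL & forall x, `|L x| <= CL * `|x|.
  have [C hC] := L_bounded; exists (`|C| + 1) => [|x]; first by rewrite ltr_wpDl.
  apply: le_trans (hC x) _; rewrite ler_wpM2r// (le_trans (ler_norm _))//.
  by rewrite lerDl.
have [c c0 L_ge] : exists2 c : R, 0 < c & forall x, c * `|x| <= `|L x|.
  have [M [[C hC] LM _]] := L_invertible.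
  have C1 : 0 < `|C| + 1 by rewrite ltr_wpDl.
  exists (`|C| + 1)^-1 => [|x]; first by rewrite invr_gt0.
  rewrite ler_pdivrMl// -{1}[x]LM; apply: le_trans (hC _) _.
  by rewrite ler_wpM2r// (le_trans (ler_norm _))// lerDl.
have [F_lips [K K_cc FE]] := F_LS.
have [l l0 F_lip] := lipschitzP F_lips.
have [n [b [Gd [b_n grad [lG lG0 Gd_lip] Gd_cc
    [d [nu [nu0 [M [B [[d0 nup nu0p M0] bnd far_f far_U]]]]]]]]]] :=
  gradient_like_function ip_norm CL0 c0 L_le L_ge L_selfadjoint E_fin_dim
    E_increasing E_dense L_E P_proj l0 F_lip FE K_cc phi_flow U_isolating.
pose X (s : R) x := (1 - clip s) *: F x + clip s *: Gd x.
have X_lip s x y : `|X s x - X s y| <= (l + lG) * `|x - y|.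
  have /andP[s0 s1] := clip_itv s; have s1' : 0 <= 1 - clip s by rewrite subr_ge0.
  have -> : X s x - X s y = (1 - clip s) *: (F x - F y) + clip s *: (Gd x - Gd y).
    by rewrite /X opprD addrACA !scalerBr.
  apply: le_trans (ler_normD _ _) _; rewrite !normrZ !ger0_norm// [leRHS]mulrDl.
  apply: lerD; rewrite -[leRHS]mul1r.
    by apply: ler_pM => //; rewrite gerBl.
  exact: ler_pM.
(* [Gd - F] grows at most linearly, with this constant. *)
pose D := `|Gd 0 - F 0| + (l + lG).
have D0 : 0 <= D by rewrite !addr_ge0// ltW.
have XE s x : X s x = F x + clip s *: (Gd x - F x).
  by rewrite /X scalerBl scale1r scalerBr -addrA [- _ + _]addrC.
have X_par s s' x : `|X s x - X s' x| <= D * `|s - s'| * (1 + `|x|).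
  have -> : X s x - X s' x = (clip s - clip s') *: (Gd x - F x).
    by rewrite !XE opprD addrACA subrr add0r -scalerBl.
  rewrite normrZ [D * _]mulrC -mulrA; apply: ler_pM => //; first exact: clip_lip.
  have -> : Gd x - F x = (Gd 0 - F 0) + ((Gd x - Gd 0) - (F x - F 0)).
    have -> : (Gd x - Gd 0) - (F x - F 0) = (Gd x - F x) - (Gd 0 - F 0).
      by rewrite !opprD !opprK addrACA.
    by rewrite [RHS]addrC subrK.
  have h1 := F_lip x 0; have h2 := Gd_lip x 0; rewrite subr0 in h1 h2.
  apply: le_trans (ler_normD _ _) _.
  apply: le_trans (lerD (lexx _) (ler_normB _ _)) _.
  have x0 := normr_ge0 x; have g0 := normr_ge0 (Gd 0 - F 0).
  have := mulr_ge0 g0 x0; rewrite /D; lra.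
(* Both fields have the linear part [L], so convex combinations keep it and only the compact parts
   are mixed. *)
have X_LS s : LS_vector_field L (X s).
  split; first exact: lipschitz_from_bound (X_lip s).
  exists (fun x => (1 - clip s) *: K x + clip s *: (Gd x - L x)) => [A bA|x].
    by apply: precompact_comb; [exact: K_cc|exact: Gd_cc].
  rewrite /X FE scalerDr [_ *: (Gd x - _)]scalerBr [_ *: L x]scalerBl scale1r.
  by rewrite -!addrA; congr (_ + _); rewrite addrC -addrA.
have [Phi [Phi_flow Phi_cont]] := lipschitz_family_flow ip_norm
  (addr_ge0 (ltW l0) lG0) D0 X_lip X_par.
have X1 : X 1 = Gd.
  by apply/funext => x; rewrite /X clip_id ?ler01 ?lexx// subrr scale0r add0r scale1r.
have X0 : X 0 = F.
  by apply/funext => x; rewrite /X clip_id ?ler01 ?lexx// subr0 scale0r addr0 scale1r.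
exists b, (Phi 1); split.
- by exists n.
- exists Gd; split; [by rewrite -X1|by rewrite -X1|].
  by move=> x _; exact: grad.
- exists (fun p : R * H * R => Phi p.1.1 p.1.2 p.2); split => //.
  + exact: continuous_subspaceT.
  + move=> x t /=.
    (* The constructed flow at parameter 0 is the given [phi] by uniqueness of solutions. *)
    have F0 := Phi_flow 0; rewrite X0 in F0.
    exact: (generated_by_unique ip_norm (ltW l0) F_lip F0 phi_flow).
  + move=> s s01 /=; split; first by exists (X s).
    have [Ucl Ubd _] := U_isolating; split=> // x [_ Ux].
    have [[_ Phi0 _] dPhi] := Phi_flow s.
    rewrite -[x](Phi0 x).
    apply: (no_boundary_orbit ip_norm d0 nup nu0p M0 s01 grad bnd far_f far_U) => // t.
    by have := dPhi x t; rewrite /X clip_id.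
Qed.
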